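(* Let $N\ge2$ and $q=2(N+1)/(N-1)$. Then $$\mathcal R_N \ge \frac{2^{q/2}}{\sqrt\pi}\,\frac{\Gamma(\frac{q+1}{2})}{\Gamma(\frac{q+2}{2})}\,\mathcal S_{N-1}.$$ Moreover, the strict inequality is necessary for precompactness of all maximizing sequences: if every sequence $(f_n)\subset L^2(\mathbb S^{N-1})$ with $\|f_n\|=1$ for all $n$ and $\int_{\mathbb R^N}|\check f_n|^q\,dx\to\mathcal R_N$ is precompact in $L^2(\mathbb S^{N-1})$ up to modulations, then $$\mathcal R_N > \frac{2^{q/2}}{\sqrt\pi}\,\frac{\Gamma(\frac{q+1}{2})}{\Gamma(\frac{q+2}{2})}\,\mathcal S_{N-1}.$$
   Context: Functions are complex-valued. For $f\in L^2(\mathbb S^{N-1})$, with $d\omega$ the surface measure on $\mathbb S^{N-1}$, set $\check f(x)=(2\pi)^{-N/2}\int_{\mathbb S^{N-1}}e^{ix\cdot\omega}f(\omega)\,d\omega$, $x\in\mathbb R^N$. The norm of $L^2(\mathbb S^{N-1})$ or $L^2(\mathbb R^d)$ is denoted $\|\cdot\|$. Optimal Stein--Tomas constant: $\mathcal R_N:=\sup_{0\not\equiv f\in L^2(\mathbb S^{N-1})}\|f\|^{-q}\int_{\mathbb R^N}|\check f|^q\,dx$, with $q=2(N+1)/(N-1)$. Optimal Strichartz constant, for $d\ge1$: $\mathcal S_d:=(2\pi)^{-(d+2)/d}\sup_{0\ne\psi\in L^2(\mathbb R^d)}\|\psi\|^{-(2+4/d)}\iint_{\mathbb R\times\mathbb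 R^d}|(e^{it\Delta/2}\psi)(x)|^{2+4/d}\,dx\,dt$. A sequence $(f_n)\subset L^2(\mathbb S^{N-1})$ is precompact in $L^2(\mathbb S^{N-1})$ up to modulations if there are a subsequence $(f_{n_k})$ and a sequence $(a_k)\subset\mathbb R^N$ such that the functions $\omega\mapsto e^{-ia_k\cdot\omega}f_{n_k}(\omega)$ converge in $L^2(\mathbb S^{N-1})$. *)

(* Defs.v *)
From HB Require Import structures.
From mathcomp Require Import all_boot all_order all_algebra.
From mathcomp Require Import all_classical all_reals all_analysis.
From mathcomp Require Import measurable_realfun.
From mathcomp Require Import complex.

(* R[i] is the field of complex numbers over R : realType.  It carries no
   measurable structure here, so measurability and integration of
   complex-valued functions are defined on real and imaginary parts. *)

Set Implicit Arguments.
Unset Strict Implicit.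
Unset Printing Implicit Defensive.

Import Order.TTheory GRing.Theory Num.Theory.
Import numFieldNormedType.Exports.

Local Open Scope classical_set_scope.
Local Open Scope ring_scope.

(* R^n, with the product Borel sigma-algebra. *)
Notation euc R n := (n.-tuple (measurableTypeR R)).

Section Euclidean.
Context {R : realType} {n : nat}.
Implicit Types x y : euc R n.

Definition dot x y : R := \sum_(i < n) (tnth x i : R) * (tnth y i : R).

Definition enorm x : R := Num.sqrt (dot x x).

Definition escale (c : R) x : euc R n :=
  [tuple (c * (tnth x i : R) : measurableTypeR R) | i < n].

Definition sphere : set (euc R n) := [set x | enorm x = 1].

Lemma measurable_coord (i : 'I_n) :
  measurable_fun [set: euc R n] (fun x => tnth x i : R).
Proof. exact: measurable_tnth. Qed.

Lemma dot_ge0 x : 0 <= dot x x.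
Proof. by apply: sumr_ge0 => i _; rewrite -expr2 sqr_ge0. Qed.

Lemma dot_scale c x : dot (escale c x) (escale c x) = c ^+ 2 * dot x x.
Proof.
rewrite /dot mulr_sumr; apply: eq_bigr => i _.
by rewrite !tnth_mktuple expr2 mulrACA.
Qed.

Lemma measurable_enorm : measurable_fun [set: euc R n] enorm.
Proof.
apply: (@measurableT_comp _ _ _ _ _ _ (@Num.sqrt R)).
  by apply: continuous_measurable_fun; exact: sqrt_continuous.
apply: measurable_sum => i.
by apply: measurable_funM; exact: measurable_coord.
Qed.

Definition sphere_proj x : euc R n := escale (enorm x)^-1 x.

Lemma measurable_sphere_proj : measurable_fun [set: euc R n] sphere_proj.
Proof.
apply/measurable_fun_tnthP => i.
have -> : @tnth n _ ^~ i \o sphere_proj =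
    (fun x => (enorm x `^ (-1)) * (tnth x i : R)).
  apply/funext => x /=; rewrite tnth_mktuple powR_inv1//.
  exact: sqrtr_ge0.
apply: measurable_funM; last exact: measurable_coord.
apply: (@measurableT_comp _ _ _ _ _ _ (fun r : R => r `^ (-1))).
  exact: measurable_powR.
exact: measurable_enorm.
Qed.

HB.instance Definition _ :=
  isMeasurableFun.Build _ _ _ _ sphere_proj measurable_sphere_proj.

Lemma sphere_proj_sphere x : 0 < enorm x -> sphere (sphere_proj x).
Proof.
move=> x0; rewrite /sphere /= {1}/enorm dot_scale sqrtrM ?sqr_ge0//.
rewrite sqrtr_sqr ger0_norm ?invr_ge0 ?(ltW x0)//.
by rewrite mulVf// gt_eqF.
Qed.

Definition punctured_ball : set (euc R n) := [set x | 0 < enorm x <= 1].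

Lemma measurable_punctured_ball : measurable punctured_ball.
Proof.
have -> : punctured_ball = setT `&` enorm @^-1` `]0, 1]%classic.
  by rewrite setTI; apply/seteqP; split => x /=; rewrite in_itv.
exact: measurable_enorm.
Qed.

End Euclidean.

Section LebesgueStep.
Context {R : realType} {n : nat}.
Variable m : {sigma_finite_measure set (euc R n) -> \bar R}.

Definition tuple_cons (z : measurableTypeR R * euc R n) : euc R n.+1 :=
  [tuple of z.1 :: z.2].

Lemma measurable_tuple_cons : measurable_fun setT tuple_cons.
Proof.
apply: (@measurable_cons _ _ _ _ fst n snd).
  exact: measurable_fst.
exact: measurable_snd.
Qed.

HB.instance Definition _ :=
  isMeasurableFun.Build _ _ _ _ tuple_cons measurable_tuple_cons.

(* Image of (Lebesgue measure on R) x m under R * R^n = R^(n+1). *)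
Definition cons_measure : set (euc R n.+1) -> \bar R :=
  pushforward ((@lebesgue_measure R) \x m)%E tuple_cons.

Let cons_measure0 : cons_measure set0 = 0%E.
Proof. by rewrite /cons_measure /pushforward preimage_set0 measure0. Qed.

Let cons_measure_ge0 A : (0 <= cons_measure A)%E.
Proof. exact: measure_ge0. Qed.

Let cons_measure_sigma_additive : semi_sigma_additive cons_measure.
Proof. exact: (@measure_semi_sigma_additive _ _ _ (pushforward _ _)). Qed.

HB.instance Definition _ := isMeasure.Build _ _ _ cons_measure
  cons_measure0 cons_measure_ge0 cons_measure_sigma_additive.

Let cons_measure_sigma_finite : sigma_finite setT cons_measure.
Proof.
have /sigma_finiteP[F [TF ndF Foo]] := sigma_finiteT (@lebesgue_measure R).
have /sigma_finiteP[G [TG ndG Goo]] := sigma_finiteT m.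
pose u (t : euc R n.+1) : measurableTypeR R * euc R n :=
  (tnth t ord0, [tuple of behead t]).
have mu : measurable_fun setT u.
  apply/measurable_fun_pairP; split.
    exact: measurable_tnth.
  exact: measurable_behead.
have uK : cancel tuple_cons u.
  by move=> [a b]; rewrite /u /= tnth0; congr pair; exact/val_inj.
exists (fun k => u @^-1` (F k `*` G k)).
  apply/esym; rewrite -subTset => t _.
  have [i _ Fi] : (\bigcup_i F i) (u t).1 by rewrite -TF.
  have [j _ Gj] : (\bigcup_i G i) (u t).2 by rewrite -TG.
  exists (maxn i j) => //; split => /=.
    by move: Fi; apply/subsetPset/ndF/leq_maxl.
  by move: Gj; apply/subsetPset/ndG/leq_maxr.
move=> k; have [mF Fk] := Foo k; have [mG Gk] := Goo k.
have mFG : measurable (F k `*` G k) by exact: measurableX.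
split; first by rewrite -[X in measurable X]setTI; exact: mu.
rewrite /cons_measure /pushforward -comp_preimage.
rewrite (_ : u \o tuple_cons = id); last by apply/funext => z /=; rewrite uK.
rewrite preimage_id product_measure1E// lte_mul_pinfty// ge0_fin_numE//.
Qed.

HB.instance Definition _ := Measure_isSigmaFinite.Build _ _ _ cons_measure
  cons_measure_sigma_finite.

End LebesgueStep.

Fixpoint lebesgue_euc (R : realType) (n : nat) :
    {sigma_finite_measure set (euc R n) -> \bar R} :=
  if n is k.+1 then cons_measure (lebesgue_euc R k)
  else \d_([tuple] : euc R 0).

Section ConeMeasure.
Context {R : realType} {n : nat}.
Local Open Scope ereal_scope.

(* Volume of the cone {r w | 0 < r <= 1, w in A} over a subset A of the unit
   sphere. *)
Definition cone_measure (A : set (euc R n)) : \bar R :=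
  lebesgue_euc R n [set x | (0 < enorm x <= 1)%R /\ A (sphere_proj x)].

Let cone_measureE : cone_measure =
  pushforward (mrestr (lebesgue_euc R n) measurable_punctured_ball) sphere_proj.
Proof.
apply/funext => A; rewrite /cone_measure /pushforward /mrestr.
by congr (lebesgue_euc R n _); apply/seteqP; split => x [].
Qed.

Let cone_measure0 : cone_measure set0 = 0.
Proof. by rewrite cone_measureE /pushforward preimage_set0 measure0. Qed.

Let cone_measure_ge0 A : 0 <= cone_measure A.
Proof. exact: measure_ge0. Qed.

Let cone_measure_sigma_additive : semi_sigma_additive cone_measure.
Proof.
rewrite cone_measureE.
exact: (@measure_semi_sigma_additive _ _ _ (pushforward _ _)).
Qed.

HB.instance Definition _ := isMeasure.Build _ _ _ cone_measure
  cone_measure0 cone_measure_ge0 cone_measure_sigma_additive.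

End ConeMeasure.

Section SurfaceMeasure.
Context {R : realType} {n : nat}.
Local Open Scope ereal_scope.

(* Surface measure on the unit sphere of R^n, through polar coordinates: the
   area of A is n times the volume of the cone over A.  It is a measure on R^n
   that is carried by the sphere (surface_measure_sphereC), so functions on the
   sphere are represented by functions on R^n, whose values off the sphere are
   irrelevant. *)
Definition surface_measure : set (euc R n) -> \bar R :=
  mscale ((n%:R : R)%:nng)%R cone_measure.

HB.instance Definition _ := Measure.on surface_measure.

Lemma surface_measure_sphereC : surface_measure (~` sphere) = 0.
Proof.
rewrite /surface_measure /mscale /= /cone_measure.
rewrite (_ : [set x | _] = set0); first by rewrite measure0 mule0.
by apply/seteqP; split => x //= [/andP[x0 _]]; case; exact: sphere_proj_sphere.
Qed.

End SurfaceMeasure.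

Section ComplexFunctions.
Context {R : realType}.

Definition cis (t : R) : R[i] := (cos t +i* sin t)%C.

Definition cmod (z : R[i]) : R := complex.ComplexField.Normc.normc z.

Context {d : measure_display} {T : measurableType d}.
Variable mu : {measure set T -> \bar R}.
Implicit Types f : T -> R[i].

Definition cmeasurable f :=
  measurable_fun setT (fun x => complex.Re (f x)) /\
  measurable_fun setT (fun x => complex.Im (f x)).

Definition cint f : R[i] :=
  (\int[mu]_x complex.Re (f x) +i* \int[mu]_x complex.Im (f x))%C.

Definition L2norm f : \bar R := ('N[mu]_2%:E[EFin \o (cmod \o f)])%E.

Definition inL2 f := cmeasurable f /\ (L2norm f < +oo)%E.

Definition ae_zero f := {ae mu, forall x, f x = 0}.

End ComplexFunctions.

Section Fourier.
Context {R : realType} {n : nat}.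
Implicit Types f g : euc R n -> R[i].

(* (2 pi)^(-n/2) \int e^(i s x.y) f(y) dmu(y); s = -1 gives the Fourier
   transform, s = 1 the inverse one. *)
Definition fourier_int (s : R) (mu : {measure set (euc R n) -> \bar R}) f
    (x : euc R n) : R[i] :=
  (((2 * pi) `^ (- (n%:R / 2)))%:C)%C *
  cint mu (fun y => cis (s * dot x y) * f y).

Definition ball_cut (k : nat) f (x : euc R n) : R[i] :=
  if enorm x <= k%:R then f x else 0.

(* The Fourier transform on L^2(R^n), as the limit in the mean of the
   Fourier integrals of the truncated functions; it is defined up to a null
   set, of which fourierL2 chooses a representative. *)
Definition is_fourierL2 (s : R) f g :=
  inL2 (lebesgue_euc R n) g /\
  (fun k : nat => L2norm (lebesgue_euc R n) (fun x =>
     fourier_int s (lebesgue_euc R n) (ball_cut k f) x - g x))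
    @ \oo --> 0%E.

Definition fourierL2 (s : R) f : euc R n -> R[i] :=
  xget (fun=> 0) [set g | is_fourierL2 s f g].

(* e^(i t Delta / 2) psi *)
Definition schroedinger (t : R) (psi : euc R n -> R[i]) : euc R n -> R[i] :=
  fourierL2 1
    (fun xi => cis (- (t * dot xi xi / 2)) * fourierL2 (-1) psi xi).

End Fourier.

Section Constants.
Context {R : realType}.
Local Open Scope ereal_scope.

Definition st_exponent (N : nat) : R := (2 * (N%:R + 1) / (N%:R - 1))%R.

Definition extension (N : nat) (f : euc R N -> R[i]) : euc R N -> R[i] :=
  fourier_int 1 surface_measure f.

Definition extension_int (N : nat) (f : euc R N -> R[i]) : \bar R :=
  \int[lebesgue_euc R N]_x ((cmod (extension f x)) `^ (st_exponent N))%:E.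

Definition stein_tomas (N : nat) : \bar R :=
  ereal_sup [set L2norm surface_measure f `^ (- st_exponent N) *
                 extension_int f |
             f in [set f : euc R N -> R[i] |
                   inL2 surface_measure f /\ ~ ae_zero surface_measure f]].

Definition strichartz_exponent (d : nat) : R := (2 + 4 / d%:R)%R.

(* The space-time integral is written as an iterated one: the inner integral
   depends only on the class of e^(i t Delta / 2) psi in L^2(R^d), hence not
   on the representatives chosen separately for each t. *)
Definition strichartz_int (d : nat) (psi : euc R d -> R[i]) : \bar R :=
  \int[@lebesgue_measure R]_t \int[lebesgue_euc R d]_x
    ((cmod (schroedinger (t : R) psi x)) `^ (strichartz_exponent d))%:E.

Definition strichartz (d : nat) : \bar R :=
  ((2 * pi) `^ (- ((d%:R + 2) / d%:R)))%:E *
  ereal_sup [set L2norm (lebesgue_euc R d) psi `^ (- strichartz_exponent d) *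
                 strichartz_int psi |
             psi in [set psi : euc R d -> R[i] |
                     inL2 (lebesgue_euc R d) psi /\
                     ~ ae_zero (lebesgue_euc R d) psi]].

Definition Gamma (s : R) : R :=
  (\int[@lebesgue_measure R]_(t in `]0%R, +oo[) (t `^ (s - 1) * expR (- t)))%R.

Definition precompact_up_to_modulations (N : nat)
    (f : nat -> euc R N -> R[i]) : Prop :=
  exists (k : nat -> nat) (a : nat -> euc R N) (g : euc R N -> R[i]),
    [/\ {homo k : i j / (i < j)%N >-> (i < j)%N},
        inL2 surface_measure g &
        (fun j => L2norm surface_measure (fun w =>
           (cis (- dot (a j) w) * f (k j) w - g w)%R)) @ \oo --> 0].

End Constants.

(* Main.v *)
From HB Require Import structures.
Require Import Defs.
From mathcomp Require Import all_boot all_order all_algebra.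
From mathcomp Require Import all_classical all_reals all_analysis.
From mathcomp Require Import complex.
From mathcomp Require Import measurable_realfun ring lra.

(** Functions that concentrate at two antipodal points of the sphere transplant
    the Strichartz functional, up to the explicit constant, into the Stein-Tomas
    functional.

    Write N = n + 1 and q = 2 + 4 / n. The gnomonic coordinate of the point
    (1, v) / <v> of the northern hemisphere is v, with <v>^2 = 1 + |v|^2. Take
    a function [g] on a cap around the north pole and its conjugate on the
    antipodal cap ([cap_pair]): the extension is then real, equal to 2 (2
    pi)^(-N/2) Re E, where E is the oscillatory integral over the north cap
    ([extension_cap_pair]). Replacing [g] by e^(i a) [g] rotates E, and
    averaging |Re (e^(i a) E)|^q over a produces |E|^q times the mean of
    |cos|^q ([phase_average]); that mean dominates the quotient of Gamma
    functions over the root of pi ([gamma_ratio_le_cos]). No asymptotic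
    analysis of rapid oscillations is involved: the average is exact.

    With [g] v = phi (v / e) and the point (t / e^2, y / e), the phase of E is
    t / e^2 plus a term that tends to y.xi - t |xi|^2 / 2 as e tends to 0, so |E|
    tends after scaling to the modulus of the solution of the Schroedinger
    equation with Fourier data phi, and Fatou's lemma passes to the limit
    ([concentration_bound]).  The powers of e cancel because n q / 2 = n + 2.
    Hence any bound for the Stein-Tomas functional on functions supported near
    the poles, however near, bounds the Strichartz constant
    ([strichartz_le_concentrated]).  To apply this to arbitrary data psi,
    the Fourier transform of psi is truncated to balls ([strichartz_int_le]) and
    its L^2 norm is bounded by that of psi: Plancherel's inequality, proved with
    the Poisson kernel ([bessel], [L2sq_fourierL2]).

    Taking for the bound the Stein-Tomas constant itself gives the first claim.
    For the second, suppose that equality holds.  Then functions of norm one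
    supported in caps of radius 1 / (j + 1) form a maximizing sequence
    ([concentrated_competitor]).  Modulations preserve supports, so an L^2 limit
    along a subsequence vanishes off the poles, hence almost everywhere
    ([concentrating_limit_null]), although its norm is one. *)

Set Implicit Arguments.
Unset Strict Implicit.
Unset Printing Implicit Defensive.

Import Order.TTheory GRing.Theory Num.Theory.
Import numFieldNormedType.Exports.

Local Open Scope classical_set_scope.
Local Open Scope ring_scope.

(** * Linear substitutions in R^n *)

Section AffineSubstitution.
Context {R : realType}.
Local Notation mu := (@lebesgue_measure R).

Definition affine (a b : R) (x : measurableTypeR R) : measurableTypeR R :=
  a * x + b.

Lemma measurable_affine a b : measurable_fun setT (affine a b).
Proof.
apply: measurable_funD; last exact: measurable_cst.
by apply: measurable_funM => //; exact: measurable_cst.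
Qed.

Lemma preimage_affine_itv (a b u v : R) : 0 < a ->
  affine a b @^-1` `]u, v]%classic = `](u - b) / a, (v - b) / a]%classic.
Proof.
move=> a0; apply/seteqP; split => x; rewrite /= !in_itv /= /affine.
  by rewrite ltr_pdivrMr// ler_pdivlMr// [x * a]mulrC ltrBlDr lerBrDr.
by rewrite ltr_pdivrMr// ler_pdivlMr// [x * a]mulrC ltrBlDr lerBrDr.
Qed.

Lemma ge0_integral_affine_pos (a b : R) (h : measurableTypeR R -> \bar R) :
  0 < a -> measurable_fun setT h -> (forall x, 0 <= h x)%E ->
  (\int[mu]_x h (a * x + b)%R = a^-1%:E * \int[mu]_x h x)%E.
Proof.
move=> a0 mh h0.
rewrite -[LHS](@ge0_integral_pushforward _ _ _ _ _ _ (measurable_affine a b) mu setT h)//.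
rewrite -[LHS]mul1e -(mulVf (lt0r_neq0 a0)) EFinM -muleA; congr (_ * _)%E.
rewrite -(@ge0_integral_mscale _ _ _ _ _ _ (NngNum (ltW a0)))//.
  exact: measurable_affine.
move=> mphi; apply: eq_measure_integral => A mA _; apply/esym.
apply: lebesgue_measure_unique mA => _ [[u v]] _ <-.
rewrite -[RHS]/(a%:E * mu (affine a b @^-1` `]u, v]%classic))%E.
rewrite preimage_affine_itv//.
rewrite !lebesgue_measure_itv/= !lte_fin ltr_pM2r ?invr_gt0// ltrD2r.
case: ifPn => _; last by rewrite mule0.
by rewrite -!EFinD -EFinM; congr EFin; field; rewrite gt_eqF.
Qed.

Lemma ge0_integralN (h : measurableTypeR R -> \bar R) :
  measurable_fun setT h -> (forall x, 0 <= h x)%E ->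
  (\int[mu]_x h (- x)%R = \int[mu]_x h x)%E.
Proof.
move=> mh h0.
rewrite -[LHS](@ge0_integral_pushforward _ _ _ _ _ _ _ mu setT h)//.
by apply: eq_measure_integral => A mA _; exact: lebesgue_measureN.
Qed.

Lemma ge0_integral_affine (a b : R) (h : measurableTypeR R -> \bar R) :
  a != 0 -> measurable_fun setT h -> (forall x, 0 <= h x)%E ->
  (\int[mu]_x h (a * x + b)%R = `|a|^-1%:E * \int[mu]_x h x)%E.
Proof.
move=> a0 mh h0; have [a0'|a0'|/eqP] := ltrgt0P a; last by rewrite (negbTE a0).
  exact: ge0_integral_affine_pos.
rewrite -(@ge0_integral_affine_pos _ b)// ?oppr_gt0//.
rewrite -[RHS]ge0_integralN//.
  by apply: eq_integral => x _; rewrite mulrNN.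
apply: measurableT_comp => //; exact: measurable_affine.
Qed.

Lemma ge0_integral_scaleZ (c k : R) (h : measurableTypeR R -> \bar R) :
  c != 0 -> 0 <= k -> measurable_fun setT h -> (forall x, 0 <= h x)%E ->
  (\int[mu]_x (k%:E * h (c * x)%R) = (`|c|^-1 * k)%:E * \int[mu]_x h x)%E.
Proof.
move=> c0 k0 mh h0; rewrite ge0_integralZl//; last first.
  apply: (measurableT_comp mh).
  by apply: measurable_funM => //; exact: measurable_cst.
rewrite mulrC EFinM -muleA -(ge0_integral_affine 0)//; congr (_ * _)%E.
by apply: eq_integral => x _; rewrite addr0.
Qed.

End AffineSubstitution.

Section EuclideanIntegral.
Context {R : realType}.
Local Notation mu := (@lebesgue_measure R).
Local Notation leb := (lebesgue_euc R).

Lemma measurable_escale_pair n :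
  measurable_fun setT (fun z : measurableTypeR R * euc R n => escale z.1 z.2).
Proof.
apply/measurable_fun_tnthP => i.
rewrite (_ : _ \o _ = (fun z : measurableTypeR R * euc R n =>
  (z.1 : R) * (tnth z.2 i : R))); last first.
  by apply/funext => z /=; rewrite tnth_mktuple.
apply: measurable_funM; first exact: measurable_fst.
by apply: (measurableT_comp (measurable_tnth i)); exact: measurable_snd.
Qed.

Lemma measurable_escale n (c : R) : measurable_fun setT (@escale R n c).
Proof.
apply: (measurableT_comp (@measurable_escale_pair n) (g := fun x => (c, x))).
exact: pair1_measurable.
Qed.

Lemma ge0_integral_cons n (F : euc R n.+1 -> \bar R) :
  measurable_fun setT F -> (forall x, 0 <= F x)%E ->
  (\int[leb n.+1]_x F x = \int[mu]_s \int[leb n]_y F (tuple_cons (s, y)))%E.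
Proof.
move=> mF F0.
rewrite [LHS](@ge0_integral_pushforward _ _ _ _ _ _
  (@measurable_tuple_cons R n) (mu \x leb n)%E setT F)//.
rewrite preimage_setT fubini_tonelli1//; last by move=> x; exact: F0.
by apply: measurableT_comp => //; exact: measurable_tuple_cons.
Qed.

Lemma ge0_integral_euc0 (F : euc R 0 -> \bar R) :
  measurable_fun setT F -> (\int[leb 0]_x F x = F [tuple])%E.
Proof. by move=> mF; rewrite integral_dirac// diracT mul1e. Qed.

Lemma escale_cons n (c : R) (s : measurableTypeR R) (y : euc R n) :
  escale c (tuple_cons (s, y)) = tuple_cons (c * (s : R), escale c y).
Proof.
apply/eq_from_tnth => i; rewrite tnth_mktuple.
case: (unliftP ord0 i) => [j ->|->]; last by rewrite !tnth0.
by rewrite !tnthS tnth_mktuple.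
Qed.

Lemma ge0_integral_escale n (c : R) (F : euc R n -> \bar R) :
  c != 0 -> measurable_fun setT F -> (forall x, 0 <= F x)%E ->
  (\int[leb n]_x F (escale c x) = (`|c| ^- n)%:E * \int[leb n]_x F x)%E.
Proof.
move=> c0; elim: n => [|n IH] in F *; move=> mF F0.
  rewrite !ge0_integral_euc0//; last first.
    by apply: measurableT_comp => //; exact: measurable_escale.
  by rewrite expr0 invr1 mul1e [escale _ _]tuple0.
have mFe : measurable_fun setT (F \o escale c).
  by apply: measurableT_comp => //; exact: measurable_escale.
rewrite !ge0_integral_cons//.
under eq_integral => s _.
  under eq_integral do rewrite escale_cons.
  over.
have mFs (s : R) : measurable_fun setT (fun y => F (tuple_cons (s, y))).
  apply: measurableT_comp => //.
  apply: (measurableT_comp (@measurable_tuple_cons R n)).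
  exact: pair1_measurable.
under eq_integral => s _ do rewrite (IH (fun y => F (tuple_cons (c * (s : R), y))))//.
have mI : measurable_fun setT
    (fun s : measurableTypeR R => \int[leb n]_y F (tuple_cons (s, y)))%E.
  apply: (measurable_fun_fubini_tonelli_F (F \o @tuple_cons R n)) => [|x].
    by apply: measurableT_comp => //; exact: measurable_tuple_cons.
  exact: F0.
rewrite (@ge0_integral_scaleZ _ c (`|c| ^- n)
  (fun s => \int[leb n]_y F (tuple_cons (s, y)))%E)//.
- by rewrite exprS invfM.
- by move=> s; exact: integral_ge0.
Qed.

End EuclideanIntegral.

Section IntegralTools.
Local Open Scope ereal_scope.

Lemma ge0_integral_mrestr d (T : measurableType d) (R : realType)
    (m : {measure set T -> \bar R}) (D : set T) (mD : measurable D)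
    (f : T -> \bar R) :
  measurable_fun setT f -> (forall x, 0 <= f x) ->
  \int[mrestr m mD]_x f x = \int[m]_(x in D) f x.
Proof.
move=> mf f0; rewrite -(setUv D) ge0_integral_setU//; last 3 first.
- exact: measurableC.
- by rewrite setUv.
- by apply/disj_setPCl.
rewrite [X in _ + X]null_set_integral ?adde0; last 3 first.
- exact: measurableC.
- exact: measurable_funTS.
- by rewrite /= /mrestr setICl measure0.
apply: eq_measure_integral => A mA AD /=.
by rewrite /mrestr setIidl.
Qed.

Lemma integral_FTC (R : realType) (f F : R -> R) (a b : R) : (a < b)%R ->
  continuous f -> (forall x : R, is_derive x (1%R : R) F (f x)) ->
  \int[lebesgue_measure]_(x in `[a, b]) (f x)%:E = (F b)%:E - (F a)%:E.
Proof.
move=> ab cf dF.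
have cF : continuous F.
  by move=> x; apply/differentiable_continuous/derivable1_diffP; have [] := dF x.
apply: continuous_FTC2 => //.
- exact: continuous_subspaceT.
- split.
  + by move=> x _; have [] := dF x.
  + exact/cvg_at_right_filter/cF.
  + exact/cvg_at_left_filter/cF.
- by move=> x _; rewrite derive1E; have [_ ->] := dF x.
Qed.

End IntegralTools.

(** * Gnomonic coordinates on the sphere *)

Section Gnomonic.
Context {R : realType} {n : nat}.
Local Notation mu := (@lebesgue_measure R).
Local Notation leb := (lebesgue_euc R).
Implicit Type v : euc R n.

Definition lift1 v : euc R n.+1 := tuple_cons (1, v).

(** The Japanese bracket (1 + |v|^2)^(1/2). *)
Definition bracket v : R := enorm (lift1 v).

(** Central projection onto the northern hemisphere of its tangent hyperplane at
    the pole. *)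
Definition gnomonic v : euc R n.+1 := sphere_proj (lift1 v).

Lemma measurable_lift1 : measurable_fun setT lift1.
Proof.
apply: (measurableT_comp (@measurable_tuple_cons R n)).
exact: pair1_measurable.
Qed.

Lemma measurable_bracket : measurable_fun setT bracket.
Proof. exact: measurableT_comp measurable_enorm measurable_lift1. Qed.

Lemma measurable_gnomonic : measurable_fun setT gnomonic.
Proof. exact: measurableT_comp measurable_sphere_proj measurable_lift1. Qed.

Lemma dot_cons (s t : R) v w :
  dot (tuple_cons (s, v)) (tuple_cons (t, w)) = s * t + dot v w.
Proof.
rewrite /dot big_ord_recl !tnth0; congr +%R.
by apply: eq_bigr => i _; rewrite !tnthS.
Qed.

Lemma bracket_ge1 v : 1 <= bracket v.
Proof.
by rewrite -[leLHS]sqrtr1; apply: ler_wsqrtr; rewrite dot_cons mulr1 lerDl dot_ge0.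
Qed.

Lemma bracket_sqr v : bracket v ^+ 2 = 1 + dot v v.
Proof. by rewrite /bracket /enorm sqr_sqrtr ?dot_ge0// dot_cons mulr1. Qed.

Lemma bracket_gt0 v : 0 < bracket v.
Proof. exact: lt_le_trans ltr01 (bracket_ge1 v). Qed.

Lemma enorm_escale k (s : R) (x : euc R k) : enorm (escale s x) = `|s| * enorm x.
Proof. by rewrite /enorm dot_scale sqrtrM ?sqr_ge0// sqrtr_sqr. Qed.

Lemma escaleA k (s t : R) (x : euc R k) : escale s (escale t x) = escale (s * t) x.
Proof. by apply/eq_from_tnth => i; rewrite !tnth_mktuple mulrA. Qed.

Lemma escale1 k (x : euc R k) : escale 1 x = x.
Proof. by apply/eq_from_tnth => i; rewrite !tnth_mktuple mul1r. Qed.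

Lemma sphere_proj_escale k (s : R) (x : euc R k) : s != 0 ->
  sphere_proj (escale s x) = escale (Num.sg s) (sphere_proj x).
Proof.
move=> s0; rewrite /sphere_proj enorm_escale !escaleA; congr escale.
by rewrite invfM mulrAC {2}(numEsg s) [`|s|^-1 * _]mulrC mulfK ?normr_eq0.
Qed.

(** Integral over one line through the origin in polar coordinates: the two
    half lines are the two antipodal directions, with values [P] and [Q]. *)
Lemma integral_line (a : R) (P Q : \bar R) : 0 < a -> (0 <= P)%E -> (0 <= Q)%E ->
  (\int[mu]_s ((`|s : R| ^+ n)%:E *
     (if ((0 < `|s : R|) && (`|s : R| <= a))%R then if (0 < (s : R))%R then P else Q
      else 0)) = (P + Q) * (a ^+ n.+1 / n.+1%:R)%:E)%E.
Proof.
move=> a0 P0 Q0.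
pose u (s : measurableTypeR R) : \bar R :=
  (((s : R) ^+ n) * \1_(`]0, a]%classic : set R) s)%:E.
have mu_ : measurable_fun setT u.
  apply/measurable_EFinP; apply: measurable_funM.
    exact: measurable_funX.
  exact: measurable_indic.
have muN : measurable_fun setT (fun s : measurableTypeR R => u (- s)%R).
  by apply: (measurableT_comp mu_).
have u0 s : (0 <= u s)%E.
  rewrite lee_fin indicE; have [|_] := boolP (s \in _); last by rewrite mulr0.
  by rewrite inE /= in_itv /= => /andP[s0 _]; rewrite mulr1 exprn_ge0// ltW.
have Iu : (\int[mu]_s u s = (a ^+ n.+1 / n.+1%:R)%:E)%E.
  have -> : (\int[mu]_s u s = \int[mu]_(s in `]0%R, a]) (s ^+ n)%:E)%E.
    rewrite [RHS]integral_mkcond; apply: eq_integral => s _.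
    rewrite /u indicE patchE; by case: ifPn => _; rewrite ?mulr1 ?mulr0.
  rewrite integral_itv_obnd_cbnd; last first.
    by apply/measurable_EFinP/measurable_funTS; exact: measurable_funX.
  have dF (x : R) : is_derive x (1 : R)
      (n.+1%:R^-1 *: (@id R) ^+ n.+1 : R -> R) (x ^+ n).
    apply: is_derive_eq.
    by rewrite -[LHS]/(n.+1%:R^-1 * (n.+1%:R * x ^+ n * 1)) mulr1 mulKf// pnatr_eq0.
  rewrite (integral_FTC a0 _ dF); last exact: exprn_continuous.
  rewrite /= !fctE /=.
  by rewrite expr0n /= scaler0 oppr0 adde0 mulrC.
transitivity (\int[mu]_s (P * u s + Q * u (- s)%R))%E.
  apply: eq_integral => s _; rewrite /u !indicE.
  have indE (x : R) : (x \in `]0, a]%classic) = (0 < x <= a).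
    by apply/idP/idP; rewrite inE /= in_itv.
  rewrite !indE; have [s0|s0|->] := ltrgt0P (s : R).
  - rewrite oppr_gt0 (lt_gtF s0) s0 /= mulr0 mule0 adde0.
    by case: ifPn => _; rewrite ?mule0 ?mulr0 ?mule0 ?mulr1 1?muleC.
  - rewrite oppr_gt0 s0 /= mulr0 mule0 add0e.
    by case: ifPn => _; rewrite ?mule0 ?mulr0 ?mule0 ?mulr1 1?muleC.
  - by rewrite oppr0 ltxx /= !mulr0 !mule0 adde0.
rewrite ge0_integralD//; last 4 first.
- by move=> s _; rewrite mule_ge0.
- exact: measurable_funeM.
- by move=> s _; rewrite mule_ge0.
- exact: measurable_funeM.
rewrite !ge0_integralZl// ge0_integralN// Iu.
by rewrite ge0_muleDl.
Qed.

Lemma tuple_cons_escale (s : R) v : tuple_cons (s, escale s v) = escale s (lift1 v).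
Proof. by rewrite /lift1 escale_cons mulr1. Qed.

Lemma surface_integral_polar (F : euc R n.+1 -> \bar R) :
  measurable_fun setT F -> (forall x, 0 <= F x)%E ->
  (\int[surface_measure]_w F w =
   n.+1%:R%:E * \int[leb n.+1]_(x in punctured_ball) F (sphere_proj x))%E.
Proof.
move=> mF F0.
pose k : {nonneg R} := NngNum (ler0n R n.+1).
rewrite (eq_measure_integral (mscale k (@cone_measure R n.+1))); last first.
  by move=> A mA _; reflexivity.
rewrite (ge0_integral_mscale _ measurableT k mF) => [|x _]; last exact: F0.
suff -> : (\int[cone_measure]_w F w =
  \int[leb n.+1]_(x in punctured_ball) F (sphere_proj x))%E by [].
have mFp : measurable_fun setT (F \o sphere_proj).
  by apply: measurableT_comp => //; exact: measurable_sphere_proj.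
rewrite -(ge0_integral_mrestr _ measurable_punctured_ball mFp) => [|x];
  last exact: F0.
have F0T : {in setT, forall y, 0 <= F y}%E by move=> y _; exact: F0.
etransitivity; last exact: (ge0_integral_pushforward measurable_sphere_proj
  (mrestr (leb n.+1) measurable_punctured_ball) measurableT mF F0T).
apply: eq_measure_integral => A mA _.
rewrite /= /cone_measure /pushforward /mrestr.
by congr (leb _ _); apply/seteqP; split => x [].
Qed.

(** The surface measure counts volumes of cones.  Off a null hyperplane the ball
    is described by x = s (1, v), with Jacobian |s|^n and |s| <= 1 / <v>: for
    each v the integral over s is explicit, and the factor n + 1 of the surface
    measure cancels. *)
Lemma surface_integral_gnomonic (F : euc R n.+1 -> \bar R) :
  measurable_fun setT F -> (forall x, 0 <= F x)%E ->
  (\int[surface_measure]_w F w =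
   \int[leb n]_v ((F (gnomonic v) + F (escale (- 1) (gnomonic v))) *
                  (bracket v ^- n.+1)%:E))%E.
Proof.
move=> mF F0; rewrite surface_integral_polar//.
pose I := (F \o sphere_proj) \_ (@punctured_ball R n.+1).
have mI : measurable_fun setT I.
  apply/(measurable_restrictT _ measurable_punctured_ball)/measurable_funTS.
  by apply: measurableT_comp => //; exact: measurable_sphere_proj.
have I0 x : (0 <= I x)%E by rewrite /I patchE; case: ifPn => // _; exact: F0.
pose J (z : measurableTypeR R * euc R n) : \bar R :=
  ((`|z.1 : R| ^+ n)%:E * I (escale (z.1 : R) (lift1 z.2)))%E.
have J0 z : (0 <= J z)%E by rewrite mule_ge0// lee_fin exprn_ge0.
have mJ : measurable_fun setT J.
  apply: emeasurable_funM.
    apply/measurable_EFinP/measurable_funX.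
    by apply: measurableT_comp => //; exact: measurable_fst.
  apply: measurableT_comp => //.
  apply: (measurableT_comp (@measurable_escale_pair R n.+1)
    (g := fun z => (z.1, lift1 z.2))).
  apply: measurable_fun_pair; first exact: measurable_fst.
  by apply: (measurableT_comp measurable_lift1); exact: measurable_snd.
rewrite integral_mkcond -/I ge0_integral_cons//.
have -> : (\int[mu]_s \int[leb n]_y I (tuple_cons (s, y)) =
          \int[mu]_s \int[leb n]_v J (s, v))%E.
  apply: ge0_ae_eq_integral => //.
  - apply: (measurable_fun_fubini_tonelli_F (I \o @tuple_cons R n)) => [|x].
      by apply: measurableT_comp => //; exact: measurable_tuple_cons.
    exact: I0.
  - exact: measurable_fun_fubini_tonelli_F.
  - by move=> s _; exact: integral_ge0.
  - by move=> s _; exact: integral_ge0.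
  exists [set 0]; split => //=; first by rewrite lebesgue_measure_set1.
  move=> s /= /not_implyP[_] sP; apply: contrapT => /eqP s0; apply: sP.
  have mIs : measurable_fun setT (fun y => I (tuple_cons (s, y))).
    apply: measurableT_comp => //.
    apply: (measurableT_comp (@measurable_tuple_cons R n)).
    exact: pair1_measurable.
  rewrite /J /=; under [RHS]eq_integral => v _ do rewrite -tuple_cons_escale.
  rewrite ge0_integralZl//; last first.
    by apply: (measurableT_comp mIs); exact: measurable_escale.
  rewrite (ge0_integral_escale (F := fun y => I (tuple_cons (s, y))))//.
  by rewrite muleA -EFinM mulfV ?mul1e// expf_neq0// normr_eq0.
rewrite fubini_tonelli//.
have -> : (\int[leb n]_v \int[mu]_s J (s, v) =
  \int[leb n]_v ((F (gnomonic v) + F (escale (- 1) (gnomonic v))) *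
                 (bracket v ^- n.+1 / n.+1%:R)%:E))%E.
  apply: eq_integral => v _.
  rewrite -exprVn -integral_line ?invr_gt0 ?bracket_gt0//.
  apply: eq_integral => s _; rewrite /J /=; congr (_ * _)%E.
  rewrite /I patchE.
  have -> : (escale (s : R) (lift1 v) \in punctured_ball) =
      (0 < `|s : R| <= (bracket v)^-1).
    rewrite -[RHS]asboolb; apply: asbool_equiv_eq.
    rewrite /punctured_ball /= enorm_escale pmulr_lgt0 ?bracket_gt0//.
    by rewrite -[_^-1]mul1r ler_pdivlMr ?bracket_gt0.
  case: ifPn => // /andP[s0 _]; rewrite /= sphere_proj_escale -?normr_gt0//.
  case: ifPn => [/gtr0_sg ->|]; first by rewrite escale1.
  rewrite -leNgt le_eqVlt -normr_eq0 gt_eqF//= => s0'.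
  by rewrite ltr0_sg.
have mFg : measurable_fun setT (fun v => F (gnomonic v) + F (escale (-1) (gnomonic v)))%E.
  apply: emeasurable_funD; apply: measurableT_comp => //.
    exact: measurable_gnomonic.
  by apply: measurableT_comp; [exact: measurable_escale|exact: measurable_gnomonic].
rewrite -ge0_integralZl//; last 2 first.
- apply: emeasurable_funM => //; apply/measurable_EFinP.
  apply: measurable_funM => //; rewrite (_ : (fun=> _) = (fun v => (bracket v) `^ (- n.+1%:R))).
    apply: (measurableT_comp (measurable_powR _)); exact: measurable_bracket.
  by apply/funext => v; rewrite powRN powR_mulrn// ltW ?bracket_gt0.
- move=> v _; rewrite mule_ge0 ?adde_ge0// lee_fin.
  by rewrite divr_ge0// invr_ge0 exprn_ge0// ltW ?bracket_gt0.
apply: eq_integral => v _; rewrite muleCA -EFinM; congr (_ * _%:E)%E.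
by rewrite mulrCA mulfV ?mulr1// pnatr_eq0.
Qed.

End Gnomonic.

(** * The Gamma quotient as a mean value *)

Section GammaRatio.
Context {R : realType}.
Local Notation mu := (@lebesgue_measure R).

Lemma integral_gauss_scale (t : R) : 0 < t ->
  (\int[mu]_w (expR (- (t * (w : R) ^+ 2)))%:E = (Num.sqrt pi / Num.sqrt t)%:E)%E.
Proof.
move=> t0; have s0 : 0 < Num.sqrt t by rewrite sqrtr_gt0.
have mg : measurable_fun setT (fun w : measurableTypeR R => (gauss_fun (w : R))%:E).
  by apply/measurable_EFinP; exact: measurable_gauss_fun.
have := @ge0_integral_affine R (Num.sqrt t) 0 _ (lt0r_neq0 s0) mg.
rewrite integralT_gauss gtr0_norm// -EFinM mulrC => <-; last first.
  by move=> w; rewrite lee_fin gauss_fun_ge0.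
by apply: eq_integral => w _; rewrite /gauss_fun addr0 exprMn sqr_sqrtr// ltW.
Qed.

Lemma mem_pos (t : R) : (t \in `]0, +oo[%classic) = (0 < t).
Proof. by apply/idP/idP; rewrite inE /= in_itv /= ?andbT. Qed.

(** The integrand of [Gamma (p + 1)], extended by zero to the whole line. *)
Definition gamma_density (p t : R) : R :=
  t `^ p * expR (- t) * \1_(`]0, +oo[%classic : set R) t.

Lemma gamma_density_ge0 p t : 0 <= gamma_density p t.
Proof. by rewrite !mulr_ge0// ?powR_ge0 ?expR_ge0// indicE. Qed.

Lemma measurable_gamma_density p : measurable_fun setT (gamma_density p).
Proof.
apply: measurable_funM; last exact: measurable_indic.
apply: measurable_funM; first exact: measurable_powR.
by apply: measurableT_comp => //; exact: measurableT_comp.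
Qed.

Lemma integral_gamma_density (p : R) :
  (\int[mu]_t (gamma_density p t)%:E =
   \int[mu]_(t in `]0%R, +oo[) (t `^ p * expR (- t))%:E)%E.
Proof.
rewrite [RHS]integral_mkcond; apply: eq_integral => t _.
rewrite /gamma_density indicE patchE.
by case: ifPn => _; rewrite ?mulr1 ?mulr0.
Qed.

(** Tonelli's theorem for t^p e^(- t (1 + w^2)): integrating first in t scales the
    Gamma integral, integrating first in w leaves a Gaussian. *)
Lemma gamma_ratio_line (p : R) :
  (\int[mu]_t (gamma_density p t)%:E *
   \int[mu]_w ((1 + (w : R) ^+ 2) `^ (- (p + 1)))%:E =
   (Num.sqrt pi)%:E * \int[mu]_t (gamma_density (p - 2^-1) t)%:E)%E.
Proof.
pose K (z : measurableTypeR R * measurableTypeR R) : \bar R :=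
  ((z.2 : R) `^ p * expR (- ((z.2 : R) * (1 + (z.1 : R) ^+ 2))) *
   \1_(`]0, +oo[%classic : set R) z.2)%:E.
have b0 (w : R) : 0 < 1 + w ^+ 2 by rewrite ltr_pwDl// sqr_ge0.
have K0 z : (0 <= K z)%E.
  by rewrite lee_fin !mulr_ge0// ?powR_ge0 ?expR_ge0// indicE.
have m1 : measurable_fun setT (fst : measurableTypeR R * measurableTypeR R -> R).
  exact: measurable_fst.
have m2 : measurable_fun setT (snd : measurableTypeR R * measurableTypeR R -> R).
  exact: measurable_snd.
have mb : measurable_fun setT (fun w : measurableTypeR R => 1 + (w : R) ^+ 2).
  by apply: measurable_funD => //; exact: measurable_funX.
have mK : measurable_fun setT K.
  apply/measurable_EFinP; apply: measurable_funM; last first.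
    by apply: measurableT_comp m2; exact: measurable_indic.
  apply: measurable_funM; first exact: (measurableT_comp (measurable_powR p) m2).
  apply: measurableT_comp => //; apply: measurableT_comp => //.
  by apply: measurable_funM => //; exact: (measurableT_comp mb m1).
have mg q : measurable_fun setT (fun t : measurableTypeR R => (gamma_density q t)%:E).
  by apply/measurable_EFinP; exact: measurable_gamma_density.
rewrite -ge0_integralZl//; last 3 first.
- by apply/measurable_EFinP; apply: (measurableT_comp (measurable_powR _) mb).
- by move=> w _; rewrite lee_fin powR_ge0.
- by apply: integral_ge0 => t _; rewrite lee_fin gamma_density_ge0.
transitivity (\int[mu]_w \int[mu]_t K (w, t))%E.
  apply: eq_integral => w _.
  have := @ge0_integral_scaleZ R (1 + w ^+ 2) ((1 + w ^+ 2) `^ (- p)) _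
    (lt0r_neq0 (b0 w)) (powR_ge0 _ _) (mg p).
  rewrite gtr0_norm// -{1}powR_inv1 ?(ltW (b0 w))// -powRD; last first.
    by apply/implyP => _; rewrite lt0r_neq0.
  rewrite -opprD [(1 + p)%R]addrC muleC => <-; last first.
    by move=> t; rewrite lee_fin gamma_density_ge0.
  apply: eq_integral => t _; rewrite /K /= -EFinM; congr EFin.
  rewrite /gamma_density !indicE.
  have [t0|t0] := ltP 0 t.
    rewrite !mem_pos t0 mulr_gt0// !mulr1 powRM ?(ltW (b0 w)) ?ltW//.
    rewrite !mulrA -powRD ?addNr ?powRr0 ?mul1r.
      by rewrite [t * _]mulrC.
    by apply/implyP => _; rewrite lt0r_neq0.
  by rewrite !mem_pos pmulr_rgt0// ltNge t0 !mulr0.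
rewrite fubini_tonelli// -ge0_integralZl//; last first.
  by move=> t _; rewrite lee_fin gamma_density_ge0.
apply: eq_integral => t _; rewrite /K /gamma_density /= indicE.
rewrite mem_pos; have [t0|t0] := ltP 0 t; last first.
  by under eq_integral do rewrite mulr0; rewrite integral0 mulr0 mule0.
under eq_integral => w _.
  rewrite mulr1 mulrDr mulr1 opprD expRD mulrA EFinM; over.
rewrite ge0_integralZl//.
- rewrite integral_gauss_scale// -!EFinM; congr EFin.
  rewrite mulr1 powRB ?powR12_sqrt ?ltW//.
    by field; rewrite sqrtr_eq0 -ltNge.
  by apply/implyP => _; rewrite lt0r_neq0.
- apply/measurable_EFinP; apply: measurableT_comp => //; apply: measurableT_comp => //.
  by apply: measurable_funM => //; exact: measurable_funX.
- by rewrite lee_fin mulr_ge0 ?powR_ge0 ?expR_ge0.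
Qed.

Lemma continuous_norm_powR (q : R) : 0 < q -> continuous (fun x : R => `|x| `^ q).
Proof.
move=> q0 x; have [->|x0] := eqVneq x 0.
  rewrite /continuous_at normr0 powR0 ?gt_eqF//.
  apply/cvgrPdist_lt => e e0; near=> y.
  rewrite sub0r normrN ger0_norm ?powR_ge0//.
  have -> : e = (e `^ q^-1) `^ q.
    by rewrite -powRrM mulVf ?gt_eqF// powRr1// ltW.
  apply: gt0_ltr_powR; rewrite ?nnegrE ?powR_ge0// .
  by near: y; apply: (@nbhs0_lt R R); exact: powR_gt0.
have cp : {for `|x|, continuous (fun y : R => y `^ q)}.
  apply/differentiable_continuous/derivable1_diffP.
  by have [] := @is_derive1_powR R q `|x| _; rewrite ?normr_gt0.
apply: (@continuous_comp _ _ _ (fun y : R => `|y|) (fun y => y `^ q)) => //.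
exact: norm_continuous.
Unshelve. all: by end_near. Qed.

Lemma cvg_powR_ge0 (q : R) (u : nat -> R) (l : R) : 0 < q ->
  (forall k, 0 <= u k) -> u k @[k --> \oo] --> l -> u k `^ q @[k --> \oo] --> l `^ q.
Proof.
move=> q0 u0 ul; have l0 : 0 <= l.
  rewrite -(cvg_lim _ ul)//; apply: limr_ge; last exact: nearW.
  by apply/cvg_ex; exists l.
have := cvg_comp _ _ ul (@continuous_norm_powR q q0 l).
rewrite [X in X @ _ --> _](_ : _ = (fun k => u k `^ q)); last first.
  by apply/funext => k /=; rewrite ger0_norm.
by rewrite {1}(ger0_norm l0).
Qed.

(** The substitution w = tan t on bounded intervals, which exhaust the line. *)
Lemma integral_line_le_cos (q : R) : 0 < q ->
  (\int[mu]_w ((1 + (w : R) ^+ 2) `^ (- (q / 2 + 1)))%:E <=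
   \int[mu]_(t in `[(- (pi / 2))%R, (pi / 2)%R]) (`|cos t| `^ q)%:E)%E.
Proof.
move=> q0; pose h (w : R) := (1 + w ^+ 2) `^ (- (q / 2 + 1)).
pose G (t : R) := `|cos t| `^ q.
have cG : continuous G.
  move=> t; apply: (@continuous_comp _ _ _ (@cos R) (fun y => `|y| `^ q)).
    exact: continuous_cos.
  exact: continuous_norm_powR.
have mG : measurable_fun setT (fun t : measurableTypeR R => (G t)%:E).
  by apply/measurable_EFinP; exact: continuous_measurable_fun.
have mh : measurable_fun setT (fun t : measurableTypeR R => (h t)%:E).
  apply/measurable_EFinP; apply: (measurableT_comp (measurable_powR _)).
  by apply: measurable_funD => //; exact: measurable_funX.
have catan' : continuous (@atan R)^`()%classic.
  rewrite (_ : _^`()%classic = (fun x => (1 + x ^+ 2)^-1)); last first.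
    by apply/funext => x; rewrite derive1_atan.
  move=> x; apply: cvgV.
    by rewrite gt_eqF// ltr_pwDl// sqr_ge0.
  by apply: cvgD; [exact: cvg_cst|exact: exprn_continuous].
have Ih n : (\int[mu]_(w in `[(- n%:R)%R, n%:R]) (h w)%:E <=
             \int[mu]_(t in `[(- (pi / 2))%R, (pi / 2)%R]) (G t)%:E)%E.
  have -> : (\int[mu]_(w in `[(- n%:R)%R, n%:R]) (h w)%:E =
             \int[mu]_(t in `[atan (- n%:R), atan n%:R]) (G t)%:E)%E.
    rewrite integration_by_substitution_increasing.
    - apply: eq_integral => w _; congr EFin.
      rewrite -[RHS]/(`|cos (atan w)| `^ q * atan^`()%classic w).
      rewrite derive1_atan cos_atan /h.
      have b0 : 0 < 1 + w ^+ 2 by rewrite ltr_pwDl// sqr_ge0.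
      rewrite normfV ger0_norm ?sqrtr_ge0// -powR12_sqrt ?(ltW b0)//.
      rewrite -powRN -powRrM -[X in _ = _ * X]powR_inv1 ?(ltW b0)// -powRD.
        by congr (_ `^ _); rewrite opprD mulNr mulrC.
      by apply/implyP => _; rewrite gt_eqF.
    - by rewrite (@le_trans _ _ 0)// oppr_le0.
    - by move=> x y _ _; exact: lt_atan.
    - by move=> x _; exact: catan'.
    - by apply/cvg_ex; eexists; apply/cvg_at_right_filter/catan'.
    - by apply/cvg_ex; eexists; apply/cvg_at_left_filter/catan'.
    - split.
      + by move=> x _; have [] := is_derive1_atan x.
      + exact/cvg_at_right_filter/continuous_atan.
      + exact/cvg_at_left_filter/continuous_atan.
    - exact: continuous_subspaceT.
  apply: ge0_subset_integral => //.
  - exact: measurable_funTS.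
  - by move=> t _; rewrite lee_fin powR_ge0.
  - move=> t /=; rewrite !in_itv /= => /andP[t1 t2]; apply/andP; split.
      by rewrite (le_trans _ t1)// ltW// atan_gtNpi2.
    by rewrite (le_trans t2)// ltW// atan_ltpi2.
have ndF : {homo (fun n => `[(- n%:R)%R, n%:R]%classic : set R) :
    n m / (n <= m)%N >-> (n <= m)%O}.
  move=> n m nm; apply/subsetPset => x /=; rewrite !in_itv /= => /andP[x1 x2].
  rewrite (le_trans _ x1) ?lerN2 ?ler_nat//=.
  by rewrite (le_trans x2) ?ler_nat.
have UT : \bigcup_n `[(- n%:R)%R, n%:R]%classic = [set: R].
  rewrite -subTset => x _; exists (Num.bound `|x|) => //=.
  by rewrite in_itv /= -ler_norml ltW// archi_boundP.
have mFn n : measurable (`[(- n%:R)%R, n%:R]%classic : set R) by exact: measurable_itv.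
have := ge0_nondecreasing_set_cvg_integral (mu := mu) ndF mFn
  (fun n => measurable_funTS mh).
rewrite UT => /(_ _)/cvg_lim <- //; last first.
  by move=> n x _; rewrite lee_fin powR_ge0.
apply: lime_le; last by apply: nearW.
apply/cvg_ex; eexists.
apply: (ge0_nondecreasing_set_cvg_integral (mu := mu) ndF mFn
  (fun n => measurable_funTS mh)).
by move=> n x _; rewrite lee_fin powR_ge0.
Qed.

(** Quotient of the two sides of [gamma_ratio_line] at p = q / 2. *)
Lemma gamma_ratio_le_cos (q : R) : 0 < q ->
  ((Num.sqrt pi * (Gamma ((q + 1) / 2) / Gamma ((q + 2) / 2)))%:E <=
   \int[mu]_(t in `[(- (pi / 2))%R, (pi / 2)%R]) (`|cos t| `^ q)%:E)%E.
Proof.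
move=> q0; apply: (le_trans _ (integral_line_le_cos q0)).
have GE (p : R) : Gamma (p + 1) = fine (\int[mu]_t (gamma_density p t)%:E)%E.
  by rewrite integral_gamma_density /Gamma /Rintegral addrK.
have -> : (q + 1) / 2 = (q / 2 - 2^-1) + 1 by field.
have -> : (q + 2) / 2 = q / 2 + 1 by field.
rewrite !GE.
have := gamma_ratio_line (q / 2).
have : (0 <= \int[mu]_t (gamma_density (q / 2) t)%:E)%E.
  by apply: integral_ge0 => t _; rewrite lee_fin gamma_density_ge0.
have : (0 <= \int[mu]_w ((1 + (w : R) ^+ 2) `^ (- (q / 2 + 1)))%:E)%E.
  by apply: integral_ge0 => t _; rewrite lee_fin powR_ge0.
move: (\int[mu]_w ((1 + _) `^ _)%:E)%E => W W0.
move: (\int[mu]_t (gamma_density (q / 2) t)%:E)%E => G2.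
move: (\int[mu]_t _)%E => G1.
(* [Gamma] reads an infinite integral as zero. *)
case: G2 => [g2| |]//= g20; last by rewrite invr0 !mulr0.
move: g20; rewrite lee_fin le_eqVlt => /predU1P[<-|g20].
  by rewrite invr0 !mulr0.
case: W W0 => [w| |]// w0; last by rewrite leey.
rewrite -EFinM; case: G1 => [g1| |]/=.
- by move=> -[] gw; rewrite lee_fin mulrA -gw mulrAC mulfV ?mul1r ?gt_eqF.
- by rewrite gt0_muley ?lte_fin ?sqrtr_gt0 ?pi_gt0.
- by rewrite gt0_muleNy ?lte_fin ?sqrtr_gt0 ?pi_gt0.
Qed.

End GammaRatio.

Section CircleAverage.
Context {R : realType}.
Local Notation mu := (@lebesgue_measure R).

Lemma integral_itv_shift (i j : interval R) (b : R)
    (h : measurableTypeR R -> \bar R) :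
  (forall x : R, (x + b \in j) = (x \in i)) ->
  measurable_fun setT h -> (forall x, 0 <= h x)%E ->
  (\int[mu]_(x in [set` i]) h (x + b)%R = \int[mu]_(x in [set` j]) h x)%E.
Proof.
move=> ij mh h0; rewrite integral_mkcond [RHS]integral_mkcond.
rewrite -[RHS]mul1e -{1}invr1 -normr1 -(ge0_integral_affine b)//.
- apply: eq_integral => x _; rewrite mul1r !patchE.
  by rewrite !mem_setE ij.
- by apply/(measurable_restrictT _ (measurable_itv _))/measurable_funTS.
- by move=> x; rewrite patchE; case: ifPn.
Qed.

Lemma integral_period_shift (a p b : R) (h : measurableTypeR R -> \bar R) :
  0 <= b <= p -> measurable_fun setT h -> (forall x, 0 <= h x)%E ->
  (forall x : R, h (x + p) = h x) ->
  (\int[mu]_(x in `[a, (a + p)%R]) h (x + b)%R =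
   \int[mu]_(x in `[a, (a + p)%R]) h x)%E.
Proof.
move=> /andP[b0 bp] mh h0 hp.
rewrite (@integral_itv_shift _ `[a + b, a + p + b])//; last first.
  by move=> x; rewrite !in_itv /= !lerD2r.
have -> : `[(a + b)%R, (a + p + b)%R]%classic =
    `[(a + b)%R, (a + p)%R] `|` `](a + p)%R, (a + p + b)%R] :> set R.
  by rewrite -itv_bndbnd_setU// bnd_simp ?lerD2l// ?lerDl.
rewrite ge0_integral_setU//; last 2 first.
- exact: measurable_funTS.
- by apply/disj_setPRL => x /=; rewrite !in_itv /= => /andP[xp _] /andP[_]; rewrite leNgt xp.
have -> : `[a, (a + p)%R]%classic = `[a, (a + b)%R[ `|` `[(a + b)%R, (a + p)%R] :> set R.
  by rewrite -itv_bndbnd_setU// bnd_simp ?lerD2l// ?lerDl.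
rewrite [RHS]ge0_integral_setU//; last 2 first.
- exact: measurable_funTS.
- by apply/disj_setPRL => x /=; rewrite !in_itv /= => /andP[xp _] /andP[_]; rewrite ltNge xp.
rewrite addeC; congr (_ + _)%E.
rewrite integral_itv_bndo_bndc; last exact: measurable_funTS.
rewrite integral_itv_obnd_cbnd; last exact: measurable_funTS.
rewrite -(@integral_itv_shift `[a, a + b] _ p)//; last first.
  by move=> x; rewrite !in_itv /= [a + p + b]addrAC !lerD2r.
by apply: eq_integral => x _; rewrite hp.
Qed.

Lemma polar_angle (a b : R) : 0 <= b -> exists2 t, 0 <= t <= pi &
  a = Num.sqrt (a ^+ 2 + b ^+ 2) * cos t /\ b = Num.sqrt (a ^+ 2 + b ^+ 2) * sin t.
Proof.
move=> b0; set r := Num.sqrt _.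
have r2 : r ^+ 2 = a ^+ 2 + b ^+ 2 by rewrite sqr_sqrtr// addr_ge0 ?sqr_ge0.
have r0 : 0 <= r by exact: sqrtr_ge0.
have [r00|rn0] := eqVneq r 0.
  move: r2; rewrite r00 expr0n /= => /esym/eqP.
  rewrite paddr_eq0 ?sqr_ge0// !sqrf_eq0 => /andP[/eqP -> /eqP ->].
  by exists 0; rewrite ?lexx ?pi_ge0// !mul0r.
have rp : 0 < r by rewrite lt_neqAle eq_sym rn0.
have ar : -1 <= a / r <= 1.
  rewrite -ler_norml normrM normfV (gtr0_norm rp) ler_pdivrMr// mul1r.
  rewrite -(@ler_sqr R) ?nnegrE// real_normK ?num_real// r2.
  by rewrite lerDl sqr_ge0.
exists (acos (a / r)); first by rewrite acos_ge0// acos_lepi.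
rewrite acosK// sin_acos//; split; first by rewrite mulrCA mulfV ?mulr1.
have -> : 1 - (a / r) ^+ 2 = (b / r) ^+ 2.
  by rewrite !expr_div_n r2 ; field; rewrite -r2 sqrf_eq0.
by rewrite sqrtr_sqr ger0_norm ?divr_ge0// mulrCA mulfV ?mulr1.
Qed.

(** The linear form is the cosine up to amplitude and a shift of the angle, and
    [|cos|] has period [pi], the length of the interval. *)
Lemma circle_average (q a b : R) : 0 < q ->
  (\int[mu]_(t in `[(- (pi / 2))%R, (pi / 2)%R])
      (`|a * cos t - b * sin t| `^ q)%:E =
   (Num.sqrt (a ^+ 2 + b ^+ 2) `^ q)%:E *
   \int[mu]_(t in `[(- (pi / 2))%R, (pi / 2)%R]) (`|cos t| `^ q)%:E)%E.
Proof.
move=> q0; wlog b0 : a b / 0 <= b => [hw|].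
  have [/hw //|b0] := leP 0 b.
  have := hw (- a) (- b); rewrite !sqrrN oppr_ge0 => /(_ (ltW b0)) <-.
  by apply: eq_integral => t _; rewrite !mulNr -opprD normrN.
have [t0 /andP[t00 t0p] [{2}-> {2}->]] := polar_angle a b0.
set r := Num.sqrt _.
pose h (t : measurableTypeR R) := (`|cos (t : R)| `^ q)%:E.
have mh : measurable_fun setT h.
  have ch : continuous (fun t : R => `|cos t| `^ q).
    move=> t; apply: (@continuous_comp _ _ _ (@cos R) (fun y => `|y| `^ q)).
      exact: continuous_cos.
    exact: continuous_norm_powR.
  by apply/measurable_EFinP; exact: continuous_measurable_fun ch.
have h0 t : (0 <= h t)%E by rewrite lee_fin powR_ge0.
transitivity (\int[mu]_(t in `[(- (pi / 2))%R, (pi / 2)%R])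
   ((r `^ q)%:E * h (t + t0)%R))%E.
  apply: eq_integral => t _; rewrite -EFinM; congr EFin.
  rewrite -powRM ?sqrtr_ge0//; congr (_ `^ _).
  rewrite -[X in _ = X * _](ger0_norm (sqrtr_ge0 _ : 0 <= r)) -normrM cosD.
  congr `|_|; ring.
have mhs : measurable_fun `[(- (pi / 2))%R, (pi / 2)%R]%classic
    (fun t : measurableTypeR R => h (t + t0)).
  by apply: measurable_funTS; apply: (measurableT_comp mh); exact: measurable_funD.
rewrite (ge0_integralZl mu (measurable_itv _) mhs) => [|t _|]; last 2 first.
- exact: h0.
- by rewrite lee_fin powR_ge0.
apply: (congr1 (fun z => ((r `^ q)%:E * z)%E)).
have := @integral_period_shift (- (pi / 2)) pi t0 h.
rewrite (_ : - (pi / 2) + pi = pi / 2); last by field.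
by apply=> //; [rewrite t00|move=> x; rewrite /h cosDpi normrN].
Qed.

End CircleAverage.

(** * Limits of integrals, complex integrals *)

Section LimitTools.
Context d (T : measurableType d) (R : realType).
Variable m : {measure set T -> \bar R}.
Local Open Scope ereal_scope.

Lemma limn_einf_le (u : nat -> \bar R) (B : \bar R) :
  (forall n, u n <= B) -> limn_einf u <= B.
Proof.
move=> uB; rewrite limn_einf_lim; apply: lime_le; first exact: is_cvg_einfs.
apply: nearW => n; apply: le_trans (uB n).
by apply: ereal_inf_lbound; exists n => /=.
Qed.

Lemma fatou_le (F : nat -> T -> R) (G : T -> R) (B : \bar R) :
  (forall n, measurable_fun setT (F n)) ->
  (forall n x, 0 <= F n x)%R ->
  (forall x, F n x @[n --> \oo] --> G x) ->
  (forall n, \int[m]_x (F n x)%:E <= B) ->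
  \int[m]_x (G x)%:E <= B.
Proof.
move=> mF F0 FG FB.
have GE x : (G x)%:E = limn_einf (fun n => (F n x)%:E).
  have cF : (F n x)%:E @[n --> \oo] --> (G x)%:E.
    by apply: cvg_EFin; [exact: nearW|exact: FG].
  by rewrite (cvg_limn_einf_sup cF).
under eq_integral do rewrite GE.
apply: le_trans (fatou m measurableT _ _) _.
- by move=> n; apply/measurable_EFinP.
- by move=> n x _; rewrite lee_fin.
exact: limn_einf_le.
Qed.

Lemma cvg_Rintegral_dominated (F : nat -> T -> R) (G h : T -> R) :
  (forall n, measurable_fun setT (F n)) ->
  (forall x, F n x @[n --> \oo] --> G x) ->
  m.-integrable setT (EFin \o h) ->
  (forall n x, `|F n x| <= h x)%R ->
  (\int[m]_x F n x @[n --> \oo] --> \int[m]_x G x)%R.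
Proof.
move=> mF FG ih Fh.
have [iG _ cI] : [/\ m.-integrable setT (EFin \o G),
    (fun n => \int[m]_x `|(F n x)%:E - (G x)%:E|) @ \oo --> 0 &
    (fun n => \int[m]_x (F n x)%:E) @ \oo --> \int[m]_x (G x)%:E].
  apply: (@dominated_convergence _ _ _ m setT measurableT
    (fun n x => (F n x)%:E) (EFin \o G) (EFin \o h)) => //.
  - by move=> n; apply/measurable_EFinP.
  - apply/measurable_EFinP; exact: (measurable_fun_cvg (h := F)).
  - by apply: aeW => x _; apply: cvg_EFin; [exact: nearW|exact: FG].
  - by apply: aeW => x n _; rewrite lee_fin.
by apply: fine_cvg; rewrite fineK//; exact: integrable_fin_num.
Qed.

End LimitTools.

Lemma measurable_Rintegral_param d1 d2 (X : measurableType d1)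
    (Y : measurableType d2) (R : realType)
    (m : {sigma_finite_measure set Y -> \bar R}) (G : X * Y -> R) :
  measurable_fun setT G -> measurable_fun setT (fun x => \int[m]_y G (x, y))%R.
Proof.
move=> mG; rewrite /Rintegral.
apply: (measurableT_comp (fine_measurable _)) => //.
under eq_fun do rewrite integralE.
apply: emeasurable_funB.
  have mp : measurable_fun setT ((EFin \o G)^\+)%E.
    by apply: measurable_funepos; exact/measurable_EFinP.
  have := measurable_fun_fubini_tonelli_F (m2 := m) _ mp (fun x => funepos_ge0 _ x).
  congr measurable_fun; apply/funext => x.
  by apply: eq_integral => y _; rewrite !funeposE.
have mn : measurable_fun setT ((EFin \o G)^\-)%E.
  by apply: measurable_funeneg; exact/measurable_EFinP.
have := measurable_fun_fubini_tonelli_F (m2 := m) _ mn (fun x => funeneg_ge0 _ x).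
congr measurable_fun; apply/funext => x.
by apply: eq_integral => y _; rewrite !funenegE.
Qed.

Section ComplexIntegrals.
Context {R : realType}.

Lemma cmodE (z : R[i]) : cmod z = Num.sqrt (complex.Re z ^+ 2 + complex.Im z ^+ 2).
Proof. by case: z. Qed.

Lemma cmod_ge0 (z : R[i]) : 0 <= cmod z.
Proof. by rewrite cmodE sqrtr_ge0. Qed.

Lemma sqr_cmod (z : R[i]) : cmod z ^+ 2 = complex.Re z ^+ 2 + complex.Im z ^+ 2.
Proof. by rewrite cmodE sqr_sqrtr// addr_ge0// sqr_ge0. Qed.

Lemma ReM (z w : R[i]) : complex.Re (z * w) =
  complex.Re z * complex.Re w - complex.Im z * complex.Im w.
Proof. by case: z w => [a b] [c d]. Qed.

Lemma ImM (z w : R[i]) : complex.Im (z * w) =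
  complex.Re z * complex.Im w + complex.Im z * complex.Re w.
Proof. by case: z w => [a b] [c d]. Qed.

Lemma complex_eq (z w : R[i]) :
  complex.Re z = complex.Re w -> complex.Im z = complex.Im w -> z = w.
Proof. by case: z w => [a b] [c d] /= -> ->. Qed.

Lemma cmodM (z w : R[i]) : cmod (z * w) = cmod z * cmod w.
Proof.
rewrite !cmodE -sqrtrM ?addr_ge0 ?sqr_ge0// ReM ImM; congr Num.sqrt; ring.
Qed.

Lemma cmod_cis t : cmod (cis t : R[i]) = 1.
Proof. by rewrite cmodE /= cos2Dsin2 sqrtr1. Qed.

Lemma cmod_real (x : R) : cmod (x%:C)%C = `|x|.
Proof. by rewrite cmodE /= expr0n addr0 sqrtr_sqr. Qed.

Lemma cisD s t : cis (s + t) = cis s * cis t :> R[i].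
Proof.
by apply: complex_eq; rewrite ?ReM ?ImM /= ?cosD ?sinD// addrC [X in _ + X]mulrC.
Qed.

Lemma Re_le_cmod (z : R[i]) : `|complex.Re z| <= cmod z.
Proof. by rewrite cmodE -sqrtr_sqr ler_wsqrtr// lerDl sqr_ge0. Qed.

Lemma Im_le_cmod (z : R[i]) : `|complex.Im z| <= cmod z.
Proof. by rewrite cmodE -sqrtr_sqr ler_wsqrtr// lerDr sqr_ge0. Qed.

Lemma cmod_le (z : R[i]) : cmod z <= `|complex.Re z| + `|complex.Im z|.
Proof.
rewrite -(@ler_sqr R) ?nnegrE ?cmod_ge0 ?addr_ge0// sqr_cmod sqrrD !real_normK ?num_real//.
by rewrite -addrA [X in _ <= _ + X]addrC addrA lerDl mulrn_wge0// mulr_ge0.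
Qed.

Lemma cvg_cmod (u : nat -> R[i]) (l : R[i]) :
  (complex.Re (u n) @[n --> \oo] --> complex.Re l) ->
  (complex.Im (u n) @[n --> \oo] --> complex.Im l) ->
  cmod (u n) @[n --> \oo] --> cmod l.
Proof.
move=> ur ui; under eq_fun do rewrite cmodE; rewrite cmodE.
apply: (@cvg_comp _ _ _ (fun n => complex.Re (u n) ^+ 2 + complex.Im (u n) ^+ 2)
  (@Num.sqrt R) _ _ _ _ (@sqrt_continuous R _)).
by apply: cvgD; rewrite expr2; under eq_fun do rewrite expr2; apply: cvgM.
Qed.

Context {d : measure_display} {T : measurableType d}.
Implicit Types (g : T -> R[i]) (m : {measure set T -> \bar R}).

Lemma cmeasurable_cmod g : cmeasurable g -> measurable_fun setT (cmod \o g).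
Proof.
move=> [gr gi]; rewrite (_ : _ \o _ =
  Num.sqrt \o (fun x => complex.Re (g x) ^+ 2 + complex.Im (g x) ^+ 2)); last first.
  by apply/funext => x /=; rewrite cmodE.
apply: measurableT_comp.
  by apply: continuous_measurable_fun; exact: sqrt_continuous.
by apply: measurable_funD; exact: measurable_funX.
Qed.

Definition cintegrable m g :=
  m.-integrable setT (EFin \o (fun x => complex.Re (g x))) /\
  m.-integrable setT (EFin \o (fun x => complex.Im (g x))).

Lemma cintegrable_cmeasurable m g : cintegrable m g -> cmeasurable g.
Proof.
by move=> [/measurable_int/measurable_EFinP ? /measurable_int/measurable_EFinP ?].
Qed.

Lemma cintegrable_dominated m g (h : T -> R) : cmeasurable g ->
  m.-integrable setT (EFin \o h) -> (forall x, cmod (g x) <= h x) ->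
  cintegrable m g.
Proof.
move=> [gr gi] ih gh; split; apply: (le_integrable measurableT _ _ ih);
  try exact/measurable_EFinP.
- move=> x _; rewrite /= lee_fin (le_trans (Re_le_cmod _))// (le_trans (gh x))//.
  exact: ler_norm.
- move=> x _; rewrite /= lee_fin (le_trans (Im_le_cmod _))// (le_trans (gh x))//.
  exact: ler_norm.
Qed.

Lemma cintegrable_cmod m g : cintegrable m g ->
  m.-integrable setT (EFin \o (cmod \o g)).
Proof.
move=> ig; have [ir ii] := ig.
have := integrableD measurableT (integrable_abse ir) (integrable_abse ii).
apply: le_integrable => //.
  exact/measurable_EFinP/cmeasurable_cmod/(cintegrable_cmeasurable ig).
move=> x _; rewrite /= lee_fin ger0_norm ?cmod_ge0// (le_trans (cmod_le _))//.
exact: ler_norm.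
Qed.

Lemma cmeasurableM g1 g2 : cmeasurable g1 -> cmeasurable g2 ->
  cmeasurable (fun x => g1 x * g2 x).
Proof.
move=> [r1 i1] [r2 i2]; split.
  under eq_fun do rewrite ReM.
  by apply: measurable_funB; exact: measurable_funM.
under eq_fun do rewrite ImM.
by apply: measurable_funD; exact: measurable_funM.
Qed.

Lemma cmeasurable_cis (t : T -> R) : measurable_fun setT t ->
  cmeasurable (fun x => cis (t x)).
Proof.
move=> mt; split => /=; apply: measurableT_comp => //.
  by apply: continuous_measurable_fun; exact: continuous_cos.
by apply: continuous_measurable_fun; exact: continuous_sin.
Qed.

Lemma cintegrableM m g1 g2 (c : R) : cmeasurable g1 -> cintegrable m g2 ->
  (forall x, cmod (g1 x) <= c) -> cintegrable m (fun x => g1 x * g2 x).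
Proof.
move=> m1 i2 g1c; have m2 := cintegrable_cmeasurable i2.
apply: (@cintegrable_dominated _ _ (fun x => c * cmod (g2 x))).
- exact: cmeasurableM.
- have := integrableZl measurableT c (cintegrable_cmod i2).
  by congr integrable.
- by move=> x; rewrite cmodM ler_wpM2r ?cmod_ge0.
Qed.

Lemma cintegrable_cis m g (t : T -> R) : measurable_fun setT t ->
  cintegrable m g -> cintegrable m (fun x => cis (t x) * g x).
Proof.
move=> mt ig; apply: (@cintegrableM _ _ _ 1) => //.
  exact: cmeasurable_cis.
by move=> x; rewrite cmod_cis.
Qed.

Lemma cintZ m (c : R[i]) g : cintegrable m g ->
  cint m (fun x => c * g x) = c * cint m g.
Proof.
move=> [ir ii].
apply: complex_eq; rewrite ?ReM ?ImM /cint /=.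
  under eq_Rintegral do rewrite ReM.
  rewrite RintegralB//; last 2 first.
  - by have := integrableZl measurableT (complex.Re c) ir; congr integrable.
  - by have := integrableZl measurableT (complex.Im c) ii; congr integrable.
  by rewrite !RintegralZl.
under eq_Rintegral do rewrite ImM.
rewrite RintegralD//; last 2 first.
- by have := integrableZl measurableT (complex.Re c) ii; congr integrable.
- by have := integrableZl measurableT (complex.Im c) ir; congr integrable.
by rewrite !RintegralZl.
Qed.

Lemma cvg_cmod_cint m (g : nat -> T -> R[i]) (l : T -> R[i]) (h : T -> R) :
  (forall n, cmeasurable (g n)) ->
  (forall x, complex.Re (g n x) @[n --> \oo] --> complex.Re (l x)) ->
  (forall x, complex.Im (g n x) @[n --> \oo] --> complex.Im (l x)) ->
  m.-integrable setT (EFin \o h) -> (forall n x, cmod (g n x) <= h x) ->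
  cmod (cint m (g n)) @[n --> \oo] --> cmod (cint m l).
Proof.
move=> mg gr gi ih gh; apply: cvg_cmod; apply: (cvg_Rintegral_dominated _ _ ih) => //.
- by move=> n; have [] := mg n.
- by move=> n x; rewrite (le_trans (Re_le_cmod _)).
- by move=> n; have [] := mg n.
- by move=> n x; rewrite (le_trans (Im_le_cmod _)).
Qed.

Lemma cmeasurable_cint_param d1 (X : measurableType d1)
    (m : {sigma_finite_measure set T -> \bar R}) (G : X * T -> R[i]) :
  cmeasurable G -> cmeasurable (fun x => cint m (fun y => G (x, y))).
Proof.
by move=> [mr mi]; split => /=;
  [exact: (measurable_Rintegral_param m mr)|exact: (measurable_Rintegral_param m mi)].
Qed.

End ComplexIntegrals.

Section SquareNorm.
Context {R : realType} {d : measure_display} {T : measurableType d}.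
Variable m : {measure set T -> \bar R}.
Local Open Scope ereal_scope.
Implicit Type f : T -> R[i].

(** The square of the norm of L^2, free of the root in [L2norm]. *)
Definition L2sq f : \bar R := \int[m]_x ((cmod (f x)) ^+ 2)%:E.

Lemma L2sq_ge0 f : 0 <= L2sq f.
Proof. by apply: integral_ge0 => x _; rewrite lee_fin sqr_ge0. Qed.

Lemma L2norm_sqr f : L2norm m f `^ 2%R = L2sq f.
Proof.
rewrite /L2norm poweR_Lnorm//; apply: eq_integral => x _ /=.
by rewrite ger0_norm ?cmod_ge0// powR_mulrn ?cmod_ge0.
Qed.

Lemma L2normE f : L2norm m f = L2sq f `^ 2^-1%R.
Proof.
by rewrite -L2norm_sqr -poweRrM mulfV// poweRe1// /L2norm Lnorm_ge0.
Qed.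

End SquareNorm.

(** * Antipodal caps *)

Section CapPair.
Context {R : realType} {n : nat}.
Local Notation mu := (@lebesgue_measure R).
Local Notation leb := (lebesgue_euc R).
Implicit Types (v : euc R n) (w x : euc R n.+1) (g : euc R n -> R[i]).

(** Positive and negative parts of [F] are transported separately. *)
Lemma surface_Rintegral_gnomonic (F : euc R n.+1 -> R) :
  measurable_fun setT F ->
  (leb n).-integrable setT (EFin \o
    (fun v => F (gnomonic v) * bracket v ^- n.+1)) ->
  (leb n).-integrable setT (EFin \o
    (fun v => F (escale (- 1) (gnomonic v)) * bracket v ^- n.+1)) ->
  \int[surface_measure]_w F w =
  \int[leb n]_v (F (gnomonic v) * bracket v ^- n.+1 +
                 F (escale (- 1) (gnomonic v)) * bracket v ^- n.+1).
Proof.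
move=> mF iA iB.
have b0 v : 0 <= bracket v ^- n.+1 by rewrite invr_ge0 exprn_ge0// ltW ?bracket_gt0.
pose P (h : R -> R) v := h (F (gnomonic v)) * bracket v ^- n.+1 +
   h (F (escale (- 1) (gnomonic v))) * bracket v ^- n.+1.
pose hp (r : R) := Num.max r 0.
pose hn (r : R) : R := Num.max (- r) 0.
have mhp : measurable_fun setT hp by apply: measurable_maxr => //; exact: measurable_cst.
have mhn : measurable_fun setT hn.
  apply: measurable_maxr; last exact: measurable_cst.
  exact: oppr_measurable.
have hp0 r : 0 <= hp r by rewrite le_max lexx orbT.
have hn0 r : 0 <= hn r by rewrite le_max lexx orbT.
have hpr r : hp r <= `|r| by rewrite ge_max ler_norm normr_ge0.
have hnr r : hn r <= `|r| by rewrite ge_max -normrN ler_norm normr_ge0.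
have mk : measurable_fun setT (@gnomonic R n) := measurable_gnomonic.
have mk' : measurable_fun setT (fun v => escale (- 1) (gnomonic v)).
  by apply: measurableT_comp mk; exact: measurable_escale.
have mb : measurable_fun setT (fun v => bracket v ^- n.+1).
  rewrite (_ : (fun=> _) = (fun v => (bracket v) `^ (- n.+1%:R))).
    apply: (measurableT_comp (measurable_powR _)); exact: measurable_bracket.
  by apply/funext => v; rewrite powRN powR_mulrn// ltW ?bracket_gt0.
have iP (h : R -> R) : measurable_fun setT h -> (forall r, 0 <= h r) ->
    (forall r, h r <= `|r|) -> (leb n).-integrable setT (EFin \o P h).
  move=> mh h0 hr; rewrite /P.
  apply: (integrableD measurableT (f := fun v => (h (F (gnomonic v)) * _)%:E)
     (g := fun v => (h (F (escale (- 1) (gnomonic v))) * _)%:E)).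
  - apply: (le_integrable measurableT _ _ iA).
      apply/measurable_EFinP; apply: measurable_funM => //.
      by do 2 apply: measurableT_comp => //.
    by move=> v _; rewrite lee_fin normrM (ger0_norm (h0 _)) normrM ler_wpM2r.
  - apply: (le_integrable measurableT _ _ iB).
      apply/measurable_EFinP; apply: measurable_funM => //.
      by do 2 apply: measurableT_comp => //.
    by move=> v _; rewrite lee_fin normrM (ger0_norm (h0 _)) normrM ler_wpM2r.
have sP (h : R -> R) : measurable_fun setT h -> (forall r, 0 <= h r) ->
   (\int[surface_measure]_w (h (F w))%:E = \int[leb n]_v (P h v)%:E)%E.
  move=> mh h0; rewrite surface_integral_gnomonic//.
  - by apply: eq_integral => v _; rewrite -EFinD -EFinM mulrDl.
  - by apply/measurable_EFinP; exact: measurableT_comp.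
  - by move=> x; rewrite lee_fin.
rewrite {1}/Rintegral integralE.
have -> : (\int[surface_measure]_w (fun x => (F x)%:E)^\+ w =
  \int[leb n]_v (P hp v)%:E)%E.
  by rewrite -sP//; apply: eq_integral => v _; rewrite funeposE /hp EFin_max.
have -> : (\int[surface_measure]_w (fun x => (F x)%:E)^\- w =
  \int[leb n]_v (P hn v)%:E)%E.
  by rewrite -sP//; apply: eq_integral => v _; rewrite funenegE /hn EFin_max.
rewrite -integralB_EFin//; last 2 first.
- exact: iP.
- exact: iP.
rewrite /Rintegral; congr fine; apply: eq_integral => v _.
rewrite -EFinB; congr EFin; rewrite /P opprD addrACA -!mulrBl.
have hpn r : hp r - hn r = r.
  rewrite /hp /hn; have [r0|r0] := leP 0 r.
    by rewrite max_r ?subr0// oppr_le0.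
  by rewrite max_l ?sub0r ?opprK// oppr_ge0 ltW.
by rewrite !hpn.
Qed.

Definition head w : R := tnth w ord0.
Definition tail w : euc R n := [tuple of behead w].

(** The gnomonic coordinate of [w]; antipodal points share it. *)
Definition slope w : euc R n := escale (head w)^-1 (tail w).

(** Two antipodal caps carrying [g] and its conjugate in gnomonic coordinates:
    with such a pair the extension is real valued.  The factor [sg ^+ 2] removes
    the equator, where the coordinate degenerates. *)
Definition cap_pair g w : R[i] :=
  ((Num.sg (head w) ^+ 2 * complex.Re (g (slope w)))%R +i*
   (Num.sg (head w) * complex.Im (g (slope w)))%R)%C.

Lemma escale_coords (c : R) v :
  head (escale c (lift1 v)) = c /\ tail (escale c (lift1 v)) = escale c v.
Proof.
rewrite -tuple_cons_escale; split; first by rewrite /head tnth0.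
by apply/val_inj.
Qed.

Lemma slope_escale (c : R) v : c != 0 -> slope (escale c (lift1 v)) = v.
Proof.
by move=> c0; rewrite /slope; have [-> ->] := escale_coords c v;
  rewrite escaleA mulVf// escale1.
Qed.

Lemma cap_pair_escale (c : R) v g : c != 0 -> cap_pair g (escale c (lift1 v)) =
  (complex.Re (g v) +i* (Num.sg c * complex.Im (g v))%R)%C.
Proof.
move=> c0; rewrite /cap_pair slope_escale//.
by have [-> _] := escale_coords c v; rewrite sqr_sg c0 mul1r.
Qed.

Lemma cap_pair_north v g : cap_pair g (gnomonic v) = g v.
Proof.
rewrite cap_pair_escale; last by rewrite invr_eq0 gt_eqF// bracket_gt0.
by rewrite gtr0_sg ?invr_gt0 ?bracket_gt0// mul1r; case: (g v).
Qed.

Lemma cap_pair_south v g : cap_pair g (escale (- 1) (gnomonic v)) =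
  (complex.Re (g v) +i* (- complex.Im (g v))%R)%C.
Proof.
rewrite /gnomonic /sphere_proj escaleA cap_pair_escale; last first.
  by rewrite mulN1r oppr_eq0 invr_eq0 gt_eqF// bracket_gt0.
by rewrite mulN1r sgrN gtr0_sg ?invr_gt0 ?bracket_gt0// mulN1r.
Qed.

Lemma measurable_head : measurable_fun setT head.
Proof. exact: measurable_tnth. Qed.

Lemma measurable_tail : measurable_fun setT tail.
Proof. exact: measurable_behead. Qed.

Lemma measurable_sg : measurable_fun setT (@Num.sg R).
Proof.
rewrite /Num.sg; apply: measurable_fun_ifT.
- exact: measurable_fun_eqr.
- exact: measurable_cst.
- apply: measurable_fun_ifT; [|exact: measurable_cst|exact: measurable_cst].
  by apply: measurable_fun_ltr => //; exact: measurable_cst.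
Qed.

Lemma measurable_inv : measurable_fun setT (fun r : R => r^-1).
Proof.
rewrite (_ : (fun=> _) = (fun r => Num.sg r * `|r| `^ (-1))).
  apply: measurable_funM; first exact: measurable_sg.
  by apply: (measurableT_comp (measurable_powR _)).
apply/funext => r; rewrite powR_inv1//; have [->|r0] := eqVneq r 0.
  by rewrite sgr0 mul0r invr0.
rewrite {1}(numEsg r) invfM; congr (_ * _).
by apply: (mulfI (x := Num.sg r)); rewrite ?sgr_eq0// mulfV ?sgr_eq0// -expr2 sqr_sg r0.
Qed.

Lemma measurable_slope : measurable_fun setT slope.
Proof.
apply: (measurableT_comp (@measurable_escale_pair R n)
  (g := fun w => ((head w)^-1 : measurableTypeR R, tail w))).
apply: measurable_fun_pair; last exact: measurable_tail.
exact: (measurableT_comp measurable_inv measurable_head).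
Qed.

Lemma cmeasurable_comp d1 d2 (X : measurableType d1) (Y : measurableType d2)
    (u : X -> Y) (f : Y -> R[i]) :
  measurable_fun setT u -> cmeasurable f -> cmeasurable (f \o u).
Proof.
move=> mu_ [fr fi]; split.
  exact: (measurableT_comp fr mu_).
exact: (measurableT_comp fi mu_).
Qed.

Lemma cmeasurable_cap_pair g : cmeasurable g -> cmeasurable (cap_pair g).
Proof.
move=> mg; have [gr gi] := cmeasurable_comp measurable_slope mg.
have ms : measurable_fun setT (fun w => Num.sg (head w)).
  exact: (measurableT_comp measurable_sg measurable_head).
split => /=; apply: measurable_funM => //.
by apply: measurable_funX.
Qed.

Lemma measurable_bracketV (k : nat) : measurable_fun setT (fun v => bracket v ^- k).
Proof.
apply: (measurableT_comp measurable_inv).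
by apply: measurable_funX; exact: measurable_bracket.
Qed.

Lemma L2sq_cap_pair g : cmeasurable g ->
  L2sq surface_measure (cap_pair g) =
  (\int[leb n]_v ((2 * cmod (g v) ^+ 2) * bracket v ^- n.+1)%:E)%E.
Proof.
move=> mg; rewrite /L2sq surface_integral_gnomonic//; first last.
- by move=> w; rewrite lee_fin sqr_ge0.
- apply/measurable_EFinP; apply: measurable_funX.
  exact: (cmeasurable_cmod (cmeasurable_cap_pair mg)).
apply: eq_integral => v _; rewrite cap_pair_north cap_pair_south.
by rewrite !sqr_cmod /= sqrrN -EFinD -EFinM mulr_natl mulr2n.
Qed.

(** The oscillatory integral over the northern cap. *)
Definition cap_integral g x : R[i] :=
  cint (leb n) (fun v => cis (dot x (gnomonic v)) *
    (((bracket v ^- n.+1)%:C)%C * g v)).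

Lemma measurable_dotl k (x : euc R k) : measurable_fun setT (dot x).
Proof.
apply: measurable_sum => i; apply: measurable_funM => //.
exact: measurable_coord.
Qed.

Lemma dotN k (x y : euc R k) : dot x (escale (- 1) y) = - dot x y.
Proof.
rewrite /dot -sumrN; apply: eq_bigr => i _.
by rewrite tnth_mktuple mulN1r mulrN.
Qed.

Lemma bracketV_itv k v : 0 <= bracket v ^- k <= 1.
Proof.
rewrite invr_ge0 exprn_ge0 ?(ltW (bracket_gt0 v))//=.
by rewrite invf_le1 ?exprn_gt0 ?bracket_gt0// exprn_ege1// bracket_ge1.
Qed.

Lemma cintegrable_weight g : cintegrable (leb n) g ->
  cintegrable (leb n) (fun v => ((bracket v ^- n.+1)%:C)%C * g v).
Proof.
move=> ig; apply: (@cintegrableM _ _ _ _ _ _ 1) => //.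
  by split => /=; [exact: measurable_bracketV|exact: measurable_cst].
by move=> v; have /andP[v0 v1] := bracketV_itv n.+1 v; rewrite cmod_real ger0_norm.
Qed.

(** The southern cap contributes the complex conjugate of the northern one. *)
Lemma extension_cap_pair g x : cintegrable (leb n) g ->
  cmod (extension (cap_pair g) x) =
  (2 * pi) `^ (- (n.+1%:R / 2)) * `|2 * complex.Re (cap_integral g x)|.
Proof.
move=> ig; have mg := cintegrable_cmeasurable ig.
rewrite /extension /fourier_int cmodM cmod_real ger0_norm ?powR_ge0//.
congr (_ * _).
have mF : cmeasurable (fun w => cis (1 * dot x w) * cap_pair g w).
  apply: cmeasurableM; last exact: cmeasurable_cap_pair.
  apply: cmeasurable_cis; apply: measurable_funM; first exact: measurable_cst.
  exact: measurable_dotl.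
have mk : measurable_fun setT (fun v => dot x (gnomonic v)).
  exact: (measurableT_comp (measurable_dotl x) measurable_gnomonic).
have [iN1 iN2] := cintegrable_cis mk (cintegrable_weight ig).
have ReE v : complex.Re (cis (1 * dot x (gnomonic v)) * cap_pair g (gnomonic v)) *
    bracket v ^- n.+1 = complex.Re (cis (dot x (gnomonic v)) *
    (((bracket v ^- n.+1)%:C)%C * g v)).
  by rewrite mul1r cap_pair_north !(ReM, ImM) /=; ring.
have ImE v : complex.Im (cis (1 * dot x (gnomonic v)) * cap_pair g (gnomonic v)) *
    bracket v ^- n.+1 = complex.Im (cis (dot x (gnomonic v)) *
    (((bracket v ^- n.+1)%:C)%C * g v)).
  by rewrite mul1r cap_pair_north !ImM !(ReM, ImM) /=; ring.
have ReS v : complex.Re (cis (1 * dot x (escale (- 1) (gnomonic v))) *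
    cap_pair g (escale (- 1) (gnomonic v))) *
    bracket v ^- n.+1 = complex.Re (cis (dot x (gnomonic v)) *
    (((bracket v ^- n.+1)%:C)%C * g v)).
  by rewrite mul1r dotN cap_pair_south !(ReM, ImM) /= cosN sinN; ring.
have ImS v : complex.Im (cis (1 * dot x (escale (- 1) (gnomonic v))) *
    cap_pair g (escale (- 1) (gnomonic v))) *
    bracket v ^- n.+1 = - complex.Im (cis (dot x (gnomonic v)) *
    (((bracket v ^- n.+1)%:C)%C * g v)).
  by rewrite mul1r dotN cap_pair_south !ImM !(ReM, ImM) /= cosN sinN; ring.
rewrite cmodE /cint /=.
rewrite [X in Num.sqrt (X ^+ 2 + _)]surface_Rintegral_gnomonic; first last.
- by under eq_fun do rewrite ReS.
- by under eq_fun do rewrite ReE.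
- exact: mF.1.
rewrite [X in Num.sqrt (_ + X ^+ 2)]surface_Rintegral_gnomonic; first last.
- under eq_fun do rewrite ImS.
  by have := integrableN iN2; congr integrable.
- by under eq_fun do rewrite ImE.
- exact: mF.2.
under [X in Num.sqrt (X ^+ 2 + _)]eq_Rintegral do rewrite ReE ReS.
under [X in Num.sqrt (_ + X ^+ 2)]eq_Rintegral do rewrite ImE ImS subrr.
rewrite [X in Num.sqrt (_ + X ^+ 2)]/Rintegral integral0 expr0n addr0 sqrtr_sqr RintegralD//.
by rewrite /cap_integral /cint /= mulr_natl mulr2n.
Qed.

Lemma measurable_dot_pair k :
  measurable_fun setT (fun z : euc R k * euc R k => dot z.1 z.2).
Proof.
apply: measurable_sum => i; apply: measurable_funM.
  by apply: (measurableT_comp (@measurable_coord R k i)); exact: measurable_fst.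
by apply: (measurableT_comp (@measurable_coord R k i)); exact: measurable_snd.
Qed.

Lemma cmeasurable_cap_integral g : cmeasurable g -> cmeasurable (cap_integral g).
Proof.
move=> mg; pose G (z : euc R n.+1 * euc R n) : R[i] :=
  cis (dot z.1 (gnomonic z.2)) * (((bracket z.2 ^- n.+1)%:C)%C * g z.2).
apply: (@cmeasurable_cint_param _ _ _ _ _ (leb n) G); apply: cmeasurableM.
  apply: cmeasurable_cis.
  apply: (measurableT_comp (@measurable_dot_pair n.+1)
    (g := fun z : euc R n.+1 * euc R n => (z.1, gnomonic z.2))).
  apply: measurable_fun_pair; first exact: measurable_fst.
  by apply: (measurableT_comp measurable_gnomonic); exact: measurable_snd.
apply: (cmeasurable_comp (f := fun v => ((bracket v ^- n.+1)%:C)%C * g v)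
  (u := snd)); first exact: measurable_snd.
apply: cmeasurableM => //.
by split => /=; [exact: measurable_bracketV|exact: measurable_cst].
Qed.

Lemma cap_integralZ (c : R[i]) g x : cintegrable (leb n) g ->
  cap_integral (fun v => c * g v) x = c * cap_integral g x.
Proof.
move=> ig; rewrite /cap_integral -cintZ; last first.
  apply: cintegrable_cis; last exact: cintegrable_weight.
  exact: (measurableT_comp (measurable_dotl x) measurable_gnomonic).
by congr cint; apply/funext => v; ring.
Qed.

Lemma st_exponentS k : (0 < k)%N -> st_exponent k.+1 = strichartz_exponent k :> R.
Proof.
move=> k0; rewrite /st_exponent /strichartz_exponent.
have -> : (k.+1%:R - 1 : R) = k%:R by rewrite -natr1 addrK.
by rewrite -natr1; field; rewrite pnatr_eq0 -lt0n.
Qed.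

Lemma cintegrableZ (c : R[i]) d1 (X : measurableType d1)
    (m : {measure set X -> \bar R}) (f : X -> R[i]) : cintegrable m f ->
  cintegrable m (fun y => c * f y).
Proof.
move=> jf; apply: (@cintegrableM _ _ _ _ (fun=> c) _ (cmod c)) => //.
Qed.

(** Multiplying [g] by a phase rotates the value of the cap integral, while the
    extension only sees a real part.  Averaging over the phases therefore
    produces the mean value of [|cos|^q] exactly. *)
Lemma phase_average g (B : \bar R) : (0 < n)%N -> cintegrable (leb n) g ->
  (forall a : R, (extension_int (cap_pair (fun v => (cis a * g v)%R)) <= B)%E) ->
  ((((2 * pi) `^ (- (n.+1%:R / 2)) * 2) `^ st_exponent n.+1)%:E *
   \int[mu]_(t in `[(- (pi / 2))%R, (pi / 2)%R]) (`|cos t| `^ st_exponent n.+1)%:E *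
   \int[leb n.+1]_x (cmod (cap_integral g x) `^ st_exponent n.+1)%:E <=
   pi%:E * B)%E.
Proof.
move=> n0 ig gB; set q : R := st_exponent n.+1.
have q0 : 0 < q.
  by rewrite /q st_exponentS// addr_gt0// divr_gt0// ltr0n.
set C := (2 * pi) `^ _.
have C0 : 0 <= C by exact: powR_ge0.
pose I : set R := `[(- (pi / 2))%R, (pi / 2)%R]%classic.
have B0 : (0 <= B)%E.
  apply: le_trans (gB 0); apply: integral_ge0 => x _.
  by rewrite lee_fin powR_ge0.
have [E1 E2] := cmeasurable_cap_integral (cintegrable_cmeasurable ig).
pose K (z : measurableTypeR R * euc R n.+1) : \bar R :=
  ((C * 2) `^ q * `|complex.Re (cap_integral g z.2) * cos (z.1 : R) -
    complex.Im (cap_integral g z.2) * sin (z.1 : R)| `^ q * \1_I (z.1 : R))%:E.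
have K0 z : (0 <= K z)%E by rewrite lee_fin !mulr_ge0 ?powR_ge0// indicE.
have m1 : measurable_fun setT (fst : measurableTypeR R * euc R n.+1 -> R).
  exact: measurable_fst.
have m2 : measurable_fun setT (snd : measurableTypeR R * euc R n.+1 -> euc R n.+1).
  exact: measurable_snd.
have mI : measurable I by exact: measurable_itv.
have mK : measurable_fun setT K.
  apply/measurable_EFinP; apply: measurable_funM; last first.
    by apply: measurableT_comp m1; exact: measurable_indic.
  apply: measurable_funM; first exact: measurable_cst.
  apply: (measurableT_comp (measurable_powR _)); apply: measurableT_comp => //.
  apply: measurable_funB; apply: measurable_funM.
  - exact: (measurableT_comp E1 m2).
  - apply: measurableT_comp m1; apply: continuous_measurable_fun.
    exact: continuous_cos.
  - exact: (measurableT_comp E2 m2).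
  - apply: measurableT_comp m1; apply: continuous_measurable_fun.
    exact: continuous_sin.
have KE : (\int[leb n.+1]_x \int[mu]_t K (t, x) =
  ((C * 2) `^ q)%:E *
   \int[mu]_(t in `[(- (pi / 2))%R, (pi / 2)%R]) (`|cos t| `^ q)%:E *
   \int[leb n.+1]_x (cmod (cap_integral g x) `^ q)%:E)%E.
  rewrite muleAC -[X in (X * _)%E]ge0_integralZl//; last 3 first.
  - apply/measurable_EFinP; apply: (measurableT_comp (measurable_powR _)).
    exact: (cmeasurable_cmod (conj E1 E2)).
  - by move=> x _; rewrite lee_fin powR_ge0.
  - by rewrite lee_fin powR_ge0.
  rewrite -ge0_integralZr//; last 3 first.
  - apply: measurable_funeM; apply/measurable_EFinP.
    apply: (measurableT_comp (measurable_powR _)).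
    exact: (cmeasurable_cmod (conj E1 E2)).
  - by move=> x _; rewrite mule_ge0// lee_fin powR_ge0.
  - by apply: integral_ge0 => x _; rewrite lee_fin powR_ge0.
  apply: eq_integral => x _; rewrite cmodE -muleA -circle_average//.
  rewrite -ge0_integralZl//; last 2 first.
  - apply/measurable_EFinP/measurable_funTS.
    apply: (measurableT_comp (measurable_powR _)); apply: measurableT_comp => //.
    apply: measurable_funB; apply: measurable_funM => //.
      by apply: continuous_measurable_fun; exact: continuous_cos.
    by apply: continuous_measurable_fun; exact: continuous_sin.
  - by rewrite lee_fin powR_ge0.
  rewrite [RHS]integral_mkcond; apply: eq_integral => t _.
  rewrite /K /= patchE indicE /I.
  by case: ifPn => _; rewrite ?mulr1 ?mulr0// EFinM.
rewrite -KE -fubini_tonelli//.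
apply: (@le_trans _ _ (\int[mu]_t (B * (\1_I t)%:E))%E).
  apply: ge0_le_integral => //.
  - by move=> t _; exact: integral_ge0.
  - exact: measurable_fun_fubini_tonelli_F.
  - by apply: measurable_funeM; apply/measurable_EFinP; exact: measurable_indic.
  move=> t _; rewrite indicE; have [tI|tI] := boolP (t \in I).
    rewrite mule1; apply: le_trans (gB t); rewrite /extension_int le_eqVlt.
    apply/orP; left; apply/eqP; apply: eq_integral => x _.
    rewrite (extension_cap_pair x (cintegrableZ (cis t) ig)) cap_integralZ//.
    rewrite ReM [complex.Re (cis t)]/= [complex.Im (cis t)]/=.
    rewrite /K [(t, x).1]/= [(t, x).2]/= indicE tI mulr1.
    rewrite -powRM ?mulr_ge0// -/q -/C; congr (_ `^ _)%:E.
    rewrite normrM (@ger0_norm _ 2)// mulrA.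
    by congr (_ * `|_|); ring.
  rewrite mule0 integral0_eq// => x _.
  by rewrite /K /= indicE (negbTE tI) mulr0.
rewrite ge0_integralZl//; last by apply/measurable_EFinP; exact: measurable_indic.
have -> : (\int[mu]_t (\1_I t)%:E = pi%:E)%E.
  rewrite integral_indic// setIT; transitivity (lebesgue_measure I) => //.
  rewrite [LHS]lebesgue_measure_itv /= lte_fin gtrN ?divr_gt0 ?pi_gt0//.
  by rewrite -EFinB opprK (_ : pi / 2 + pi / 2 = pi)//; field.
by rewrite muleC.
Qed.

End CapPair.

(** * Parabolic blow-up at the poles *)

Section Concentration.
Context {R : realType} {n : nat}.
Local Notation mu := (@lebesgue_measure R).
Local Notation leb := (lebesgue_euc R).
Implicit Types (v y xi : euc R n) (phi : euc R n -> R[i]).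

Lemma integral_cos_fin (q : R) : 0 < q ->
  exists2 a : R, 0 <= a &
    (\int[mu]_(t in `[(- (pi / 2))%R, (pi / 2)%R]) (`|cos t| `^ q)%:E)%E = a%:E.
Proof.
move=> q0; have A0 : (0 <= \int[mu]_(t in `[(- (pi / 2))%R, (pi / 2)%R]) (`|cos t| `^ q)%:E)%E.
  by apply: integral_ge0 => t _; rewrite lee_fin powR_ge0.
have : (\int[mu]_(t in `[(- (pi / 2))%R, (pi / 2)%R]) (`|cos t| `^ q)%:E < +oo)%E.
  apply: (@le_lt_trans _ _ (\int[mu]_(t in `[(- (pi / 2))%R, (pi / 2)%R]) 1%:E)%E).
    apply: ge0_le_integral => //.
    - apply/measurable_EFinP/measurable_funTS.
      apply: (measurableT_comp (measurable_powR _)); apply: measurableT_comp => //.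
      by apply: continuous_measurable_fun; exact: continuous_cos.
    - move=> t _; rewrite lee_fin.
      have -> : 1 = 1 `^ q :> R by rewrite powR1.
      apply: ge0_ler_powR; rewrite ?nnegrE ?(ltW q0)//.
      by rewrite ler_norml cos_geN1 cos_le1.
  rewrite integral_cst// mul1e; apply: le_lt_trans (ltry (pi : R)).
  rewrite [leLHS]lebesgue_measure_itv /= lte_fin; case: ifPn => _.
    by rewrite -EFinB lee_fin opprK -splitr.
  by rewrite lee_fin pi_ge0.
move: A0; case: (\int[mu]_(t in _) _)%E => [a| |]//.
by rewrite lee_fin => a0 _; exists a.
Qed.

Lemma Rintegral_escale (c : R) (F : euc R n -> R) : c != 0 ->
  (leb n).-integrable setT (EFin \o F) ->
  \int[leb n]_v F (escale c v) = `|c| ^- n * \int[leb n]_v F v.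
Proof.
move=> c0 iF; have /measurable_EFinP mF := measurable_int _ iF.
rewrite /Rintegral [in LHS]integralE.
have -> : (\int[leb n]_v (fun y => (F (escale c y))%:E)^\+ v =
    (`|c| ^- n)%:E * \int[leb n]_v (EFin \o F)^\+ v)%E.
  rewrite -ge0_integral_escale//; last exact/measurable_funepos/measurable_EFinP.
  by apply: eq_integral => v _; rewrite !funeposE.
have -> : (\int[leb n]_v (fun y => (F (escale c y))%:E)^\- v =
    (`|c| ^- n)%:E * \int[leb n]_v (EFin \o F)^\- v)%E.
  rewrite -ge0_integral_escale//; last exact/measurable_funeneg/measurable_EFinP.
  by apply: eq_integral => v _; rewrite !funenegE.
rewrite -muleBr//.
  by rewrite -integralE fineM// integrable_fin_num.
by apply: fin_num_adde_defr; exact: integrable_pos_fin_num.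
Qed.

Lemma dotC k (x y : euc R k) : dot x y = dot y x.
Proof. by apply: eq_bigr => i _; rewrite mulrC. Qed.

Lemma dotZl k (c : R) (x y : euc R k) : dot (escale c x) y = c * dot x y.
Proof.
rewrite /dot mulr_sumr; apply: eq_bigr => i _.
by rewrite tnth_mktuple mulrA.
Qed.

Lemma dotZr k (c : R) (x y : euc R k) : dot x (escale c y) = c * dot x y.
Proof. by rewrite dotC dotZl dotC. Qed.

Lemma dot_gnomonic (s : R) y v :
  dot (tuple_cons (s, y)) (gnomonic v) = (s + dot y v) / bracket v.
Proof. by rewrite /gnomonic /sphere_proj dotZr dot_cons mulr1 mulrC. Qed.

Lemma ge0_integral_parabolic (e : R) (F : euc R n.+1 -> \bar R) : 0 < e ->
  measurable_fun setT F -> (forall x, 0 <= F x)%E ->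
  (\int[leb n.+1]_x F x = (e ^- (n + 2))%:E *
   \int[mu]_t \int[leb n]_y F (tuple_cons ((e ^- 2 * (t : R))%R, escale e^-1%R y)))%E.
Proof.
move=> e0 mF F0; rewrite ge0_integral_cons//.
have en0 : e != 0 by rewrite gt_eqF.
have mFs (s : R) : measurable_fun setT (fun y => F (tuple_cons (s, y))).
  apply: measurableT_comp => //.
  apply: (measurableT_comp (@measurable_tuple_cons R n)).
  exact: pair1_measurable.
under [in RHS]eq_integral => t _.
  rewrite (ge0_integral_escale (F := fun y => F (tuple_cons ((e ^- 2 * (t : R))%R, y))))//;
    last by rewrite invr_eq0.
  over.
have mI : measurable_fun setT
    (fun s : measurableTypeR R => \int[leb n]_y F (tuple_cons (s, y)))%E.
  apply: (measurable_fun_fubini_tonelli_F (F \o @tuple_cons R n)) => [|x].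
    by apply: measurableT_comp => //; exact: measurable_tuple_cons.
  exact: F0.
rewrite (@ge0_integral_scaleZ _ (e ^- 2) (`|e^-1| ^- n)
  (fun s => \int[leb n]_y F (tuple_cons (s, y)))%E)//; last 2 first.
- by rewrite invr_eq0 expf_neq0.
- by move=> s; exact: integral_ge0.
rewrite muleA -EFinM -[LHS]mul1e; congr (_ %:E * _)%E.
rewrite !gtr0_norm ?invr_gt0 ?exprn_gt0// exprVn !invrK exprD invfM.
by rewrite -mulrA mulKf ?mulVf// expf_neq0.
Qed.

Definition rescale (e : R) phi : euc R n -> R[i] := fun v => phi (escale e^-1 v).

(** Phase of the northern cap integral in parabolically rescaled variables, once
    the fast phase [e ^- 2 * t], constant in [xi], has been removed. *)
Definition blowup_phase (e : R) (z : measurableTypeR R * euc R n) xi : R :=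
  - ((z.1 : R) * (dot xi xi / (bracket (escale e xi) * (1 + bracket (escale e xi)))))
  + dot z.2 xi / bracket (escale e xi).

Definition blowup (e : R) phi (z : measurableTypeR R * euc R n) : R[i] :=
  cint (leb n) (fun xi => cis (blowup_phase e z xi) *
    (((bracket (escale e xi) ^- n.+1)%:C)%C * phi xi)).

Lemma measurable_blowup_phase (e : R) : measurable_fun setT
  (fun p : (measurableTypeR R * euc R n) * euc R n => blowup_phase e p.1 p.2).
Proof.
have m1 : measurable_fun setT
    (fun p : (measurableTypeR R * euc R n) * euc R n => p.1.1 : R).
  by apply: (measurableT_comp (@measurable_fst _ _ _ _)); exact: measurable_fst.
have m2 : measurable_fun setT
    (fun p : (measurableTypeR R * euc R n) * euc R n => p.1.2).
  by apply: (measurableT_comp (@measurable_snd _ _ _ _)); exact: measurable_fst.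
have m3 : measurable_fun setT
    (snd : (measurableTypeR R * euc R n) * euc R n -> euc R n).
  exact: measurable_snd.
have mb : measurable_fun setT
    (fun p : (measurableTypeR R * euc R n) * euc R n => bracket (escale e p.2)).
  apply: (measurableT_comp measurable_bracket).
  exact: (measurableT_comp (@measurable_escale R n e) m3).
have mdot (u v : (measurableTypeR R * euc R n) * euc R n -> euc R n) :
    measurable_fun setT u -> measurable_fun setT v ->
    measurable_fun setT (fun p => dot (u p) (v p)).
  move=> mu_ mv; apply: (measurableT_comp (@measurable_dot_pair R n)
    (g := fun p => (u p, v p))).
  exact: measurable_fun_pair.
apply: measurable_funD.
  apply: measurableT_comp => //; apply: measurable_funM => //.
  apply: measurable_funM; first exact: mdot.
  apply: (measurableT_comp measurable_inv).
  by apply: measurable_funM => //; exact: measurable_funD.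
apply: measurable_funM; first exact: mdot.
exact: (measurableT_comp measurable_inv mb).
Qed.

Lemma cmeasurable_weight_escale (e : R) phi : cmeasurable phi ->
  cmeasurable (fun xi => ((bracket (escale e xi) ^- n.+1)%:C)%C * phi xi).
Proof.
move=> mp; apply: cmeasurableM => //; split => /=; last exact: measurable_cst.
exact: (measurableT_comp (measurable_bracketV _) (@measurable_escale R n e)).
Qed.

Lemma measurable_blowup_phase1 (e : R) z : measurable_fun setT (blowup_phase e z).
Proof.
apply: (measurableT_comp (measurable_blowup_phase e) (g := fun xi => (z, xi))).
exact: pair1_measurable.
Qed.

Lemma cmeasurable_blowup (e : R) phi : cmeasurable phi -> cmeasurable (blowup e phi).
Proof.
move=> mp; apply: (@cmeasurable_cint_param _ _ _ _ _ (leb n)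
  (fun p => cis (blowup_phase e p.1 p.2) *
    (((bracket (escale e p.2) ^- n.+1)%:C)%C * phi p.2))).
apply: cmeasurableM; first exact: (cmeasurable_cis (measurable_blowup_phase e)).
exact: (cmeasurable_comp (@measurable_snd _ _ _ _) (cmeasurable_weight_escale e mp)).
Qed.

(** Up to the factor (2 pi)^(-n/2), the solution at time [z.1] and place [z.2] of
    the Schroedinger equation whose initial datum has Fourier transform [phi]. *)
Definition schroedinger_integral phi (z : measurableTypeR R * euc R n) : R[i] :=
  cint (leb n) (fun xi =>
    cis (- ((z.1 : R) * (dot xi xi / 2)) + dot z.2 xi) * phi xi).

(** With b = <e xi>, the part e^-2 t / b of the phase exceeds e^-2 t by
    e^-2 t (1 / b - 1) = - t |xi|^2 / (b (1 + b)), because b^2 - 1 = e^2 |xi|^2. *)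
Lemma cap_integral_rescale (e : R) phi (t : R) y : 0 < e ->
  cintegrable (leb n) phi ->
  cmod (cap_integral (rescale e phi) (tuple_cons (e ^- 2 * t, escale e^-1 y))) =
  e ^+ n * cmod (blowup e phi (t, y)).
Proof.
move=> e0 ip; have en0 : e != 0 by rewrite gt_eqF.
have mp := cintegrable_cmeasurable ip.
pose th := blowup_phase e (t, y).
pose w xi : R[i] := ((bracket (escale e xi) ^- n.+1)%:C)%C * phi xi.
have iw : cintegrable (leb n) w.
  apply: (@cintegrable_dominated _ _ _ _ _ (cmod \o phi)).
  - exact: cmeasurable_weight_escale.
  - exact: cintegrable_cmod.
  - move=> v; have /andP[v0 v1] := bracketV_itv n.+1 (escale e v).
    by rewrite cmodM cmod_real ger0_norm// -[leRHS]mul1r ler_wpM2r ?cmod_ge0.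
have itw : cintegrable (leb n) (fun xi => cis (th xi) * w xi).
  by apply: cintegrable_cis => //; exact: measurable_blowup_phase1.
pose H xi : R[i] := cis (e ^- 2 * t) * (cis (th xi) * w xi).
have iH : cintegrable (leb n) H by exact: cintegrableZ.
have -> : cap_integral (rescale e phi) (tuple_cons (e ^- 2 * t, escale e^-1 y)) =
    cint (leb n) (fun v => H (escale e^-1 v)).
  rewrite /cap_integral; congr cint; apply/funext => v.
  rewrite /H /w escaleA mulfV// escale1 /rescale [in RHS]mulrA -cisD; congr (cis _ * _).
  rewrite dot_gnomonic dotZl /th /blowup_phase /= escaleA mulfV// escale1 dotZr dotZl dotZr.
  have b0 := bracket_gt0 v.
  have -> : dot v v = bracket v ^+ 2 - 1.
    by rewrite bracket_sqr addrAC subrr add0r.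
  by field; rewrite en0 !gt_eqF// addr_gt0.
have -> : cint (leb n) (fun v => H (escale e^-1 v)) =
    ((e ^+ n)%:C)%C * cint (leb n) H.
  have [iH1 iH2] := iH.
  have ei0 : e^-1 != 0 by rewrite invr_eq0.
  apply: complex_eq; rewrite ?ReM ?ImM /cint /= ?mul0r ?subr0 ?addr0.
    rewrite (Rintegral_escale ei0 iH1) gtr0_norm ?invr_gt0//.
    by rewrite exprVn invrK.
  rewrite (Rintegral_escale ei0 iH2) gtr0_norm ?invr_gt0//.
  by rewrite exprVn invrK.
rewrite cmodM cmod_real ger0_norm ?exprn_ge0 ?ltW// cintZ//.
by rewrite cmodM cmod_cis mul1r.
Qed.

(** The brackets in phase and weight tend to 1, and |phi| dominates. *)
Lemma blowup_cvg (e : nat -> R) phi z : (forall k, 0 < e k) ->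
  e k @[k --> \oo] --> 0 -> cintegrable (leb n) phi ->
  cmod (blowup (e k) phi z) @[k --> \oo] --> cmod (schroedinger_integral phi z).
Proof.
case: z => t y e0 ecvg ip.
pose b k xi := bracket (escale (e k) xi).
have bcvg xi : b k xi @[k --> \oo] --> (1 : R).
  rewrite (_ : b^~ xi = (fun k => Num.sqrt (1 + (e k * e k) * dot xi xi))); last first.
    apply/funext => k; rewrite /b -[LHS]ger0_norm ?ltW ?bracket_gt0// -sqrtr_sqr.
    by rewrite bracket_sqr dotZl dotZr mulrA.
  have lim1 : 1 + (e k * e k) * dot xi xi @[k --> \oo] --> 1 + (0 * 0) * dot xi xi.
    apply: cvgD; first exact: cvg_cst.
    by apply: cvgM; [exact: cvgM|exact: cvg_cst].
  rewrite mul0r mul0r addr0 in lim1.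
  have := cvg_comp _ _ lim1 (@sqrt_continuous R 1).
  by rewrite sqrtr1.
pose th k xi := - (t * (dot xi xi / (b k xi * (1 + b k xi)))) + dot y xi / b k xi.
have thcvg xi : th k xi @[k --> \oo] --> - (t * (dot xi xi / 2)) + dot y xi.
  have -> : - (t * (dot xi xi / 2)) + dot y xi =
      - (t * (dot xi xi / (1 * (1 + 1)))) + dot y xi / 1 by rewrite mul1r divr1.
  apply: cvgD.
    apply: cvgN; apply: cvgM; first exact: cvg_cst.
    apply: cvgM; first exact: cvg_cst.
    apply: cvgV; first by rewrite mul1r.
    apply: cvgM; first exact: bcvg.
    by apply: cvgD; [exact: cvg_cst|exact: bcvg].
  apply: cvgM; first exact: cvg_cst.
  by apply: cvgV; [exact: oner_neq0|exact: bcvg].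
have wcvg xi : b k xi ^- n.+1 @[k --> \oo] --> (1 : R).
  have -> : (1 : R) = 1 ^- n.+1 by rewrite expr1n invr1.
  apply: cvgV; first by rewrite expr1n oner_neq0.
  exact: (cvg_comp _ _ (bcvg xi) (@exprn_continuous R n.+1 1)).
have ccvg xi : cos (th k xi) @[k --> \oo] --> cos (- (t * (dot xi xi / 2)) + dot y xi).
  exact: (cvg_comp _ _ (thcvg xi) (@continuous_cos R _)).
have scvg xi : sin (th k xi) @[k --> \oo] --> sin (- (t * (dot xi xi / 2)) + dot y xi).
  exact: (cvg_comp _ _ (thcvg xi) (@continuous_sin R _)).
rewrite /blowup /schroedinger_integral.
apply: (@cvg_cmod_cint _ _ _ _ _ _ (cmod \o phi)).
- move=> k; apply: cmeasurableM.
    exact: (cmeasurable_cis (measurable_blowup_phase1 (e k) (t, y))).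
  exact/cmeasurable_weight_escale/(cintegrable_cmeasurable ip).
- move=> xi; under eq_fun do rewrite !(ReM, ImM) /= mul0r mul0r subr0 addr0.
  rewrite ReM /=; apply: cvgB; apply: cvgM.
  + exact: ccvg.
  + by rewrite -[X in _ --> X]mul1r; apply: cvgM; [exact: wcvg|exact: cvg_cst].
  + exact: scvg.
  + by rewrite -[X in _ --> X]mul1r; apply: cvgM; [exact: wcvg|exact: cvg_cst].
- move=> xi; under eq_fun do rewrite !(ReM, ImM) /= mul0r mul0r subr0 addr0.
  rewrite ImM /=; apply: cvgD; apply: cvgM.
  + exact: ccvg.
  + by rewrite -[X in _ --> X]mul1r; apply: cvgM; [exact: wcvg|exact: cvg_cst].
  + exact: scvg.
  + by rewrite -[X in _ --> X]mul1r; apply: cvgM; [exact: wcvg|exact: cvg_cst].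
- exact: cintegrable_cmod.
- move=> k xi; rewrite !cmodM cmod_cis mul1r cmod_real /=.
  have /andP[v0 v1] := bracketV_itv n.+1 (escale (e k) xi).
  by rewrite ger0_norm// -[leRHS]mul1r ler_wpM2r ?cmod_ge0.
Qed.

Lemma cintegrable_rescale (e : R) phi : 0 < e -> cintegrable (leb n) phi ->
  cintegrable (leb n) (rescale e phi).
Proof.
move=> e0 [ir ii]; have ei0 : e^-1 != 0 by rewrite invr_eq0 gt_eqF.
have aux (F : euc R n -> R) : (leb n).-integrable setT (EFin \o F) ->
    (leb n).-integrable setT (EFin \o (fun v => F (escale e^-1 v))).
  move=> /integrableP[mF Foo]; apply/integrableP; split.
    by apply: (measurableT_comp mF); exact: measurable_escale.
  rewrite (ge0_integral_escale (F := fun v => `|(F v)%:E|%E))//; last first.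
    exact: measurableT_comp.
  by rewrite lte_mul_pinfty// ?lee_fin ?invr_ge0 ?exprn_ge0.
by split; [exact: (aux _ ir)|exact: (aux _ ii)].
Qed.

(** The exponent is the one for which both sides scale alike. *)
Lemma integral_cap_rescale (e : R) phi : (0 < n)%N -> 0 < e ->
  cintegrable (leb n) phi ->
  (\int[leb n.+1]_x (cmod (cap_integral (rescale e phi) x) `^ st_exponent n.+1)%:E =
   (e ^+ (n + 2))%:E * \int[mu]_t \int[leb n]_y
     (cmod (blowup e phi (t, y)) `^ st_exponent n.+1)%:E)%E.
Proof.
move=> n0 e0 ip; set q : R := st_exponent n.+1.
have mp := cintegrable_cmeasurable ip.
have mW : measurable_fun setT (fun z => cmod (blowup e phi z) `^ q).
  apply: (measurableT_comp (measurable_powR _)).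
  exact: (cmeasurable_cmod (cmeasurable_blowup e mp)).
have mcap : measurable_fun setT
    (fun x => (cmod (cap_integral (rescale e phi) x) `^ q)%:E).
  apply/measurable_EFinP; apply: (measurableT_comp (measurable_powR _)).
  apply: cmeasurable_cmod; apply: cmeasurable_cap_integral.
  exact: (cintegrable_cmeasurable (cintegrable_rescale e0 ip)).
rewrite (ge0_integral_parabolic e0 mcap) => [|x]; last by rewrite lee_fin powR_ge0.
have nq : (e ^+ n) `^ q = e ^+ (n + 2) * e ^+ (n + 2).
  rewrite -powR_mulrn ?(ltW e0)// -powRrM -exprD -powR_mulrn ?(ltW e0)//.
  congr (_ `^ _); rewrite /q st_exponentS// /strichartz_exponent !natrD.
  by field; rewrite pnatr_eq0 -lt0n.
have E0 : (0 < e ^+ (n + 2))%R by rewrite exprn_gt0.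
transitivity ((e ^- (n + 2))%:E * ((e ^+ (n + 2) * e ^+ (n + 2))%:E *
    \int[mu]_t \int[leb n]_y (cmod (blowup e phi (t, y)) `^ q)%:E))%E; last first.
  by rewrite muleA -EFinM mulKf// gt_eqF.
apply: (congr1 (fun z => (_ * z)%E)).
transitivity (\int[mu]_t ((e ^+ (n + 2) * e ^+ (n + 2))%:E *
   \int[leb n]_y (cmod (blowup e phi (t, y)) `^ q)%:E))%E; last first.
  rewrite ge0_integralZl//.
  - apply: (measurable_fun_fubini_tonelli_F (m2 := leb n)
      (fun z => (cmod (blowup e phi z) `^ q)%:E)).
      exact/measurable_EFinP.
    by move=> z; rewrite lee_fin powR_ge0.
  - by move=> t _; apply: integral_ge0 => y _; rewrite lee_fin powR_ge0.
  - by rewrite lee_fin mulr_ge0// ltW.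
apply: eq_integral => t _.
transitivity (\int[leb n]_y ((e ^+ (n + 2) * e ^+ (n + 2))%:E *
   (cmod (blowup e phi (t, y)) `^ q)%:E))%E; last first.
  rewrite ge0_integralZl//.
  - apply/measurable_EFinP; apply: (measurableT_comp mW).
    exact: pair1_measurable.
  - by move=> y _; rewrite lee_fin powR_ge0.
  - by rewrite lee_fin mulr_ge0// ltW.
apply: eq_integral => y _; rewrite (cap_integral_rescale t y e0 ip) -EFinM.
by rewrite powRM ?exprn_ge0 ?(ltW e0) ?cmod_ge0// nq.
Qed.

(** The bound is averaged over phases for each cap radius, written in rescaled
    variables, and passed to the limit by Fatou's lemma. *)
Lemma concentration_bound (e : nat -> R) phi (B : \bar R) : (0 < n)%N ->
  (forall k, 0 < e k) -> e k @[k --> \oo] --> 0 -> cintegrable (leb n) phi ->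
  (forall k a, (extension_int (cap_pair (fun v => (cis a * rescale (e k) phi v)%R)) <=
     (e k ^+ (n + 2))%:E * B)%E) ->
  ((((2 * pi) `^ (- (n.+1%:R / 2)) * 2) `^ st_exponent n.+1)%:E *
   \int[mu]_(t in `[(- (pi / 2))%R, (pi / 2)%R]) (`|cos t| `^ st_exponent n.+1)%:E *
   \int[mu]_t \int[leb n]_y
     (cmod (schroedinger_integral phi (t, y)) `^ st_exponent n.+1)%:E <=
   pi%:E * B)%E.
Proof.
move=> n0 e0 ecvg ip eB; set q : R := st_exponent n.+1.
have q0 : 0 < q by rewrite /q st_exponentS// addr_gt0// divr_gt0// ltr0n.
set C := (2 * pi) `^ _.
have [a a0 aE] := integral_cos_fin q0.
rewrite aE -EFinM; set c := (C * 2) `^ q * a.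
have c0 : 0 <= c by rewrite mulr_ge0// powR_ge0.
have mp := cintegrable_cmeasurable ip.
have mW k : measurable_fun setT (fun z => cmod (blowup (e k) phi z) `^ q).
  apply: (measurableT_comp (measurable_powR _)).
  exact: (cmeasurable_cmod (cmeasurable_blowup (e k) mp)).
have mS : measurable_fun setT (fun z => cmod (schroedinger_integral phi z) `^ q).
  apply: (measurableT_comp (measurable_powR _)).
  apply: (measurable_fun_cvg (h := fun k z => cmod (blowup (e k) phi z))).
    by move=> k; exact: (cmeasurable_cmod (cmeasurable_blowup (e k) mp)).
  by move=> z _; exact: blowup_cvg.
pose m := (mu \x leb n)%E.
have toprod (f : measurableTypeR R * euc R n -> R) : measurable_fun setT f ->
    (forall z, 0 <= f z) ->
    (c%:E * \int[mu]_t \int[leb n]_y (f (t, y))%:E = \int[m]_z (c * f z)%:E)%E.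
  move=> mf f0; rewrite -[LHS](congr1 (fun z => (c%:E * z)%E)
    (fubini_tonelli1 (m1 := mu) (m2 := leb n) (EFin \o f) _ _))//; last first.
    exact/measurable_EFinP.
  rewrite -ge0_integralZl//; first exact/measurable_EFinP.
  by move=> z _; rewrite lee_fin.
rewrite (toprod _ mS) => [|z]; last exact: powR_ge0.
apply: (@fatou_le _ _ _ _ (fun k z => c * cmod (blowup (e k) phi z) `^ q)).
- move=> k; apply: measurable_funM; first exact: measurable_cst.
  exact: mW.
- by move=> k z; rewrite mulr_ge0// powR_ge0.
- move=> z; apply: cvgM; first exact: cvg_cst.
  by apply: cvg_powR_ge0 => // [k|]; [exact: cmod_ge0|exact: blowup_cvg].
move=> k; rewrite -(toprod _ (mW k)) => [|z]; last exact: powR_ge0.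
have ek0 := e0 k.
have := phase_average n0 (cintegrable_rescale ek0 ip) (eB k).
rewrite aE -EFinM -/q -/C -/c integral_cap_rescale// -/q.
have E0 : (0 < e k ^+ (n + 2))%R by rewrite exprn_gt0.
by rewrite muleCA [X in (_ <= X)%E -> _]muleCA lee_pmul2l// lte_fin.
Qed.

End Concentration.

(** * Poisson kernel and Plancherel's inequality *)

Section PoissonKernel.
Context {R : realType}.
Local Notation mu := (@lebesgue_measure R).
Local Notation leb := (lebesgue_euc R).
Variable e : R.
Hypothesis e0 : 0 < e.

Definition laplace1 (s : R) : R := expR (- (e * `|s|)).
(** The cosine transform of [laplace1]. *)
Definition poisson1 (z : R) : R := 2 * e / (e ^+ 2 + z ^+ 2).

Lemma continuous_laplace1 : continuous laplace1.
Proof.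
move=> s; apply: (@continuous_comp _ _ _ (fun s : R => - (e * `|s|)) (@expR R)).
  apply: cvgN; apply: cvgM; first exact: cvg_cst.
  exact: norm_continuous.
exact: continuous_expR.
Qed.

Lemma cvg_laplace0 : expR (- (e * s)) @[s --> +oo%R] --> (0 : R).
Proof.
apply: (@cvg_comp _ _ _ (fun s : R => e * s) (fun s => expR (- s)) _ +oo%R).
  by apply: gt0_cvgMry => //; exact: cvg_id.
exact: cvgr_expR.
Qed.

Lemma is_derive_mulr (c s : R) : is_derive s (1 : R) (fun s : R => c * s) c.
Proof.
have h := @is_deriveZ _ _ _ (@id R) c s 1 1 (is_derive_id s (1 : R)).
by apply: (is_derive_eq h); rewrite -[LHS]/(c * 1) mulr1.
Qed.

Lemma poisson_den_gt0 (z : R) : 0 < e ^+ 2 + z ^+ 2.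
Proof. by rewrite ltr_pwDl ?sqr_ge0// exprn_gt0. Qed.

(** The constant keeps the integrand nonnegative, so that the fundamental
    theorem of calculus applies on the whole half line. *)
Lemma integral_laplace1_shift (z : R) :
  (\int[mu]_s (laplace1 s * (1 + cos (s * z)))%:E = (2 / e + poisson1 z)%:E)%E.
Proof.
have f0 (s : R) : 0 <= laplace1 s * (1 + cos (s * z)).
  by rewrite mulr_ge0 ?expR_ge0// -lerBlDl sub0r cos_geN1.
have cc : continuous (fun s : R => cos (s * z)).
  move=> s; apply: (@continuous_comp _ _ _ (fun s : R => s * z) (@cos R)).
    by apply: cvgM; [exact: cvg_id|exact: cvg_cst].
  exact: continuous_cos.
have cf : continuous (fun s => laplace1 s * (1 + cos (s * z))).
  move=> s; apply: cvgM; first exact: continuous_laplace1.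
  by apply: cvgD; [exact: cvg_cst|exact: cc].
rewrite ge0_symfun_integralT//; last first.
  by move=> s /=; rewrite /laplace1 normrN mulNr cosN.
pose F (s : R) := - (expR (- (e * s)) / e) +
  expR (- (e * s)) * (z * sin (s * z) - e * cos (s * z)) / (e ^+ 2 + z ^+ 2).
have dF (s : R) : is_derive s (1 : R) F (expR (- (e * s)) * (1 + cos (s * z))).
  have dE : is_derive s (1 : R) (fun s : R => expR (- e * s)) (expR (- e * s) * - e).
    exact: (is_derive1_comp (is_derive_expR _) (is_derive_mulr _ _)).
  have dS : is_derive s (1 : R) (fun s : R => sin (z * s)) (cos (z * s) * z).
    exact: (is_derive1_comp (is_derive_sin _) (is_derive_mulr _ _)).
  have dC : is_derive s (1 : R) (fun s : R => cos (z * s)) (- sin (z * s) * z).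
    exact: (is_derive1_comp (is_derive_cos _) (is_derive_mulr _ _)).
  have dG := is_deriveB (is_deriveZ z dS) (is_deriveZ e dC).
  have dH := is_deriveZ (e ^+ 2 + z ^+ 2)^-1 (is_deriveM dE dG).
  have := is_deriveD (is_deriveZ (- e^-1) dE) dH.
  rewrite [X in is_derive _ _ X _](_ : _ = F); last first.
    apply/funext => r; rewrite /F -[- (e * r)]mulNr [r * z]mulrC.
    rewrite -[LHS]/(- e^-1 * expR (- e * r) + (e ^+ 2 + z ^+ 2)^-1 *
      (expR (- e * r) * (z * sin (z * r) - e * cos (z * r)))).
    ring.
  move=> h; apply: (is_derive_eq h).
  rewrite -[LHS]/(- e^-1 * (expR (- e * s) * - e) + (e ^+ 2 + z ^+ 2)^-1 *
      (expR (- e * s) * (z * (cos (z * s) * z) - e * (- sin (z * s) * z)) +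
       (z * sin (z * s) - e * cos (z * s)) * (expR (- e * s) * - e))).
  rewrite -[- (e * s)]mulNr [s * z]mulrC; field.
  by rewrite !gt_eqF// poisson_den_gt0.
have -> : [set x : R | 0 <= x] = `[0, +oo[%classic.
  by apply/seteqP; split => x /=; rewrite in_itv /= andbT.
rewrite (@ge0_continuous_FTC2y _ _ F _ 0).
- rewrite sub0e /F !mulr0 !mul0r oppr0 expR0 sin0 cos0 mulr0 sub0r.
  rewrite -EFinN -EFinM; congr EFin; rewrite /poisson1; field.
  by rewrite !gt_eqF// poisson_den_gt0.
- by move=> s _; exact: f0.
- exact: continuous_subspaceT.
- rewrite -[X in _ --> X]addr0; apply: cvgD.
    rewrite -oppr0; apply: cvgN; rewrite -[X in _ --> X](mul0r e^-1).
    by apply: cvgM; [exact: cvg_laplace0|exact: cvg_cst].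
  rewrite -[X in _ --> X](mul0r (e ^+ 2 + z ^+ 2)^-1).
  apply: cvgM; last exact: cvg_cst.
  pose M := `|z| + e.
  have gM (s : R) : `|z * sin (s * z) - e * cos (s * z)| <= M.
    rewrite (le_trans (ler_normB _ _))// !normrM lerD//.
      by rewrite -[leRHS]mulr1 ler_wpM2l// ler_norml sin_geN1 sin_le1.
    by rewrite (gtr0_norm e0) -[leRHS]mulr1 ler_wpM2l ?(ltW e0)// ler_norml cos_geN1 cos_le1.
  apply: (@squeeze_cvgr _ _ _ _ (fun s => - (expR (- (e * s)) * M))
     (fun s => expR (- (e * s)) * M)).
  - apply: nearW => s; rewrite -ler_norml normrM ger0_norm ?expR_ge0//.
    by rewrite ler_wpM2l// expR_ge0.
  - rewrite -oppr0; apply: cvgN; rewrite -[X in _ --> X](mul0r M).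
    by apply: cvgM; [exact: cvg_laplace0|exact: cvg_cst].
  - rewrite -[X in _ --> X](mul0r M).
    by apply: cvgM; [exact: cvg_laplace0|exact: cvg_cst].
- by move=> s _; have [] := dF s.
- apply: cvg_at_right_filter.
  have : derivable F 0 1 by have [] := dF 0.
  by move/derivable1_diffP/differentiable_continuous.
- move=> s; rewrite in_itv /= andbT => s0; rewrite derive1E.
  by have [_ ->] := dF s; rewrite /laplace1 gtr0_norm.
Qed.

Lemma measurable_laplace1 : measurable_fun setT laplace1.
Proof. exact: continuous_measurable_fun continuous_laplace1. Qed.

Lemma laplace1_ge0 s : 0 <= laplace1 s.
Proof. exact: expR_ge0. Qed.

Lemma integral_laplace1 : (\int[mu]_s (laplace1 s)%:E = (2 / e)%:E)%E.
Proof.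
have := integral_laplace1_shift 0.
under eq_integral do rewrite mulr0 cos0 mulrC EFinM.
rewrite ge0_integralZl//; last 2 first.
- by apply/measurable_EFinP; exact: measurable_laplace1.
- by move=> s _; rewrite lee_fin laplace1_ge0.
move=> h; rewrite -[LHS]mul1e -[X in (X%:E * _)%E](mulVf (lt0r_neq0 (@ltr0n R 2))).
rewrite EFinM -muleA h -EFinM; congr EFin; rewrite /poisson1; field.
by rewrite gt_eqF.
Qed.

Lemma integrable_laplace1 : mu.-integrable setT (EFin \o laplace1).
Proof.
apply/integrableP; split; first by apply/measurable_EFinP; exact: measurable_laplace1.
under eq_integral do rewrite /= ger0_norm ?laplace1_ge0//.
by rewrite integral_laplace1 ltry.
Qed.

Lemma integrable_laplace1_cos (z : R) :
  mu.-integrable setT (EFin \o (fun s => laplace1 s * cos (s * z))).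
Proof.
apply: (le_integrable measurableT _ _ integrable_laplace1).
  apply/measurable_EFinP; apply: measurable_funM; first exact: measurable_laplace1.
  apply: measurableT_comp; last exact: measurable_funM.
  by apply: continuous_measurable_fun; exact: continuous_cos.
move=> s _; rewrite lee_fin normrM -[leRHS]mulr1 ler_wpM2l//.
by rewrite ler_norml cos_geN1 cos_le1.
Qed.

Lemma integral_laplace1_cos (z : R) :
  (\int[mu]_s (laplace1 s * cos (s * z))%:E = (poisson1 z)%:E)%E.
Proof.
have := integral_laplace1_shift z.
under eq_integral do rewrite mulrDr mulr1 EFinD.
rewrite integralD//; last 2 first.
- exact: integrable_laplace1.
- exact: integrable_laplace1_cos.
rewrite integral_laplace1 EFinD => /(congr1 (fun x => (x - (2 / e)%:E)%E)).
by rewrite ![((2 / e)%:E + _)%E]addeC !addeK.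
Qed.

Lemma poisson1_ge0 z : 0 <= poisson1 z.
Proof. by rewrite divr_ge0 ?mulr_ge0 ?(ltW e0) ?(ltW (poisson_den_gt0 z)). Qed.

Lemma measurable_poisson1 : measurable_fun setT poisson1.
Proof.
apply: measurable_funM; first exact: measurable_cst.
by apply: (measurableT_comp (@measurable_inv R)); exact: measurable_funD.
Qed.

Lemma integral_poisson1 (b : R) :
  (\int[mu]_s (poisson1 ((s : R) + b))%:E = (2 * pi)%:E)%E.
Proof.
have mp : measurable_fun setT (fun s : measurableTypeR R => (poisson1 s)%:E).
  by apply/measurable_EFinP; exact: measurable_poisson1.
have p0 s : (0 <= (poisson1 s)%:E)%E by rewrite lee_fin poisson1_ge0.
have := ge0_integral_affine_pos b ltr01 mp p0.
rewrite invr1 mul1e; under eq_integral do rewrite mul1r.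
move=> ->; have := ge0_integral_affine_pos 0 e0 mp p0.
have -> : (\int[mu]_x (poisson1 (e * x + 0))%:E =
    \int[mu]_x ((2 / e)%:E * (oneDsqr x)^-1%:E))%E.
  apply: eq_integral => x _; rewrite addr0 -EFinM /poisson1 /oneDsqr; congr EFin.
  have b0 : 0 < 1 + x ^+ 2 by rewrite ltr_pwDl// sqr_ge0.
  have -> : e ^+ 2 + (e * x) ^+ 2 = e ^+ 2 * (1 + x ^+ 2) by ring.
  by field; rewrite !gt_eqF.
rewrite ge0_integralZl//; last 2 first.
- apply/measurable_EFinP; apply: continuous_measurable_fun.
  exact: continuous_oneDsqrV.
- by rewrite lee_fin divr_ge0// ?(ltW e0).
rewrite (@ge0_symfun_integralT _ (fun x => (oneDsqr x)^-1))//; last 2 first.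
- exact: continuous_oneDsqrV.
- by move=> x /=; rewrite /oneDsqr sqrrN.
have -> : [set x : R | 0 <= x] = `[0, +oo[%classic.
  by apply/seteqP; split => x /=; rewrite in_itv /= andbT.
rewrite integral0y_oneDsqr -!EFinM => /(congr1 (fun x => (e%:E * x)%E)).
rewrite muleA -!EFinM mulfV ?gt_eqF// mul1e => <-; congr EFin; field.
by rewrite gt_eqF.
Qed.

Definition laplace n (xi : euc R n) : R := \prod_(i < n) laplace1 (tnth xi i).

Definition poisson n (z : euc R n) : R := \prod_(i < n) poisson1 (tnth z i).

Lemma laplace_cons n (s : R) (xi : euc R n) :
  laplace (tuple_cons (s, xi)) = laplace1 s * laplace xi.
Proof.
rewrite /laplace big_ord_recl tnth0; congr (_ * _).
by apply: eq_bigr => i _; rewrite tnthS.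
Qed.

Lemma poisson_cons n (s : R) (z : euc R n) :
  poisson (tuple_cons (s, z)) = poisson1 s * poisson z.
Proof.
rewrite /poisson big_ord_recl tnth0; congr (_ * _).
by apply: eq_bigr => i _; rewrite tnthS.
Qed.

Lemma laplace_ge0 n (xi : euc R n) : 0 <= laplace xi.
Proof. by apply: prodr_ge0 => i _; exact: laplace1_ge0. Qed.

Lemma poisson_ge0 n (z : euc R n) : 0 <= poisson z.
Proof. by apply: prodr_ge0 => i _; exact: poisson1_ge0. Qed.

Lemma measurable_laplace n : measurable_fun setT (@laplace n).
Proof.
apply: measurable_prod => i _.
exact: (measurableT_comp measurable_laplace1 (@measurable_coord R n i)).
Qed.

Lemma measurable_poisson n : measurable_fun setT (@poisson n).
Proof.
apply: measurable_prod => i _.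
exact: (measurableT_comp measurable_poisson1 (@measurable_coord R n i)).
Qed.

Lemma integral_laplace n :
  (\int[leb n]_xi (laplace xi)%:E = ((2 / e) ^+ n)%:E)%E.
Proof.
elim: n => [|n IH].
  rewrite ge0_integral_euc0//; last first.
    by apply/measurable_EFinP; exact: measurable_laplace.
  by rewrite /laplace big_ord0 expr0.
rewrite ge0_integral_cons//; first last.
- by move=> x; rewrite lee_fin laplace_ge0.
- by apply/measurable_EFinP; exact: measurable_laplace.
transitivity (\int[mu]_s ((laplace1 s)%:E * ((2 / e) ^+ n)%:E))%E.
  apply: eq_integral => s _; rewrite -IH.
  under eq_integral do rewrite laplace_cons EFinM.
  rewrite ge0_integralZl//.
  - by apply/measurable_EFinP; exact: measurable_laplace.
  - by move=> x _; rewrite lee_fin laplace_ge0.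
  - by rewrite lee_fin laplace1_ge0.
rewrite ge0_integralZr//.
- by rewrite integral_laplace1 -EFinM exprS.
- by apply/measurable_EFinP; exact: measurable_laplace1.
- by move=> s _; rewrite lee_fin laplace1_ge0.
- by rewrite lee_fin exprn_ge0// divr_ge0// ltW.
Qed.

Lemma integrable_laplace n : (leb n).-integrable setT (EFin \o @laplace n).
Proof.
apply/integrableP; split; first by apply/measurable_EFinP; exact: measurable_laplace.
under eq_integral do rewrite /= ger0_norm ?laplace_ge0//.
by rewrite integral_laplace ltry.
Qed.

Lemma integrable_laplaceM n (h : euc R n -> R) : measurable_fun setT h ->
  (forall xi, `|h xi| <= 1) ->
  (leb n).-integrable setT (EFin \o (fun xi => laplace xi * h xi)).
Proof.
move=> mh h1; apply: (le_integrable measurableT _ _ (@integrable_laplace n)).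
  by apply/measurable_EFinP; apply: measurable_funM => //; exact: measurable_laplace.
move=> xi _; rewrite lee_fin normrM -[leRHS]mulr1 ler_wpM2l//.
Qed.

Lemma measurable_dotr n (z : euc R n) : measurable_fun setT (fun xi => dot xi z).
Proof.
apply: measurable_sum => i; apply: measurable_funM => //.
exact: measurable_coord.
Qed.

Lemma integrable_laplace_cos n (z : euc R n) :
  (leb n).-integrable setT (EFin \o (fun xi => laplace xi * cos (dot xi z))).
Proof.
apply: integrable_laplaceM => [|xi]; last by rewrite ler_norml cos_geN1 cos_le1.
apply: measurableT_comp (measurable_dotr z).
by apply: continuous_measurable_fun; exact: continuous_cos.
Qed.

Lemma integrable_laplace_sin n (z : euc R n) :
  (leb n).-integrable setT (EFin \o (fun xi => laplace xi * sin (dot xi z))).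
Proof.
apply: integrable_laplaceM => [|xi]; last by rewrite ler_norml sin_geN1 sin_le1.
apply: measurableT_comp (measurable_dotr z).
by apply: continuous_measurable_fun; exact: continuous_sin.
Qed.

Lemma Rintegral_laplace_sin n (z : euc R n) :
  \int[leb n]_xi (laplace xi * sin (dot xi z)) = 0.
Proof.
have N10 : -1 != 0 :> R by rewrite oppr_eq0 oner_neq0.
have := Rintegral_escale N10 (integrable_laplace_sin z).
rewrite normrN normr1 expr1n invr1 mul1r.
have -> : \int[leb n]_xi (laplace (escale (- 1) xi) * sin (dot (escale (- 1) xi) z)) =
    - \int[leb n]_xi (laplace xi * sin (dot xi z)).
  rewrite -[RHS]mulN1r -RintegralZl//; last exact: integrable_laplace_sin.
  apply: eq_Rintegral => xi _; rewrite dotZl mulN1r sinN mulrN mulN1r.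
  congr (- (_ * _)); apply: eq_bigr => i _.
  by rewrite tnth_mktuple /laplace1 mulN1r normrN.
by move/eqP; rewrite eq_sym -subr_eq0 opprK -mulr2n mulrn_eq0 /= => /eqP.
Qed.

Lemma integral_cons n (F : euc R n.+1 -> \bar R) : (leb n.+1).-integrable setT F ->
  (\int[leb n.+1]_x F x = \int[mu]_s \int[leb n]_y F (tuple_cons (s, y)))%E.
Proof.
move=> iF; have mF := measurable_int _ iF.
have iFc : (mu \x leb n)%E.-integrable setT (F \o @tuple_cons R n).
  apply/integrableP; split.
    by apply: (measurableT_comp mF); exact: measurable_tuple_cons.
  move/integrableP: iF => [_]; rewrite ge0_integral_cons//; last exact: measurableT_comp.
  rewrite fubini_tonelli1//.
  apply: measurableT_comp => //.
  by apply: (measurableT_comp mF); exact: measurable_tuple_cons.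
rewrite [LHS](@integral_pushforward _ _ _ _ _ _ (@measurable_tuple_cons R n)
  (mu \x leb n)%E setT F)//.
by rewrite preimage_setT -integral12_prod_meas1.
Qed.

Lemma Rintegral_laplace_cos n (z : euc R n) :
  \int[leb n]_xi (laplace xi * cos (dot xi z)) = poisson z.
Proof.
elim: n => [|n IH] in z *.
  rewrite /Rintegral ge0_integral_euc0//=.
    by rewrite /laplace /poisson /dot !big_ord0 cos0 mulr1.
  exact: (measurable_int _ (integrable_laplace_cos z)).
pose z0 : R := tnth z ord0; pose z' : euc R n := [tuple of behead z].
have zE : z = tuple_cons (z0, z') by rewrite [LHS]tuple_eta.
rewrite zE poisson_cons /Rintegral integral_cons; last exact: integrable_laplace_cos.
transitivity (fine (\int[mu]_s ((laplace1 s * cos (s * z0)) * poisson z')%:E))%E; last first.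
  rewrite -/(Rintegral _ _ _) RintegralZr//; last exact: integrable_laplace1_cos.
  by rewrite /Rintegral integral_laplace1_cos.
congr fine; apply: eq_integral => s _.
transitivity ((\int[leb n]_y (laplace (tuple_cons (s, y)) *
   cos (dot (tuple_cons (s, y)) (tuple_cons (z0, z')))))%:E).
  rewrite fineK//; apply: integrable_fin_num => //.
  have mc : measurable_fun setT
      (fun y => cos (dot (tuple_cons (s, y)) (tuple_cons (z0, z')))).
    apply: measurableT_comp; first exact: continuous_measurable_fun (@continuous_cos R).
    under eq_fun do rewrite dot_cons.
    by apply: measurable_funD => //; exact: measurable_dotr.
  have c1 (y : euc R n) : `|cos (dot (tuple_cons (s, y)) (tuple_cons (z0, z')))| <= 1.
    by rewrite ler_norml cos_geN1 cos_le1.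
  have := integrableZl measurableT (laplace1 s) (integrable_laplaceM mc c1).
  by congr integrable; apply/funext => y; rewrite /= -EFinM mulrA -laplace_cons.
congr EFin.
under eq_Rintegral => y _.
  rewrite laplace_cons dot_cons cosD.
  rewrite (_ : _ * _ = (laplace1 s * cos (s * z0)) * (laplace y * cos (dot y z')) -
     (laplace1 s * sin (s * z0)) * (laplace y * sin (dot y z'))); last by ring.
  over.
rewrite RintegralB//; last 2 first.
- by have := integrableZl measurableT (laplace1 s * cos (s * z0)) (integrable_laplace_cos z');
    congr integrable.
- by have := integrableZl measurableT (laplace1 s * sin (s * z0)) (integrable_laplace_sin z');
    congr integrable.
rewrite RintegralZl//; last exact: integrable_laplace_cos.
rewrite RintegralZl//; last exact: integrable_laplace_sin.
by rewrite IH Rintegral_laplace_sin mulr0 subr0.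
Qed.

End PoissonKernel.

Section ProductSigmaFinite.
Context {R : realType} d1 d2 (T1 : measurableType d1) (T2 : measurableType d2).
Variable m1 : {sigma_finite_measure set T1 -> \bar R}.
Variable m2 : {sigma_finite_measure set T2 -> \bar R}.

Lemma product_sigma_finite : sigma_finite setT (m1 \x m2)%E.
Proof.
have /sigma_finiteP[F [TF ndF Foo]] := sigma_finiteT m1.
have /sigma_finiteP[G [TG ndG Goo]] := sigma_finiteT m2.
exists (fun k => F k `*` G k).
  apply/esym; rewrite -subTset => t _.
  have [i _ Fi] : (\bigcup_i F i) t.1 by rewrite -TF.
  have [j _ Gj] : (\bigcup_i G i) t.2 by rewrite -TG.
  exists (maxn i j) => //; split => /=.
    by move: Fi; apply/subsetPset/ndF/leq_maxl.
  by move: Gj; apply/subsetPset/ndG/leq_maxr.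
move=> k; have [mF Fk] := Foo k; have [mG Gk] := Goo k.
split; first exact: measurableX.
by rewrite product_measure1E// lte_mul_pinfty// ge0_fin_numE.
Qed.

(** A copy of the product measure that carries the sigma-finite structure. *)
Definition prod_measure : set (T1 * T2) -> \bar R := (m1 \x m2)%E.

HB.instance Definition _ := Measure.on prod_measure.

HB.instance Definition _ := Measure_isSigmaFinite.Build _ _ _ prod_measure
  product_sigma_finite.

Lemma prod_tonelli1 (f : T1 * T2 -> \bar R) : measurable_fun setT f ->
  (forall z, 0 <= f z)%E ->
  (\int[prod_measure]_z f z = \int[m1]_x \int[m2]_y f (x, y))%E.
Proof. by move=> mf f0; rewrite /= [LHS](fubini_tonelli1 _ mf f0). Qed.

Lemma prod_tonelli2 (f : T1 * T2 -> \bar R) : measurable_fun setT f ->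
  (forall z, 0 <= f z)%E ->
  (\int[prod_measure]_z f z = \int[m2]_y \int[m1]_x f (x, y))%E.
Proof. by move=> mf f0; rewrite [LHS](fubini_tonelli2 _ mf f0). Qed.

End ProductSigmaFinite.

Section Plancherel.
Context {R : realType} {n : nat}.
Local Notation leb := (lebesgue_euc R).
Implicit Types (x y xi : euc R n).

Definition ediff k (y b : euc R k) : euc R k :=
  [tuple ((tnth y i : R) - (tnth b i : R) : measurableTypeR R) | i < k].

Lemma ediff_cons k (s t : R) (y b : euc R k) :
  ediff (tuple_cons (s, y)) (tuple_cons (t, b)) = tuple_cons (s - t, ediff y b).
Proof.
apply/eq_from_tnth => i; rewrite tnth_mktuple.
case: (unliftP ord0 i) => [j ->|->]; last by rewrite !tnth0.
by rewrite !tnthS tnth_mktuple.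
Qed.

Lemma dot_ediff k (xi y b : euc R k) : dot xi (ediff y b) = dot xi y - dot xi b.
Proof.
rewrite /dot -sumrB; apply: eq_bigr => i _.
by rewrite tnth_mktuple mulrBr.
Qed.

Lemma measurable_ediff k :
  measurable_fun setT (fun z : euc R k * euc R k => ediff z.1 z.2).
Proof.
apply/measurable_fun_tnthP => i.
rewrite (_ : _ \o _ = (fun z : euc R k * euc R k =>
  (tnth z.1 i : R) - (tnth z.2 i : R))); last first.
  by apply/funext => z /=; rewrite tnth_mktuple.
apply: measurable_funB.
  by apply: (measurableT_comp (@measurable_coord R k i)); exact: measurable_fst.
by apply: (measurableT_comp (@measurable_coord R k i)); exact: measurable_snd.
Qed.

Lemma poisson_ediffC (e : R) k (y b : euc R k) :
  poisson e (ediff y b) = poisson e (ediff b y).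
Proof.
apply: eq_bigr => i _; rewrite !tnth_mktuple /poisson1.
by rewrite -[in RHS]opprB sqrrN.
Qed.

Lemma measurable_poisson_ediff (e : R) k :
  measurable_fun setT (fun z : euc R k * euc R k => poisson e (ediff z.1 z.2)).
Proof. exact: measurableT_comp (@measurable_poisson R e k) (@measurable_ediff k). Qed.

Lemma measurable_poisson_ediffl (e : R) k (b : euc R k) :
  measurable_fun setT (fun y : euc R k => (poisson e (ediff y b))%:E).
Proof.
apply/measurable_EFinP.
exact: (measurableT_comp (@measurable_poisson_ediff e k) (pair2_measurable b)).
Qed.

Lemma integral_poisson (e : R) k (b : euc R k) : 0 < e ->
  (\int[leb k]_y (poisson e (ediff y b))%:E = ((2 * pi) ^+ k)%:E)%E.
Proof.
move=> e0; elim: k => [|k IH] in b *.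
  rewrite ge0_integral_euc0.
    by rewrite /poisson big_ord0 expr0.
  exact: measurable_poisson_ediffl.
have mp := @measurable_poisson_ediffl e k.+1 b.
rewrite ge0_integral_cons//; last by move=> x; rewrite lee_fin poisson_ge0.
pose b0 : R := tnth b ord0; pose b' : euc R k := [tuple of behead b].
have bE : b = tuple_cons (b0, b') by rewrite [LHS]tuple_eta.
transitivity (\int[lebesgue_measure]_s
  ((poisson1 e ((s : R) + - b0))%:E * ((2 * pi) ^+ k)%:E))%E.
  apply: eq_integral => s _; rewrite -(IH b') bE.
  under eq_integral do rewrite ediff_cons poisson_cons EFinM.
  rewrite ge0_integralZl//.
  - exact: measurable_poisson_ediffl.
  - by move=> x _; rewrite lee_fin poisson_ge0.
  - by rewrite lee_fin poisson1_ge0.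
rewrite ge0_integralZr//.
- by rewrite integral_poisson1// -EFinM exprS.
- apply/measurable_EFinP; apply: (measurableT_comp (measurable_poisson1 e)).
  exact: measurable_funD.
- by move=> s _; rewrite lee_fin poisson1_ge0.
- by rewrite lee_fin exprn_ge0// mulr_ge0// pi_ge0.
Qed.

Lemma integrable_prod d1 d2 (T1 : measurableType d1) (T2 : measurableType d2)
    (m1 : {sigma_finite_measure set T1 -> \bar R})
    (m2 : {sigma_finite_measure set T2 -> \bar R}) (f : T1 -> R) (g : T2 -> R) :
  m1.-integrable setT (EFin \o f) -> m2.-integrable setT (EFin \o g) ->
  (m1 \x m2)%E.-integrable setT (EFin \o (fun z => f z.1 * g z.2)).
Proof.
move=> jf jg; have /measurable_EFinP mf := measurable_int _ jf.
have /measurable_EFinP mg := measurable_int _ jg.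
have mfg : measurable_fun setT (EFin \o (fun z : T1 * T2 => f z.1 * g z.2)).
  apply/measurable_EFinP; apply: measurable_funM.
    by apply: measurableT_comp mf _; exact: measurable_fst.
  by apply: measurableT_comp mg _; exact: measurable_snd.
apply/integrable12ltyP => //.
have [c cE] : exists c, (\int[m2]_y `|(g y)%:E|)%E = c%:E.
  move/integrableP: jg => [_]; have : (0 <= \int[m2]_y `|(EFin \o g) y|)%E.
    exact: integral_ge0.
  by case: (\int[m2]_y _)%E => [c| |]// _ _; exists c.
under eq_integral => x _.
  under eq_integral do rewrite /= normrM EFinM.
  rewrite ge0_integralZl//; last exact/measurable_EFinP/measurableT_comp.
  rewrite cE; over.
have c0 : (0 <= c%:E)%E by rewrite -cE; exact: integral_ge0.
rewrite ge0_integralZr//; last exact/measurable_EFinP/measurableT_comp.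
move/integrableP: jf => [_ jf].
by rewrite muleC lte_mul_pinfty.
Qed.

Lemma Rintegral_prod d1 d2 (T1 : measurableType d1) (T2 : measurableType d2)
    (m1 : {sigma_finite_measure set T1 -> \bar R})
    (m2 : {sigma_finite_measure set T2 -> \bar R}) (f : T1 -> R) (g : T2 -> R) :
  m1.-integrable setT (EFin \o f) -> m2.-integrable setT (EFin \o g) ->
  (\int[(m1 \x m2)%E]_z (f z.1 * g z.2) = \int[m1]_x f x * \int[m2]_y g y)%R.
Proof.
move=> jf jg.
have <- : \int[m1]_x (f x * \int[m2]_y g y) = \int[m1]_x f x * \int[m2]_y g y.
  by rewrite RintegralZr.
rewrite [LHS]/Rintegral [RHS]/Rintegral -(integral12_prod_meas1 (integrable_prod jf jg)).
congr fine; apply: eq_integral => x _; rewrite /fubini_F /=.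
under eq_integral do rewrite EFinM.
rewrite integralZl// EFinM; congr (_ * _)%E.
by rewrite fineK//; exact: integrable_fin_num.
Qed.

Lemma cvg_laplace1 xi : laplace (harmonic k) xi @[k --> \oo] --> (1 : R).
Proof.
have -> : (fun k => laplace (harmonic k) xi) =
    (fun k => expR (- (harmonic k * \sum_i `|tnth xi i : R|))).
  by apply/funext => k; rewrite mulr_sumr -sumrN expR_sum.
rewrite -expR0; apply: (@cvg_comp _ _ _ _ (@expR R) _ (nbhs (0 : R))).
  have : - (harmonic k * \sum_i `|tnth xi i : R|) @[k --> \oo] -->
      - (0 * \sum_i `|tnth xi i : R|).
    by apply: cvgN; apply: cvgM; [exact: cvg_harmonic|exact: cvg_cst].
  by rewrite mul0r oppr0.
exact: continuous_expR.
Qed.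

(** The regularised square of the transform is a double integral of the kernel [K].
    Integrating [K] in the frequency variable first leaves the Poisson kernel, of
    mass (2 pi)^n, against [P], the real part of [h] at one point times the
    conjugate of [h] at the other. *)
Section Bessel.
Variables (s : R) (h : euc R n -> R[i]).
Hypothesis s2 : s ^+ 2 = 1.
Hypothesis ih : cintegrable (leb n) h.

Local Notation leb2 := (prod_measure (leb n) (leb n)).
Let wave xi y : R[i] := cis (s * dot xi y) * h y.
Let H xi : R[i] := cint (leb n) (wave xi).
Let K (e : R) (w : euc R n * (euc R n * euc R n)) : R := laplace e w.1 *
  (complex.Re (wave w.1 w.2.1) * complex.Re (wave w.1 w.2.2) +
   complex.Im (wave w.1 w.2.1) * complex.Im (wave w.1 w.2.2)).
Let P (z : euc R n * euc R n) : R :=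
  complex.Re (h z.1) * complex.Re (h z.2) + complex.Im (h z.1) * complex.Im (h z.2).
Let Q (z : euc R n * euc R n) : R :=
  complex.Re (h z.1) * complex.Im (h z.2) - complex.Im (h z.1) * complex.Re (h z.2).

Let cmeasurable_wave : cmeasurable (fun w : euc R n * euc R n => wave w.1 w.2).
Proof.
apply: cmeasurableM.
  apply: (cmeasurable_cis (t := fun w : euc R n * euc R n => s * dot w.1 w.2)).
  by apply: measurable_funM; [exact: measurable_cst|exact: measurable_dot_pair].
exact: (cmeasurable_comp (@measurable_snd _ _ _ _) (cintegrable_cmeasurable ih)).
Qed.

Let cintegrable_wave xi : cintegrable (leb n) (wave xi).
Proof.
apply: cintegrable_cis => //; apply: measurable_funM => //.
exact: measurable_dotl.
Qed.

Let cmod_wave xi y : cmod (wave xi y) = cmod (h y).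
Proof. by rewrite cmodM cmod_cis mul1r. Qed.

Let measurable_K e : measurable_fun setT (K e).
Proof.
have m1 : measurable_fun setT (fun w : euc R n * (euc R n * euc R n) => (w.1, w.2.1)).
  apply: measurable_fun_pair; first exact: measurable_fst.
  by apply: (measurableT_comp (@measurable_fst _ _ _ _)); exact: measurable_snd.
have m2 : measurable_fun setT (fun w : euc R n * (euc R n * euc R n) => (w.1, w.2.2)).
  apply: measurable_fun_pair; first exact: measurable_fst.
  by apply: (measurableT_comp (@measurable_snd _ _ _ _)); exact: measurable_snd.
have [r1 i1] := cmeasurable_comp m1 cmeasurable_wave.
have [r2 i2] := cmeasurable_comp m2 cmeasurable_wave.
apply: measurable_funM.
  by apply: (measurableT_comp (@measurable_laplace R e n)); exact: measurable_fst.
by apply: measurable_funD; exact: measurable_funM.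
Qed.

Let integrable_K e : 0 < e ->
  (leb n \x leb2)%E.-integrable setT (EFin \o K e).
Proof.
move=> e0; have ia := cintegrable_cmod ih.
have i2 : leb2.-integrable setT
    (EFin \o (fun z => 2 * (cmod (h z.1) * cmod (h z.2)))).
  by have := integrableZl measurableT 2 (integrable_prod ia ia); congr integrable.
have ij := integrable_prod (@integrable_laplace R e e0 n) i2.
have mK : measurable_fun setT (EFin \o K e).
  by apply/measurable_EFinP; exact: (measurable_K e).
apply: (le_integrable measurableT mK _ ij).
move=> [xi [y y']] _ /=; rewrite lee_fin normrM [leRHS]normrM.
rewrite ler_wpM2l// [leRHS]ger0_norm ?mulr_ge0 ?cmod_ge0//.
rewrite (le_trans (ler_normD _ _))// mulr_natl mulr2n !normrM.
by rewrite lerD// ler_pM// -?(cmod_wave xi) ?Re_le_cmod ?Im_le_cmod.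
Qed.

Let regularized_square e xi : (\int[leb2]_z (K e (xi, z))%:E =
  (laplace e xi * cmod (H xi) ^+ 2)%:E)%E.
Proof.
have [ir ii] := cintegrable_wave xi.
have iK : leb2.-integrable setT (EFin \o (fun z =>
    complex.Re (wave xi z.1) * complex.Re (wave xi z.2) +
    complex.Im (wave xi z.1) * complex.Im (wave xi z.2))).
  have := integrableD measurableT (integrable_prod ir ir) (integrable_prod ii ii).
  by congr integrable.
transitivity ((\int[leb2]_z (K e (xi, z)))%:E).
  rewrite fineK//; apply: integrable_fin_num => //.
  by have := integrableZl measurableT (laplace e xi) iK; congr integrable.
congr EFin; transitivity (laplace e xi * \int[leb2]_z
    (complex.Re (wave xi z.1) * complex.Re (wave xi z.2) +
     complex.Im (wave xi z.1) * complex.Im (wave xi z.2))).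
  by rewrite -RintegralZl.
congr (_ * _); rewrite RintegralD//; last 2 first.
- exact: (integrable_prod ir ir).
- exact: (integrable_prod ii ii).
by rewrite (Rintegral_prod ir ir) (Rintegral_prod ii ii) sqr_cmod !expr2.
Qed.

(** As [s] is 1 or -1, it acts on the cosine trivially; the sine part is odd. *)
Let kernel_transform e z : 0 < e ->
  (\int[leb n]_xi (K e (xi, z))%:E = (P z * poisson e (ediff z.1 z.2))%:E)%E.
Proof.
move=> e0; set d := ediff z.1 z.2.
have sE : s = 1 \/ s = -1.
  by have /eqP := s2; rewrite sqrf_eq1 => /orP[]/eqP ->; [left|right].
have KE xi : K e (xi, z) = P z * (laplace e xi * cos (dot xi d)) +
    (s * Q z) * (laplace e xi * sin (dot xi d)).
  rewrite /K /wave /= !ReM !ImM /= /d dot_ediff cosB sinB /P /Q.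
  case: sE => ->; rewrite ?mul1r ?mulN1r ?cosN ?sinN; ring.
have ic := @integrable_laplace_cos R e e0 n d.
have is_ := @integrable_laplace_sin R e e0 n d.
have icP : (leb n).-integrable setT
    (EFin \o (fun xi => P z * (laplace e xi * cos (dot xi d)))).
  by have := integrableZl measurableT (P z) ic; congr integrable.
have isQ : (leb n).-integrable setT
    (EFin \o (fun xi => (s * Q z) * (laplace e xi * sin (dot xi d)))).
  by have := integrableZl measurableT (s * Q z) is_; congr integrable.
under eq_integral do rewrite KE EFinD.
rewrite integralD//.
under eq_integral do rewrite EFinM.
rewrite integralZl// addeC.
under eq_integral do rewrite EFinM.
rewrite integralZl//.
have -> : (\int[leb n]_x (laplace e x * cos (dot x d))%:E = (poisson e d)%:E)%E.
  by rewrite -(Rintegral_laplace_cos e0) fineK//; exact: integrable_fin_num.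
have -> : (\int[leb n]_x (laplace e x * sin (dot x d))%:E = 0)%E.
  have := Rintegral_laplace_sin e0 d; rewrite /Rintegral => /eqP.
  by rewrite fine_eq0 ?integrable_fin_num// => /eqP.
by rewrite mule0 add0e EFinM.
Qed.

(** [P] is at most half the sum of the squared moduli at the two points. *)
Let regularized_le e : 0 < e ->
  (\int[leb n]_xi (laplace e xi * cmod (H xi) ^+ 2)%:E <=
   ((2 * pi) ^+ n)%:E * L2sq (leb n) h)%E.
Proof.
move=> e0.
have mh := cintegrable_cmeasurable ih.
have mh2 : measurable_fun setT (fun y => cmod (h y) ^+ 2).
  by apply: measurable_funX; exact: cmeasurable_cmod.
under eq_integral do rewrite -regularized_square.
rewrite -[leLHS]/(\int[leb n]_xi fubini_F leb2 (EFin \o K e) xi)%E.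
rewrite (integral12_prod_meas1 (integrable_K e0)).
rewrite -(integral21_prod_meas1 (integrable_K e0)).
rewrite /fubini_G.
under eq_integral do rewrite /= kernel_transform//.
have mp := @measurable_poisson_ediff e n.
have m1 : measurable_fun setT (fun z : euc R n * euc R n =>
    (poisson e (ediff z.1 z.2) * (2^-1 * cmod (h z.1) ^+ 2))%:E).
  apply/measurable_EFinP; apply: measurable_funM => //.
  by apply: measurable_funM => //; apply: measurableT_comp mh2 _; exact: measurable_fst.
have m2 : measurable_fun setT (fun z : euc R n * euc R n =>
    (poisson e (ediff z.1 z.2) * (2^-1 * cmod (h z.2) ^+ 2))%:E).
  apply/measurable_EFinP; apply: measurable_funM => //.
  by apply: measurable_funM => //; apply: measurableT_comp mh2 _; exact: measurable_snd.
have p0 (z : euc R n) : 0 <= poisson e z by exact: poisson_ge0.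
have q0 (y : euc R n) : 0 <= 2^-1 * cmod (h y) ^+ 2.
  by rewrite mulr_ge0// sqr_ge0.
have half : (\int[leb n]_y ((2 * pi) ^+ n * (2^-1 * cmod (h y) ^+ 2))%:E =
    ((2 * pi) ^+ n / 2)%:E * L2sq (leb n) h)%E.
  under eq_integral do rewrite mulrA EFinM.
  rewrite ge0_integralZl//.
  - exact/measurable_EFinP.
  - by move=> y _; rewrite lee_fin sqr_ge0.
  - by rewrite lee_fin divr_ge0// exprn_ge0// mulr_ge0// pi_ge0.
apply: (@le_trans _ _ (\int[leb2]_z
    ((poisson e (ediff z.1 z.2) * (2^-1 * cmod (h z.1) ^+ 2))%:E +
     (poisson e (ediff z.1 z.2) * (2^-1 * cmod (h z.2) ^+ 2))%:E))%E).
  rewrite integralE (@le_trans _ _ (\int[leb2]_z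
      (fun z => (P z * poisson e (ediff z.1 z.2))%:E)^\+ z)%E)//.
    by rewrite geeDl// oppe_le0 integral_ge0.
  apply: ge0_le_integral => //.
  - apply: measurable_funepos; apply/measurable_EFinP; apply: measurable_funM => //.
    have [r1 i1] := cmeasurable_comp
      (@measurable_fst _ _ (euc R n) (euc R n)) mh.
    have [r2 i2] := cmeasurable_comp
      (@measurable_snd _ _ (euc R n) (euc R n)) mh.
    by apply: measurable_funD; apply: measurable_funM.
  - exact: emeasurable_funD.
  move=> z _; rewrite funeposE ge_max -EFinD !lee_fin -mulrDr mulrC.
  rewrite ler_wpM2l//= ?mulr_ge0 ?addr_ge0// !sqr_cmod /P.
  have := sqr_ge0 (complex.Re (h z.1) - complex.Re (h z.2)).
  have := sqr_ge0 (complex.Im (h z.1) - complex.Im (h z.2)).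
  lra.
rewrite ge0_integralD//; last 2 first.
- by move=> z _; rewrite lee_fin mulr_ge0.
- by move=> z _; rewrite lee_fin mulr_ge0.
have -> : (\int[leb2]_z (poisson e (ediff z.1 z.2) * (2^-1 * cmod (h z.1) ^+ 2))%:E
   = ((2 * pi) ^+ n / 2)%:E * L2sq (leb n) h)%E.
  rewrite -half; etransitivity.
    by apply: (prod_tonelli1 _ _ m1) => z; rewrite lee_fin mulr_ge0.
  apply: eq_integral => y _; rewrite /fubini_F /=.
  under eq_integral do rewrite mulrC EFinM poisson_ediffC.
  rewrite ge0_integralZl//.
  - by rewrite integral_poisson// -EFinM mulrC.
  - exact: measurable_poisson_ediffl.
  - by move=> z _; rewrite lee_fin.
  - by rewrite lee_fin.
have -> : (\int[leb2]_z (poisson e (ediff z.1 z.2) * (2^-1 * cmod (h z.2) ^+ 2))%:E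
   = ((2 * pi) ^+ n / 2)%:E * L2sq (leb n) h)%E.
  rewrite -half; etransitivity.
    by apply: (prod_tonelli2 _ _ m2) => z; rewrite lee_fin mulr_ge0.
  apply: eq_integral => y _; rewrite /fubini_G /=.
  under eq_integral do rewrite mulrC EFinM.
  rewrite ge0_integralZl//.
  - by rewrite integral_poisson// -EFinM mulrC.
  - exact: measurable_poisson_ediffl.
  - by move=> z _; rewrite lee_fin.
  - by rewrite lee_fin.
rewrite -ge0_muleDl ?lee_fin ?divr_ge0 ?exprn_ge0 ?mulr_ge0 ?pi_ge0//.
by rewrite -EFinD -splitr.
Qed.

(** The weight tends to 1 as [e] tends to 0, so Fatou's lemma applies. *)
Lemma bessel :
  (\int[leb n]_xi (cmod (H xi) ^+ 2)%:E <= ((2 * pi) ^+ n)%:E * L2sq (leb n) h)%E.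
Proof.
have mH : measurable_fun setT (fun xi => cmod (H xi) ^+ 2).
  apply: measurable_funX; apply: cmeasurable_cmod.
  exact: (cmeasurable_cint_param (leb n) cmeasurable_wave).
apply: (@fatou_le _ _ _ _
  (fun k xi => laplace (harmonic k) xi * cmod (H xi) ^+ 2)).
- by move=> k; apply: measurable_funM => //; exact: measurable_laplace.
- by move=> k xi; rewrite mulr_ge0 ?laplace_ge0 ?sqr_ge0.
- move=> xi; rewrite -[X in _ --> X]mul1r; apply: cvgM; last exact: cvg_cst.
  exact: cvg_laplace1.
- by move=> k; apply: regularized_le; rewrite invr_gt0.
Qed.

End Bessel.

End Plancherel.

(** * Convergence in mean square *)

Section MeanSquareLimits.
Context {R : realType} {d : measure_display} {T : measurableType d}.
Variable m : {measure set T -> \bar R}.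
Implicit Types f g u : T -> R[i].

Lemma ReB (z w : R[i]) : complex.Re (z - w) = complex.Re z - complex.Re w.
Proof. by case: z w => [a b] [c e]. Qed.

Lemma ImB (z w : R[i]) : complex.Im (z - w) = complex.Im z - complex.Im w.
Proof. by case: z w => [a b] [c e]. Qed.

Lemma cmeasurableB f g : cmeasurable f -> cmeasurable g ->
  cmeasurable (fun x => f x - g x).
Proof.
move=> [fr fi] [gr gi]; split.
  by under eq_fun do rewrite ReB; exact: measurable_funB.
by under eq_fun do rewrite ImB; exact: measurable_funB.
Qed.

Lemma measurable_cmod_powR (p : R) g : cmeasurable g ->
  measurable_fun setT (fun x => cmod (g x) `^ p).
Proof.
by move=> mg; apply: (measurableT_comp (measurable_powR p)); exact: cmeasurable_cmod.
Qed.

Lemma measurable_cmod_sqr g : cmeasurable g ->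
  measurable_fun setT (fun x => cmod (g x) ^+ 2).
Proof. by move=> mg; apply: measurable_funX; exact: cmeasurable_cmod. Qed.

Lemma summable_cvg0 (r : nat -> R) : (forall k, 0 <= r k) ->
  (\sum_(0 <= k <oo) (r k)%:E < +oo)%E -> r k @[k --> \oo] --> (0 : R).
Proof.
move=> r0 sr; apply: (@fine_cvg _ _ _ _ (fun k => (r k)%:E) 0).
have := nneseries_tail_cvg sr (fun k _ => r0 k).
apply: squeeze_cvge; last exact: cvg_cst.
near=> k; rewrite lee_fin r0/=.
have := @nneseries_lim_ge R (fun k => (r k)%:E) xpredT k k.+1.
by rewrite big_nat1; apply => j _ _; rewrite lee_fin.
Unshelve. all: by end_near. Qed.

Lemma cvg_cmod_diff (u : nat -> R[i]) (z : R[i]) :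
  cmod (u k - z) ^+ 2 @[k --> \oo] --> (0 : R) ->
  cmod (u k) @[k --> \oo] --> cmod z.
Proof.
move=> uz; have c0 : cmod (u k - z) @[k --> \oo] --> (0 : R).
  have := cvg_comp _ _ uz (@sqrt_continuous R 0).
  rewrite sqrtr0 (_ : Num.sqrt \o _ = (fun k => cmod (u k - z)))//.
  by apply/funext => k /=; rewrite sqrtr_sqr ger0_norm ?cmod_ge0.
have aux (f : nat -> R) (l : R) : (forall k, `|f k - l| <= cmod (u k - z)) ->
    f k @[k --> \oo] --> l.
  move=> fl; apply/subr_cvg0.
  have c0N : - cmod (u k - z) @[k --> \oo] --> (0 : R).
    by rewrite -[X in _ --> X]oppr0; exact: cvgN.
  by apply: squeeze_cvgr c0N c0; apply: nearW => k; rewrite -ler_norml.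
by apply: cvg_cmod; apply: aux => k; rewrite -?ReB -?ImB ?Re_le_cmod ?Im_le_cmod.
Qed.

(** Integrals of powers are lower semicontinuous for convergence in L^2: along
    approximants whose squared errors are summable the convergence is almost
    everywhere, and Fatou's lemma applies. *)
Lemma powR_integral_lsc (p : R) g (B : \bar R) : 0 < p -> cmeasurable g ->
  (forall e, 0 < e -> exists u, [/\ cmeasurable u,
      (L2sq m (fun x => u x - g x)%R <= e%:E)%E &
      (\int[m]_x (cmod (u x) `^ p)%:E <= B)%E]) ->
  (\int[m]_x (cmod (g x) `^ p)%:E <= B)%E.
Proof.
move=> p0 mg approx.
have e0 k : (0 : R) < 1 / (2 ^ k.+1)%:R by rewrite divr_gt0// ltr0n expn_gt0.
have [u ux] := choice (fun k => approx _ (e0 k)).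
have mu k : cmeasurable (u k) by have [] := ux k.
pose r k x := cmod (u k x - g x) ^+ 2.
have mr k : measurable_fun setT (fun x => (r k x)%:E).
  by apply/measurable_EFinP/measurable_cmod_sqr/cmeasurableB.
have r0 k x : 0 <= r k x by exact: sqr_ge0.
pose S x := (\sum_(0 <= k <oo) (r k x)%:E)%E.
have mS : measurable_fun setT S.
  by apply: (@ge0_emeasurable_sum _ _ _ setT (fun k x => (r k x)%:E) xpredT) =>
    [k x _ _|k _]; [rewrite lee_fin|exact: mr].
have S0 x : (0 <= S x)%E by apply: nneseries_ge0 => k _ _; rewrite lee_fin.
have iS : m.-integrable setT S.
  apply/integrableP; split => //; under eq_integral do rewrite gee0_abs//.
  rewrite integral_nneseries//; last by move=> k x _; rewrite lee_fin.
  apply: le_lt_trans (ltry 1); apply: le_trans (epsilon_trick0 xpredT ler01).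
  by apply: lee_nneseries => [k _ _|k _]; [exact: L2sq_ge0|have [] := ux k].
pose E := [set x | S x \is a fin_num].
have mE : measurable E by rewrite -[E]setTI; exact: emeasurable_fin_num.
have aeE := integrable_ae measurableT iS.
have <- : (\int[m]_x (cmod (g x) `^ p * \1_E x)%:E =
    \int[m]_x (cmod (g x) `^ p)%:E)%E.
  apply: ae_eq_integral => //.
  - apply/measurable_EFinP/measurable_funM; first exact: measurable_cmod_powR.
    exact: measurable_indic.
  - exact/measurable_EFinP/measurable_cmod_powR.
  apply: filterS aeE => x + _ => /(_ I) Ex.
  by rewrite indicE mem_set// mulr1.
apply: (@fatou_le _ _ _ _ (fun k x => cmod (u k x) `^ p * \1_E x)).
- move=> k; apply: measurable_funM; first exact: measurable_cmod_powR.
  exact: measurable_indic.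
- by move=> k x; rewrite mulr_ge0 ?powR_ge0.
- move=> x; rewrite indicE; have [xE|xE] := boolP (x \in E); last first.
    by rewrite mulr0; under eq_fun do rewrite mulr0; exact: cvg_cst.
  rewrite mulr1; under eq_fun do rewrite mulr1.
  apply: cvg_powR_ge0 => //; first by move=> k; exact: cmod_ge0.
  apply: cvg_cmod_diff; apply: summable_cvg0 => [k|]; first exact: r0.
  by move: xE; rewrite inE /E /= ge0_fin_numE.
- move=> k; have [_ _] := ux k; apply: le_trans.
  apply: ge0_le_integral => //.
  + by move=> x _; rewrite lee_fin mulr_ge0 ?powR_ge0.
  + apply/measurable_EFinP/measurable_funM; first exact: measurable_cmod_powR.
    exact: measurable_indic.
  + exact/measurable_EFinP/measurable_cmod_powR.
  by move=> x _; rewrite lee_fin ler_piMr ?powR_ge0.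
Qed.

End MeanSquareLimits.

Section LowerLimits.
Context {R : realType}.
Local Open Scope ereal_scope.

Lemma einf_frequently (u : nat -> \bar R) (c : \bar R) : limn_einf u < c ->
  forall K, exists2 k, (K <= k)%N & u k <= c.
Proof.
move=> uc K; have : einfs u K < c.
  apply: le_lt_trans uc; rewrite limn_einf_lim.
  rewrite (cvg_lim _ (ereal_nondecreasing_cvgn (nondecreasing_einfs u)))//.
  by apply: ereal_sup_ubound; exists K.
by move=> /ereal_inf_lt[_ [k /= Kk <-]] /ltW; exists k.
Qed.

(** Comparison of the suprema over simple functions.  It serves for the time
    integral of the Strichartz functional, whose integrand involves a choice of
    representatives for each time and so may fail to be measurable. *)
Lemma ge0_integral_mono d (T : measurableType d) (m : {measure set T -> \bar R})
    (f g : T -> \bar R) : (forall x, 0 <= f x) -> (forall x, f x <= g x) ->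
  \int[m]_x f x <= \int[m]_x g x.
Proof.
move=> f0 fg; rewrite !ge0_integralTE//; last by move=> x; exact: le_trans (fg x).
apply: ereal_sup_le => _ [h /= hf <-]; exists h => //= x.
exact: le_trans (hf x) (fg x).
Qed.

Context {d : measure_display} {T : measurableType d}.
Variable m : {measure set T -> \bar R}.

Lemma L2sq_fin (f : T -> R[i]) : L2norm m f < +oo -> L2sq m f < +oo.
Proof. by move=> ?; rewrite -L2norm_sqr poweR_lty. Qed.

Lemma L2norm_fin (f : T -> R[i]) : L2sq m f < +oo -> L2norm m f < +oo.
Proof. by move=> ?; rewrite L2normE poweR_lty. Qed.

Lemma cvg_L2sq (u : nat -> T -> R[i]) : L2norm m (u k) @[k --> \oo] --> 0 ->
  forall e : R, (0 < e)%R -> \forall k \near \oo, L2sq m (u k) <= e%:E.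
Proof.
move=> u0 e e0.
have s0 : (0 < (Num.sqrt e)%:E) by rewrite lte_fin sqrtr_gt0.
have : \forall k \near \oo, L2norm m (u k) < (Num.sqrt e)%:E.
  apply: (u0 [set y | y < (Num.sqrt e)%:E]); apply: open_nbhs_nbhs.
  by split; [exact: open_ereal_lt_ereal|].
apply: filterS => k uk; rewrite -L2norm_sqr.
have -> : e%:E = (Num.sqrt e)%:E `^ 2.
  by rewrite poweR_EFin powR_mulrn ?sqrtr_ge0// sqr_sqrtr// ltW.
have k0 : 0 <= L2norm m (u k) by exact: Lnorm_ge0.
by apply: gt0_ler_poweR; rewrite ?in_itv/= ?k0 ?leey ?(ltW uk) ?(ltW s0).
Qed.

End LowerLimits.

Section BallCut.
Context {R : realType} {n : nat}.
Local Notation leb := (lebesgue_euc R).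
Implicit Types (f : euc R n -> R[i]).

Lemma cmeasurable_ball_cut k f : cmeasurable f -> cmeasurable (ball_cut k f).
Proof.
move=> [mr mi].
have mb : measurable_fun setT (fun x : euc R n => enorm x <= k%:R).
  by apply: measurable_fun_ler => //; exact: measurable_enorm.
have E x : complex.Re (ball_cut k f x) =
    (if enorm x <= k%:R then complex.Re (f x) else 0).
  by rewrite /ball_cut; case: ifP.
have E' x : complex.Im (ball_cut k f x) =
    (if enorm x <= k%:R then complex.Im (f x) else 0).
  by rewrite /ball_cut; case: ifP.
split.
  by under eq_fun do rewrite E; apply: measurable_fun_ifT.
by under eq_fun do rewrite E'; apply: measurable_fun_ifT.
Qed.

Lemma cmod_ball_cut k f x : cmod (ball_cut k f x) <= cmod (f x).
Proof.
by rewrite /ball_cut; case: ifP => // _; rewrite cmodE /= expr0n addr0 sqrtr0 cmod_ge0.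
Qed.

Lemma L2sq_ball_cut k f : cmeasurable f ->
  (L2sq (leb n) (ball_cut k f) <= L2sq (leb n) f)%E.
Proof.
move=> mf; apply: ge0_integral_mono => x; rewrite lee_fin ?sqr_ge0//.
by rewrite lerXn2r ?nnegrE ?cmod_ge0 ?cmod_ball_cut.
Qed.

Lemma coord_le_enorm (x : euc R n) i : `|tnth x i : R| <= enorm x.
Proof.
rewrite /enorm -sqrtr_sqr ler_wsqrtr// /dot (bigD1 i)//= expr2 lerDl.
by apply: sumr_ge0 => j _; rewrite -expr2 sqr_ge0.
Qed.

(** The exponential weight [laplace 1] bounds the indicator of a ball, which
    therefore has finite measure. *)
Lemma ball_le_laplace k (x : euc R n) : enorm x <= k%:R ->
  1 <= expR (k%:R *+ n) * laplace 1 x.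
Proof.
move=> xk; rewrite /laplace /laplace1 -expR_sum -expRD -[leLHS]expR0 ler_expR sumrN subr_ge0.
have -> : k%:R *+ n = \sum_(i < n) (k%:R : R) by rewrite sumr_const card_ord.
by apply: ler_sum => i _; rewrite mul1r (le_trans (coord_le_enorm _ _)).
Qed.

(** On a ball |f| <= 1 + |f|^2, and the ball has finite measure. *)
Lemma cintegrable_ball_cut k f : inL2 (leb n) f -> cintegrable (leb n) (ball_cut k f).
Proof.
move=> [mf f2]; pose a : R := expR (k%:R *+ n).
apply: (@cintegrable_dominated _ _ _ _ _ (fun x => a * laplace 1 x + cmod (f x) ^+ 2)).
- exact: cmeasurable_ball_cut.
- have il := integrableZl measurableT a (@integrable_laplace R 1 ltr01 n).
  have i2 : (leb n).-integrable setT (EFin \o (fun x => cmod (f x) ^+ 2)).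
    apply/integrableP; split; first exact/measurable_EFinP/measurable_cmod_sqr.
    under eq_integral do rewrite /= ger0_norm ?sqr_ge0//.
    exact: L2sq_fin.
  by have := integrableD measurableT il i2; congr integrable.
move=> x; rewrite /ball_cut; case: ifP => xk; last first.
  rewrite cmodE /= expr0n addr0 sqrtr0 addr_ge0 ?sqr_ge0//.
  by rewrite mulr_ge0 ?expR_ge0 ?laplace_ge0.
have := ball_le_laplace xk; rewrite -/a.
have := sqr_ge0 (cmod (f x) - 1).
have := cmod_ge0 (f x); nra.
Qed.

End BallCut.

(** * The Strichartz functional through truncated data *)

Section FourierBound.
Context {R : realType} {n : nat}.
Local Notation leb := (lebesgue_euc R).
Local Notation mu := (@lebesgue_measure R).
Implicit Types (f h : euc R n -> R[i]).

Lemma cmeasurable_cst (c : R[i]) : cmeasurable (fun _ : euc R n => c).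
Proof. by split; exact: measurable_cst. Qed.

Lemma cmeasurable_fourier_int s h : cmeasurable h ->
  cmeasurable (fourier_int s (leb n) h).
Proof.
move=> mh; apply: cmeasurableM; first exact: cmeasurable_cst.
apply: (cmeasurable_cint_param (leb n)
  (G := fun w : euc R n * euc R n => cis (s * dot w.1 w.2) * h w.2)).
apply: cmeasurableM.
  apply: (cmeasurable_cis (t := fun w : euc R n * euc R n => s * dot w.1 w.2)).
  by apply: measurable_funM; [exact: measurable_cst|exact: measurable_dot_pair].
exact: (cmeasurable_comp (@measurable_snd _ _ _ _) mh).
Qed.

Lemma cmod_fourier_int s (m : {measure set (euc R n) -> \bar R}) h x :
  cmod (fourier_int s m h x) = (2 * pi) `^ (- (n%:R / 2)) *
    cmod (cint m (fun y => cis (s * dot x y) * h y)).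
Proof. by rewrite /fourier_int cmodM cmod_real ger0_norm ?powR_ge0. Qed.

Lemma L2sq_fourier_int s h : s ^+ 2 = 1 -> cintegrable (leb n) h ->
  (L2sq (leb n) (fourier_int s (leb n) h) <= L2sq (leb n) h)%E.
Proof.
move=> s2 ih; have mh := cintegrable_cmeasurable ih.
have p0 : 0 < 2 * pi :> R by rewrite mulr_gt0// pi_gt0.
set C : R := (2 * pi) `^ (- (n%:R / 2)).
have C2 : C ^+ 2 * (2 * pi) ^+ n = 1.
  rewrite -!powR_mulrn ?powR_ge0 ?(ltW p0)// -powRrM -powRD; last first.
    by rewrite (gt_eqF p0) implybT.
  by rewrite (_ : _ + _ = 0) ?powRr0//; field.
have mH := cmeasurable_cint_param (leb n)
  (G := fun w : euc R n * euc R n => cis (s * dot w.1 w.2) * h w.2).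
rewrite [leLHS](_ : _ = (C ^+ 2)%:E * \int[leb n]_xi
    (cmod (cint (leb n) (fun y => cis (s * dot xi y) * h y)%R) ^+ 2)%:E)%E; last first.
  rewrite -ge0_integralZl//; last 3 first.
  - apply/measurable_EFinP/measurable_cmod_sqr; apply: mH; apply: cmeasurableM.
      apply: (cmeasurable_cis (t := fun w : euc R n * euc R n => s * dot w.1 w.2)).
      by apply: measurable_funM; [exact: measurable_cst|exact: measurable_dot_pair].
    exact: (cmeasurable_comp (@measurable_snd _ _ _ _) mh).
  - by move=> x _; rewrite lee_fin sqr_ge0.
  - by rewrite lee_fin sqr_ge0.
  by apply: eq_integral => x _; rewrite -EFinM cmod_fourier_int exprMn.
apply: (@le_trans _ _ ((C ^+ 2)%:E * (((2 * pi) ^+ n)%:E * L2sq (leb n) h))%E).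
  by rewrite lee_pmul2l// ?lte_fin ?exprn_gt0 ?powR_gt0//; exact: bessel.
by rewrite muleA -EFinM C2 mul1e.
Qed.

(** If the limit in the mean does not exist then [fourierL2] is zero, and the sign
    of [B] covers that case. *)
Lemma fourierL2_powR_le s (p : R) f (B : \bar R) : 0 < p -> (0 <= B)%E ->
  cmeasurable f ->
  (forall K, exists2 k, (K <= k)%N & (\int[leb n]_x
     (cmod (fourier_int s (leb n) (ball_cut k f) x) `^ p)%:E <= B)%E) ->
  (\int[leb n]_x (cmod (fourierL2 s f x) `^ p)%:E <= B)%E.
Proof.
move=> p0 B0 mf fB; rewrite /fourierL2; case: xgetP => [g gE [[mg _] gf]|_].
  apply: (powR_integral_lsc p0) => // e e0.
  have [K _ Kg] := cvg_L2sq gf e0.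
  have [k Kk kB] := fB K.
  exists (fourier_int s (leb n) (ball_cut k f)); split => //.
    exact/cmeasurable_fourier_int/cmeasurable_ball_cut.
  exact: Kg.
rewrite [leLHS](_ : _ = 0)%E// integral0_eq// => x _.
by rewrite cmod_real normr0 powR0// gt_eqF.
Qed.

Lemma fourierL2_inL2 s f : inL2 (leb n) (fourierL2 s f).
Proof.
rewrite /fourierL2; case: xgetP => [g gE []//|_]; split.
  exact: cmeasurable_cst.
apply: L2norm_fin; rewrite /L2sq integral0_eq// => x _.
by rewrite cmod_real normr0 expr0n.
Qed.

Lemma L2sq_fourierL2 s f : s ^+ 2 = 1 -> inL2 (leb n) f ->
  (L2sq (leb n) (fourierL2 s f) <= L2sq (leb n) f)%E.
Proof.
move=> s2 f2; have mf := f2.1.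
have sqE (g : euc R n -> R[i]) :
    (L2sq (leb n) g = \int[leb n]_x (cmod (g x) `^ 2)%:E)%E.
  by apply: eq_integral => x _; rewrite powR_mulrn ?cmod_ge0.
rewrite [leLHS]sqE; apply: fourierL2_powR_le => //; first exact: L2sq_ge0.
move=> K; exists K => //; rewrite -sqE.
apply: (le_trans (L2sq_fourier_int s2 (cintegrable_ball_cut K f2))).
exact: L2sq_ball_cut.
Qed.

Lemma cmeasurable_schroedinger_phase (f : euc R n -> R[i]) : cmeasurable f ->
  cmeasurable (fun p : (measurableTypeR R * euc R n) * euc R n =>
    cis (- ((p.1.1 : R) * (dot p.2 p.2 / 2)) + dot p.1.2 p.2) * f p.2).
Proof.
move=> mf.
have m1 : measurable_fun setT
    (fun p : (measurableTypeR R * euc R n) * euc R n => p.1.1 : R).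
  by apply: (measurableT_comp (@measurable_fst _ _ _ _)); exact: measurable_fst.
have m2 : measurable_fun setT
    (fun p : (measurableTypeR R * euc R n) * euc R n => p.1.2).
  by apply: (measurableT_comp (@measurable_snd _ _ _ _)); exact: measurable_fst.
have m3 : measurable_fun setT
    (snd : (measurableTypeR R * euc R n) * euc R n -> euc R n).
  exact: measurable_snd.
apply: cmeasurableM; last exact: (cmeasurable_comp m3 mf).
apply: (cmeasurable_cis (t := fun p : (measurableTypeR R * euc R n) * euc R n =>
  - ((p.1.1 : R) * (dot p.2 p.2 / 2)) + dot p.1.2 p.2)).
apply: measurable_funD.
  apply: measurableT_comp => //; apply: measurable_funM => //.
  apply: measurable_funM => //.
  apply: (measurableT_comp (@measurable_dot_pair R n)
    (g := fun p : (measurableTypeR R * euc R n) * euc R n => (p.2, p.2))).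
  exact: measurable_fun_pair.
apply: (measurableT_comp (@measurable_dot_pair R n)
  (g := fun p : (measurableTypeR R * euc R n) * euc R n => (p.1.2, p.2))).
exact: measurable_fun_pair.
Qed.

Lemma ball_cutM k (c f : euc R n -> R[i]) :
  ball_cut k (fun x => c x * f x) = (fun x => c x * ball_cut k f x).
Proof. by apply/funext => x; rewrite /ball_cut; case: ifP; rewrite ?mulr0. Qed.

(** Reduction to truncated data: only truncations of the Fourier transform of
    [psi] enter, for which the propagator is an absolutely convergent integral. *)
Lemma strichartz_int_le psi (B : \bar R) : (0 < n)%N ->
  let phi := fourierL2 (- 1) psi in
  (forall k, (\int[mu]_t \int[leb n]_y
     (cmod (schroedinger_integral (ball_cut k phi) (t, y)) `^
        strichartz_exponent n)%:E <= B)%E) ->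
  (strichartz_int psi <=
    (((2 * pi) `^ (- (n%:R / 2))) `^ strichartz_exponent n)%:E * B)%E.
Proof.
move=> n0 phi phiB; set q : R := strichartz_exponent n.
have q0 : 0 < q by rewrite addr_gt0// divr_gt0// ltr0n.
have phi2 : inL2 (leb n) phi by exact: fourierL2_inL2.
set C : R := (2 * pi) `^ (- (n%:R / 2)).
pose S k (z : measurableTypeR R * euc R n) :=
  cmod (schroedinger_integral (ball_cut k phi) z) `^ q.
pose F k (t : measurableTypeR R) := ((C `^ q)%:E * \int[leb n]_y (S k (t, y))%:E)%E.
have mS k : measurable_fun setT (S k).
  apply: measurable_cmod_powR.
  apply: (cmeasurable_cint_param (leb n) (cmeasurable_schroedinger_phase _)).
  exact/cmeasurable_ball_cut/phi2.1.
have F0 k t : (0 <= F k t)%E.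
  apply: mule_ge0; first by rewrite lee_fin powR_ge0.
  by apply: integral_ge0 => y _; rewrite lee_fin powR_ge0.
have mF k : measurable_fun setT (F k).
  apply: measurable_funeM.
  apply: (measurable_fun_fubini_tonelli_F (m2 := leb n) (EFin \o S k)).
    exact/measurable_EFinP.
  by move=> z; rewrite lee_fin powR_ge0.
apply: (@le_trans _ _ (\int[mu]_t limn_einf (F^~ t))%E); last first.
  apply: le_trans (fatou mu measurableT mF _) _ => //.
  apply: limn_einf_le => k; rewrite ge0_integralZl//; last 3 first.
  - apply: (measurable_fun_fubini_tonelli_F (m2 := leb n) (EFin \o S k)).
      exact/measurable_EFinP.
    by move=> z; rewrite lee_fin powR_ge0.
  - by move=> t _; apply: integral_ge0 => y _; rewrite lee_fin powR_ge0.
  - by rewrite lee_fin powR_ge0.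
  rewrite lee_pmul2l ?lte_fin ?powR_gt0 ?mulr_gt0 ?pi_gt0//.
  exact: phiB.
apply: ge0_integral_mono => t.
  by apply: integral_ge0 => x _; rewrite lee_fin powR_ge0.
have einf0 : (0 <= limn_einf (F^~ t))%E.
  rewrite limn_einf_lim; apply: lime_ge; first exact: is_cvg_einfs.
  by apply: nearW => k; apply: le_ereal_inf_tmp => _ [j /= _ <-].
apply/lee_addgt0Pr => e e0; rewrite /schroedinger -/phi.
apply: fourierL2_powR_le => //; first by rewrite adde_ge0// lee_fin ltW.
  apply: cmeasurableM phi2.1.
  apply: (cmeasurable_cis (t := fun xi => - ((t : R) * dot xi xi / 2))).
  apply: measurableT_comp => //; apply: measurable_funM => //.
  apply: measurable_funM => //.
  apply: (measurableT_comp (@measurable_dot_pair R n) (g := fun xi => (xi, xi))).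
  exact: measurable_fun_pair.
move=> K.
have FE k : F k t = (\int[leb n]_x (cmod (fourier_int 1 (leb n) (ball_cut k
     (fun xi => cis (- (t * dot xi xi / 2)) * phi xi)%R) x) `^ q)%:E)%E.
  rewrite /F -ge0_integralZl//; last 3 first.
  - apply/measurable_EFinP; apply: (measurableT_comp (mS k)).
    exact: pair1_measurable.
  - by move=> y _; rewrite lee_fin powR_ge0.
  - by rewrite lee_fin powR_ge0.
  apply: eq_integral => y _; rewrite -EFinM /S -powRM ?powR_ge0 ?cmod_ge0//.
  congr EFin; congr (_ `^ q); rewrite cmod_fourier_int; congr (C * cmod _).
  rewrite ball_cutM; congr (cint _ _).
  by apply/funext => xi; rewrite [RHS]mulrA -cisD mul1r /= mulrA addrC.
have [->|] := eqVneq (limn_einf (F^~ t)) +oo%E.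
  by exists K; rewrite // addye ?leey.
move=> finE; have [] := @einf_frequently R (F^~ t) (limn_einf (F^~ t) + e%:E)%E _ K.
  by rewrite lteDl ?lte_fin// ge0_fin_numE// ltey.
by move=> k Kk Fk; exists k => //; rewrite -FE.
Qed.

End FourierBound.

Section NullFunctions.
Context {R : realType} {d : measure_display} {T : measurableType d}.
Variable m : {measure set T -> \bar R}.
Implicit Types f g : T -> R[i].

Lemma cmod_eq0 (z : R[i]) : cmod z = 0 -> z = 0.
Proof.
move=> z0; have := sqr_cmod z; rewrite z0 expr0n/= => /esym/eqP.
rewrite paddr_eq0 ?sqr_ge0// !sqrf_eq0 => /andP[/eqP zr /eqP zi].
exact: complex_eq.
Qed.

Lemma L2sq_eq0 g : cmeasurable g -> (L2sq m g = 0)%E -> ae_zero m g.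
Proof.
move=> mg g0; have mg2 : measurable_fun setT (fun x => (cmod (g x) ^+ 2)%:E).
  exact/measurable_EFinP/measurable_cmod_sqr.
have : ae_eq m setT (fun x => (cmod (g x) ^+ 2)%:E) (cst 0%E).
  apply/(ae_eq_integral_abs m measurableT mg2).
  by rewrite -[RHS]g0; apply: eq_integral => x _; rewrite gee0_abs// lee_fin sqr_ge0.
apply: filterS => x /(_ I) /eqP; rewrite eqe sqrf_eq0 => /eqP.
exact: cmod_eq0.
Qed.

Lemma ae_zero_L2sq g : cmeasurable g -> ae_zero m g -> (L2sq m g = 0)%E.
Proof.
move=> mg g0; rewrite /L2sq -[RHS](integral0 m setT).
apply: ae_eq_integral => //.
  exact/measurable_EFinP/measurable_cmod_sqr.
apply: filterS g0 => x -> _.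
by rewrite cmod_real normr0 expr0n.
Qed.

Lemma cint_ae_zero g : cmeasurable g -> ae_zero m g -> cint m g = 0.
Proof.
move=> [mr mi] g0; apply: complex_eq; rewrite /cint /= /Rintegral.
  rewrite (ae_eq_integral (cst 0%E))//.
  - by rewrite integral0.
  - exact/measurable_EFinP.
  - by apply: filterS g0 => x -> _.
rewrite (ae_eq_integral (cst 0%E))//.
- by rewrite integral0.
- exact/measurable_EFinP.
- by apply: filterS g0 => x -> _.
Qed.

Lemma L2sqZ (c : R[i]) g : cmeasurable g ->
  (L2sq m (fun x => c * g x)%R = (cmod c ^+ 2)%:E * L2sq m g)%E.
Proof.
move=> mg; rewrite -ge0_integralZl//.
- by apply: eq_integral => x _; rewrite -EFinM cmodM exprMn.
- exact/measurable_EFinP/measurable_cmod_sqr.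
- by move=> x _; rewrite lee_fin sqr_ge0.
- by rewrite lee_fin sqr_ge0.
Qed.

End NullFunctions.

(** * Concentrated functions bound the Strichartz constant *)

Section Normalization.
Context {R : realType} {n : nat}.
Hypothesis n0 : (0 < n)%N.
Local Notation leb := (lebesgue_euc R).
Local Notation surf := (@surface_measure R n.+1).
Local Notation q := (st_exponent n.+1 : R).
Implicit Types (g phi psi : euc R n -> R[i]) (w : euc R n.+1).

Lemma st_exponent_gt0 : 0 < q.
Proof. by rewrite st_exponentS// addr_gt0// divr_gt0// ltr0n. Qed.

Lemma cap_pairZ (r : R) g :
  cap_pair (fun v => (r%:C)%C * g v) = (fun w => (r%:C)%C * cap_pair g w).
Proof.
by apply/funext => w; apply: complex_eq; rewrite /cap_pair ?ReM ?ImM /=; ring.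
Qed.

Lemma extension_int_cap_pairZ (r : R) g : 0 <= r -> cintegrable (leb n) g ->
  (extension_int (cap_pair (fun v => (r%:C)%C * g v)%R) =
   (r `^ q)%:E * extension_int (cap_pair g))%E.
Proof.
move=> r0 ig; have mg := cintegrable_cmeasurable ig.
rewrite /extension_int -ge0_integralZl//.
- apply: eq_integral => x _; rewrite -EFinM -powRM ?cmod_ge0//; congr (_ `^ _)%:E.
  rewrite !extension_cap_pair ?cap_integralZ//; last exact: cintegrableZ.
  rewrite ReM /= mul0r subr0 mulrCA [in RHS]mulrCA; congr (_ * _).
  by rewrite normrM (ger0_norm r0).
- under eq_fun do rewrite extension_cap_pair//.
  apply/measurable_EFinP; apply: (measurableT_comp (measurable_powR _)).
  apply: measurable_funM => //; apply: measurableT_comp => //.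
  by apply: measurable_funM => //; have [] := cmeasurable_cap_integral mg.
- by move=> x _; rewrite lee_fin powR_ge0.
- by rewrite lee_fin powR_ge0.
Qed.

Lemma extension_int_null g : cintegrable (leb n) g ->
  (L2sq surf (cap_pair g) = 0)%E -> (extension_int (cap_pair g) = 0)%E.
Proof.
move=> ig; have mg := cintegrable_cmeasurable ig.
move=> /(L2sq_eq0 (cmeasurable_cap_pair mg)) f0.
rewrite /extension_int integral0_eq// => x _.
rewrite /extension cmod_fourier_int cint_ae_zero ?cmod_real ?normr0 ?mulr0 ?powR0//.
- by rewrite gt_eqF// st_exponent_gt0.
- apply: cmeasurableM (cmeasurable_cap_pair mg).
  apply: cmeasurable_cis; apply: measurable_funM => //; exact: measurable_dotl.
- by apply: filterS f0 => w ->; rewrite mulr0.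
Qed.

(** [f] vanishes off the double cone of aperture [dl] about the polar axis. *)
Definition concentrated (dl : R) (f : euc R n.+1 -> R[i]) :=
  forall w, dl * `|head w| < enorm (tail w) -> f w = 0.

(** Both sides are homogeneous in [g], which reduces to norm one; a null function
    has zero extension. *)
Lemma concentrated_bound (dl : R) (B : \bar R) g (D : R) : (0 <= B)%E ->
  (forall f, inL2 surf f -> L2norm surf f = 1%E -> concentrated dl f ->
     (extension_int f <= B)%E) ->
  cintegrable (leb n) g -> concentrated dl (cap_pair g) ->
  (L2sq surf (cap_pair g) <= D%:E)%E ->
  (extension_int (cap_pair g) <= (D `^ (q / 2))%:E * B)%E.
Proof.
move=> B0 unitB ig cg; have mg := cintegrable_cmeasurable ig.
have mf := cmeasurable_cap_pair mg.
have := L2sq_ge0 surf (cap_pair g).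
case E : (L2sq surf (cap_pair g)) => [l| |]//; rewrite !lee_fin.
rewrite le_eqVlt => /predU1P[l0 _|l0 lD].
  by rewrite extension_int_null -?l0 ?E -?l0// mule_ge0// lee_fin powR_ge0.
pose r := (Num.sqrt l)^-1.
have s0 : 0 < Num.sqrt l by rewrite sqrtr_gt0.
have r0 : 0 < r by rewrite invr_gt0.
have fE : L2sq surf (cap_pair (fun v => (r%:C)%C * g v)) = 1%E.
  rewrite cap_pairZ L2sqZ// E -EFinM cmod_real ger0_norm ?(ltW r0)//.
  by rewrite exprVn sqr_sqrtr ?(ltW l0)// mulVf// gt_eqF.
have := unitB (cap_pair (fun v => (r%:C)%C * g v)).
rewrite extension_int_cap_pairZ ?(ltW r0)// => /(_ _ _ _)/le_trans - fB.
have -> : extension_int (cap_pair g) =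
    ((Num.sqrt l `^ q)%:E * ((r `^ q)%:E * extension_int (cap_pair g)))%E.
  rewrite muleA -EFinM -powRM ?(ltW s0) ?(ltW r0)// mulfV ?gt_eqF//.
  by rewrite powR1 mul1e.
apply: (@le_trans _ _ ((Num.sqrt l `^ q)%:E * B)%E).
  rewrite lee_pmul2l ?lte_fin ?powR_gt0//; apply: fB => //.
  - split.
      apply: cmeasurable_cap_pair.
      exact: (cintegrable_cmeasurable (cintegrableZ _ ig)).
    by apply: L2norm_fin; rewrite fE ltry.
  - by rewrite L2normE fE poweR1r.
  - by rewrite cap_pairZ => w /cg ->; rewrite mulr0.
rewrite lee_wpmul2r// lee_fin -powR12_sqrt ?(ltW l0)// -powRrM mulrC.
have q2 : 0 <= q / 2 by rewrite divr_ge0// ltW// st_exponent_gt0.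
by apply: ge0_ler_powR; rewrite ?nnegrE ?(ltW l0) ?q2 ?(le_trans (ltW l0) lD).
Qed.

End Normalization.

Section Concentrated.
Context {R : realType} {n : nat}.
Hypothesis n0 : (0 < n)%N.
Local Notation leb := (lebesgue_euc R).
Local Notation mu := (@lebesgue_measure R).
Local Notation surf := (@surface_measure R n.+1).
Local Notation q := (st_exponent n.+1 : R).
Implicit Types (g phi psi : euc R n -> R[i]) (w : euc R n.+1).

Lemma concentrated_rescale k (dl e : R) phi (z : R[i]) : 0 < e -> k%:R * e <= dl ->
  concentrated dl (cap_pair (fun v => z * rescale e (ball_cut k phi) v)).
Proof.
move=> e0 ke w wdl; have [h0|h0] := eqVneq (head w) 0.
  by rewrite /cap_pair h0 sgr0 expr0n !mul0r.
have hp : 0 < `|head w| by rewrite normr_gt0.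
rewrite /cap_pair /rescale /ball_cut ifF ?mulr0 ?mul0r//=; last first.
  apply/negbTE; rewrite -ltNge !enorm_escale normfV (gtr0_norm e0) normfV.
  rewrite mulrCA ltr_pdivlMl// mulrC ltr_pdivlMl//.
  by apply: le_lt_trans wdl; rewrite mulrA ler_pM2r// mulrC.
Qed.

Lemma L2sq_rescale (e : R) phi : 0 < e -> cmeasurable phi ->
  (L2sq (leb n) (rescale e phi) = (e ^+ n)%:E * L2sq (leb n) phi)%E.
Proof.
move=> e0 mp; rewrite /L2sq (ge0_integral_escale (c := e^-1)
  (F := fun x => (cmod (phi x) ^+ 2)%:E))//.
- by rewrite gtr0_norm ?invr_gt0// exprVn invrK.
- by rewrite invr_eq0 gt_eqF.
- exact/measurable_EFinP/measurable_cmod_sqr.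
- by move=> x; rewrite lee_fin sqr_ge0.
Qed.

Lemma cmeasurable_rescale (e : R) phi : cmeasurable phi -> cmeasurable (rescale e phi).
Proof. exact: (cmeasurable_comp (@measurable_escale R n e^-1)). Qed.

Lemma cap_density_ge0 (z : R[i]) (v : euc R n) : 0 <= 2 * cmod z ^+ 2 * bracket v ^- n.+1.
Proof.
have /andP[b0 _] := bracketV_itv n.+1 v.
by apply: mulr_ge0 => //; rewrite mulr_ge0 ?sqr_ge0.
Qed.

Lemma L2sq_cap_rescale_le (e a : R) phi : 0 < e -> cmeasurable phi ->
  (L2sq surf (cap_pair (fun v => cis a * rescale e phi v)%R) <=
   (2 * e ^+ n)%:E * L2sq (leb n) phi)%E.
Proof.
move=> e0 mp; have mr := cmeasurable_rescale e mp.
rewrite L2sq_cap_pair; last first.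
  apply: (cmeasurableM _ mr); split; exact: measurable_cst.
rewrite EFinM -muleA -L2sq_rescale// -ge0_integralZl//; last 2 first.
- exact/measurable_EFinP/measurable_cmod_sqr.
- by move=> x _; rewrite lee_fin sqr_ge0.
apply: ge0_integral_mono => v; first by rewrite lee_fin cap_density_ge0.
have /andP[_ b1] := bracketV_itv n.+1 v.
by rewrite -EFinM lee_fin cmodM cmod_cis mul1r ler_piMr// mulr_ge0 ?sqr_ge0.
Qed.

Lemma L2sq_ball_cut1_fin k : (L2sq (leb n) (ball_cut k (fun=> 1%R)) < +oo)%E.
Proof.
pose a : R := expR (k%:R *+ n).
have a0 : (0 <= a%:E)%E by rewrite lee_fin expR_ge0.
apply: (@le_lt_trans _ _ (\int[leb n]_x (a%:E * (laplace 1 x)%:E))%E).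
  apply: ge0_integral_mono => x; first by rewrite lee_fin sqr_ge0.
  rewrite -EFinM lee_fin /ball_cut; case: ifP => xk.
    by rewrite cmod_real normr1 expr1n; exact: ball_le_laplace.
  by rewrite cmod_real normr0 expr0n mulr_ge0 ?expR_ge0 ?laplace_ge0.
rewrite ge0_integralZl//.
- by rewrite integral_laplace// -EFinM ltry.
- by apply/measurable_EFinP; exact: measurable_laplace.
- by move=> x _; rewrite lee_fin laplace_ge0.
Qed.

(** The exponential weight has positive integral, so some ball has positive
    measure. *)
Lemma ball_cut1_neq0 : exists k, (L2sq (leb n) (ball_cut k (fun=> 1%R)) != 0)%E.
Proof.
apply: contrapT => /forallNP allk.
have b0 k : (L2sq (leb n) (ball_cut k (fun=> 1%R)) = 0)%E.
  by apply/eqP; apply: contrapT => h; apply: (allk k); apply/negP.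
have m1 : cmeasurable (fun _ : euc R n => 1 : R[i]) by exact: cmeasurable_cst.
have : (\int[leb n]_x (laplace (1 : R) x)%:E <= 0)%E.
  apply: (@fatou_le _ _ _ _
    (fun k x => laplace 1 x * cmod (ball_cut k (fun=> 1) x) ^+ 2)).
  - move=> k; apply: measurable_funM; first exact: measurable_laplace.
    exact/measurable_cmod_sqr/cmeasurable_ball_cut.
  - by move=> k x; rewrite mulr_ge0 ?laplace_ge0 ?sqr_ge0.
  - move=> x; apply: cvg_near_cst; near=> k.
    rewrite /ball_cut ifT; last by near: k; exact: nbhs_infty_ger.
    by rewrite cmod_real normr1 expr1n mulr1.
  - move=> k; rewrite -(b0 k); apply: ge0_integral_mono => x.
      by rewrite lee_fin mulr_ge0 ?laplace_ge0 ?sqr_ge0.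
    rewrite lee_fin ler_piMl ?sqr_ge0//.
    apply: prodr_ile1 => i _; rewrite laplace1_ge0 /laplace1/=.
    by rewrite -[leRHS]expR0 ler_expR oppr_le0 mulr_ge0.
by rewrite integral_laplace// divr1 lee_fin leNgt exprn_gt0.
Unshelve. all: by end_near. Qed.

(** A dilated ball of positive measure, lifted to a pair of caps. *)
Lemma concentrated_exists (dl : R) : 0 < dl ->
  exists f, [/\ inL2 surf f, L2norm surf f = 1%E & concentrated dl f].
Proof.
move=> dl0; have [k kn0] := ball_cut1_neq0.
have m1 : cmeasurable (fun _ : euc R n => 1 : R[i]) by exact: cmeasurable_cst.
pose e := dl / k.+1%:R; have e0 : 0 < e by rewrite divr_gt0.
pose g : euc R n -> R[i] := rescale e (ball_cut k (fun=> 1)).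
have mg : cmeasurable g by exact/cmeasurable_rescale/cmeasurable_ball_cut.
have mf := cmeasurable_cap_pair mg.
have gfin : (L2sq surf (cap_pair g) < +oo)%E.
  have := L2sq_cap_rescale_le 0 e0 (cmeasurable_ball_cut k m1).
  rewrite (_ : (fun v => _) = g); last first.
    by apply/funext => v; rewrite /cis cos0 sin0 mul1r.
  move/le_lt_trans; apply; rewrite lte_mul_pinfty ?lee_fin ?mulr_ge0 ?exprn_ge0 ?(ltW e0)//.
  exact: L2sq_ball_cut1_fin.
have gn0 : (L2sq surf (cap_pair g) != 0)%E.
  apply/negP => /eqP; rewrite L2sq_cap_pair// => g0.
  have mw : measurable_fun setT
      (fun v => (2 * cmod (g v) ^+ 2 * bracket v ^- n.+1)%:E).
    apply/measurable_EFinP; apply: measurable_funM; last exact: measurable_bracketV.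
    by apply: measurable_funM => //; exact: measurable_cmod_sqr.
  have aeg : ae_zero (leb n) g.
    have : ae_eq (leb n) setT
        (fun v => (2 * cmod (g v) ^+ 2 * bracket v ^- n.+1)%:E) (cst 0%E).
      apply/(ae_eq_integral_abs (leb n) measurableT mw).
      rewrite -[RHS]g0; apply: eq_integral => v _.
      by rewrite gee0_abs// lee_fin cap_density_ge0.
    apply: filterS => v /(_ I) /eqP; rewrite eqe !mulf_eq0 pnatr_eq0/= invr_eq0.
    rewrite orbb (gt_eqF (exprn_gt0 _ (bracket_gt0 v))) orbF.
    by move/eqP/cmod_eq0.
  have := ae_zero_L2sq mg aeg.
  rewrite L2sq_rescale//; last exact: cmeasurable_ball_cut.
  by move/eqP; rewrite mule_eq0 (negPf kn0) orbF eqe expf_eq0 [e == 0]gt_eqF// andbF.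
case E : (L2sq surf (cap_pair g)) gfin gn0 (L2sq_ge0 surf (cap_pair g)) => [l| |]// _.
rewrite eqe lee_fin => l0 l1; have lp : 0 < l by rewrite lt_neqAle eq_sym l0.
pose r := (Num.sqrt l)^-1.
have fE : L2sq surf (fun w => (r%:C)%C * cap_pair g w) = 1%E.
  rewrite L2sqZ// E -EFinM cmod_real real_normK ?num_real//.
  by rewrite exprVn sqr_sqrtr// mulVf.
exists (fun w => (r%:C)%C * cap_pair g w); split.
- split; first by apply: cmeasurableM mf; split; exact: measurable_cst.
  by apply: L2norm_fin; rewrite fE ltry.
- by rewrite L2normE fE poweR1r.
- have gE : g = (fun v => 1 * g v) by apply/funext => v; rewrite mul1r.
  have ke : k%:R * e <= dl.
    by rewrite mulrCA ger_pMr// ler_pdivrMr// mul1r ler_nat.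
  rewrite gE => w wdl.
  by rewrite (concentrated_rescale (fun=> 1) 1 e0 ke wdl) mulr0.
Qed.

Section LowerBound.
Variables (dl : R) (B : \bar R).
Hypothesis dl0 : 0 < dl.
Hypothesis B0 : (0 <= B)%E.
Hypothesis unitB : forall f, inL2 surf f -> L2norm surf f = 1%E ->
  concentrated dl f -> (extension_int f <= B)%E.

Let C' : R := (2 * pi) `^ (- (n.+1%:R / 2)).

(** The truncated data lie in the ball of radius [k], so that cap radii below
    [dl / (k + 1)] keep the functions concentrated.  The squared norm of the
    caps is at most [2 * e ^+ n * P], and [n * q / 2 = n + 2] gives the power of
    [e] required by [concentration_bound]. *)
Lemma schroedinger_integral_le phi k (P : R) : 0 <= P -> inL2 (leb n) phi ->
  (L2sq (leb n) phi <= P%:E)%E ->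
  (((C' * 2) `^ q)%:E *
   \int[mu]_(t in `[(- (pi / 2))%R, (pi / 2)%R]) (`|cos t| `^ q)%:E *
   \int[mu]_t \int[leb n]_y
     (cmod (schroedinger_integral (ball_cut k phi) (t, y)) `^ q)%:E <=
   pi%:E * (((2 * P) `^ (q / 2))%:E * B))%E.
Proof.
move=> P0 phi2 phiP; set f := ball_cut k phi.
have jf : cintegrable (leb n) f by exact: cintegrable_ball_cut.
have mf := cintegrable_cmeasurable jf.
pose e j : R := dl / k.+1%:R * harmonic j.
have e0 j : 0 < e j by rewrite mulr_gt0 ?divr_gt0// invr_gt0.
apply: (concentration_bound (e := e)) => //.
  rewrite -[X in _ --> X](mulr0 (dl / k.+1%:R)).
  by apply: cvgM; [exact: cvg_cst|exact: cvg_harmonic].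
move=> j a; have ej0 := e0 j.
have jr : cintegrable (leb n) (fun v => cis a * rescale (e j) f v).
  exact/cintegrableZ/cintegrable_rescale.
have ke : k%:R * e j <= dl.
  rewrite [leLHS](_ : _ = dl * (k%:R / k.+1%:R * j.+1%:R^-1)); last first.
    by rewrite -[e j]/(dl / k.+1%:R * j.+1%:R^-1) -!mulrA mulrCA.
  rewrite ger_pMr// mulr_ile1 ?divr_ge0//.
    by rewrite ler_pdivrMr// mul1r ler_nat.
  by rewrite invf_le1// ler1n.
have L2r : (L2sq surf (cap_pair (fun v => cis a * rescale (e j) f v)%R) <=
    (e j ^+ n * (2 * P))%:E)%E.
  apply: (le_trans (L2sq_cap_rescale_le a ej0 mf)).
  rewrite [(e j ^+ n * (2 * P))%R]mulrCA mulrA [leRHS]EFinM lee_pmul2l ?lte_fin ?mulr_gt0 ?exprn_gt0//.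
  exact: le_trans (L2sq_ball_cut _ phi2.1) phiP.
have := concentrated_bound n0 B0 unitB jr (concentrated_rescale _ _ ej0 ke) L2r.
rewrite powRM ?exprn_ge0 ?(ltW ej0) ?mulr_ge0//.
suff -> : (e j ^+ n) `^ (q / 2) = e j ^+ (n + 2) by rewrite EFinM muleA.
rewrite -!powR_mulrn ?(ltW ej0)// -powRrM; congr (_ `^ _).
rewrite st_exponentS// /strichartz_exponent natrD.
by field; rewrite pnatr_eq0 -lt0n.
Qed.

Let C : R := (2 * pi) `^ (- (n%:R / 2)).
Let s : R := (2 * pi) `^ (- ((n%:R + 2) / n%:R)).
Let ratio : R := Gamma ((q + 1) / 2) / Gamma ((q + 2) / 2).

(** All powers of [2 * pi] and of the norm [P] cancel. *)
Let constant_eq (a P : R) : 0 < a -> 0 < P ->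
  s * (P `^ (- (q / 2)) *
   (C `^ q * (((C' * 2) `^ q * a)^-1 * (pi * (2 * P) `^ (q / 2))))) =
  pi / (2 `^ (q / 2) * a).
Proof.
move=> a0 P0; set x : R := 2 * pi.
have x0 : 0 < x by rewrite mulr_gt0// pi_gt0.
have sE : s = x `^ (- (q / 2)).
  rewrite /s st_exponentS// /strichartz_exponent; congr (_ `^ _).
  by field; rewrite pnatr_eq0 -lt0n.
have CE : C `^ q = x `^ (q / 2) * C' `^ q.
  rewrite /C /C' -!powRrM -powRD ?(gt_eqF x0) ?implybT//; congr (_ `^ _).
  by rewrite -natr1; field.
rewrite sE CE [(C' * 2) `^ q]powRM ?powR_ge0// [(2 * P) `^ _]powRM// ?(ltW P0)//.
have y0 : 0 < x `^ (q / 2) by rewrite powR_gt0.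
have c0 : 0 < C' `^ q by rewrite !powR_gt0.
have p0 : 0 < P `^ (q / 2) by rewrite powR_gt0.
have t0 : 0 < 2 `^ (q / 2) :> R by rewrite powR_gt0.
rewrite !powRN.
have -> : 2 `^ q = 2 `^ (q / 2) * 2 `^ (q / 2) :> R.
  rewrite -powRD; first by rewrite -splitr.
  by rewrite pnatr_eq0 implybT.
by field; rewrite !gt_eqF.
Qed.

(** Each datum [psi] is transplanted to caps through truncations of its Fourier
    transform; the mean value [a] of [|cos|^q] dominates the Gamma quotient. *)
Lemma strichartz_le_concentrated :
  ((2 `^ (q / 2) / Num.sqrt pi * ratio)%:E * strichartz n <= B)%E.
Proof.
have q0 : 0 < q by exact: st_exponent_gt0.
have [a a0 aE] := integral_cos_fin q0.
have Ga : Num.sqrt pi * ratio <= a.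
  by have := gamma_ratio_le_cos q0; rewrite aE lee_fin.
have G0 : 0 <= ratio.
  by rewrite divr_ge0//; apply: Rintegral_ge0 => t _;
    rewrite mulr_ge0 ?powR_ge0 ?expR_ge0.
have pi0 : 0 < Num.sqrt (pi : R) by rewrite sqrtr_gt0 pi_gt0.
(* If the mean vanished, so would the constant on the left. *)
move: a0; rewrite le_eqVlt => /predU1P[az|a0].
  have -> : ratio = 0.
    by apply/eqP; rewrite eq_le G0 andbT -(pmulr_rle0 _ pi0) az.
  by rewrite mulr0 mul0e.
set c : R := _ * ratio.
have c0 : 0 <= c by rewrite mulr_ge0// divr_ge0 ?powR_ge0 ?(ltW pi0).
have s0 : 0 < s by rewrite powR_gt0// mulr_gt0// pi_gt0.
pose kappa : R := pi / (2 `^ (q / 2) * a).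
have cK : c * kappa <= 1.
  have t0 : 0 < 2 `^ (q / 2) :> R by rewrite powR_gt0.
  have -> : c * kappa = Num.sqrt pi * ratio / a.
    rewrite /c /kappa -[X in X / (_ * a)](sqr_sqrtr (pi_ge0 R)).
    by field; rewrite !gt_eqF.
  by rewrite ler_pdivrMr// mul1r.
apply: (@le_trans _ _ ((c * kappa)%:E * B)%E); last first.
  by rewrite -[leRHS]mul1e lee_wpmul2r.
rewrite [X in (X * B)%E]EFinM -muleA lee_wpmul2l ?lee_fin//.
rewrite /strichartz -/s -lee_pdivlMl//.
apply: ge_ereal_sup => _ [psi [psi2 psin0] <-].
have mpsi := psi2.1.
have [P PE E] : exists2 P : R, 0 <= P & L2sq (leb n) psi = P%:E.
  have := L2sq_fin psi2.2; have := L2sq_ge0 (leb n) psi.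
  by case: (L2sq (leb n) psi) => [P| |]//; rewrite lee_fin => P0 _; exists P.
have P0 : 0 < P.
  rewrite lt_neqAle PE andbT; apply/eqP => P0.
  by apply: psin0; apply: L2sq_eq0; rewrite // E -P0.
have qE : q = strichartz_exponent n by exact: st_exponentS.
have phiP : (L2sq (leb n) (fourierL2 (- 1) psi) <= P%:E)%E.
  by rewrite -E; apply: L2sq_fourierL2 => //; rewrite sqrrN expr1n.
set d : R := (C' * 2) `^ q * a.
have d0 : 0 < d by rewrite mulr_gt0// powR_gt0// mulr_gt0// powR_gt0// mulr_gt0// pi_gt0.
have stB : (strichartz_int psi <= (C `^ q)%:E *
    ((d^-1 * (pi * (2 * P) `^ (q / 2)))%:E * B))%E.
  rewrite qE; apply: strichartz_int_le => // k; rewrite -qE.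
  rewrite EFinM -muleA lee_pdivlMl// [in leRHS]EFinM -[leRHS]muleA.
  have := schroedinger_integral_le k (ltW P0) (fourierL2_inL2 (- 1) psi) phiP.
  by rewrite aE -EFinM.
rewrite -qE L2normE E !poweR_EFin -powRrM mulrN [(2^-1 * q)%R]mulrC.
have w0 : 0 <= P `^ (- (q / 2)) by exact: powR_ge0.
apply: (@le_trans _ _ ((P `^ (- (q / 2)))%:E * ((C `^ q)%:E *
    ((d^-1 * (pi * (2 * P) `^ (q / 2)))%:E * B)))%E).
  by rewrite lee_wpmul2l.
rewrite !muleA -!EFinM -mulrA lee_wpmul2r// lee_fin.
by rewrite -(ler_pM2l s0) [leLHS]constant_eq// mulVKf// gt_eqF.
Qed.

End LowerBound.

End Concentrated.

(** * Concentrating sequences are not precompact *)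

Section Poles.
Context {R : realType} {n : nat}.
Hypothesis n0 : (0 < n)%N.
Local Notation leb := (lebesgue_euc R).
Local Notation surf := (@surface_measure R n.+1).
Local Notation q := (st_exponent n.+1 : R).
Implicit Types (w : euc R n.+1) (f g : euc R n.+1 -> R[i]).

(** The origin is invariant under dilations, and dilation by 2 multiplies finite
    volumes by 2^n > 1. *)
Lemma origin_null : (L2sq (leb n) (ball_cut 0 (fun=> 1%R)) = 0)%E.
Proof.
set o : euc R n -> R[i] := ball_cut 0 (fun=> 1).
have m1 : cmeasurable (fun _ : euc R n => 1 : R[i]) by exact: cmeasurable_cst.
have oE : rescale 2 o = o.
  apply/funext => v; rewrite /rescale /o /ball_cut enorm_escale.
  by rewrite pmulr_rle0// normr_gt0 invr_eq0.
have := L2sq_rescale (ltr0Sn R 1) (cmeasurable_ball_cut 0 m1); rewrite -/o oE.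
have := L2sq_ball_cut1_fin (R := R) (n := n) 0; rewrite -/o.
have := L2sq_ge0 (leb n) o.
case: (L2sq (leb n) o) => [r| |]// _ _; rewrite -EFinM => h.
have rE := EFin_inj h.
congr EFin; apply/eqP; have : (2 ^+ n - 1) * r = 0 by rewrite mulrBl -rE mul1r subrr.
move/eqP; rewrite mulf_eq0 subr_eq0 => /orP[|//].
by rewrite gt_eqF// exprn_egt1// ?ltr1n// -lt0n.
Qed.

(** In the gnomonic coordinate the poles are the origin. *)
Lemma ae_off_poles : {ae surf, forall w, 0 < enorm (tail w)}.
Proof.
pose p w : R[i] := if enorm (tail w) <= 0 then 1 else 0.
have mp : cmeasurable p.
  have mb : measurable_fun setT (fun w => enorm (tail w) <= 0).
    apply: measurable_fun_ler => //.
    exact: (measurableT_comp measurable_enorm measurable_tail).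
  have E w : complex.Re (p w) = if enorm (tail w) <= 0 then 1 else 0.
    by rewrite /p; case: ifP.
  have E' w : complex.Im (p w) = 0 by rewrite /p; case: ifP.
  split; last by (under eq_fun do rewrite E'); exact: measurable_cst.
  by under eq_fun do rewrite E; apply: measurable_fun_ifT.
have m1 : cmeasurable (fun _ : euc R n => 1 : R[i]) by exact: cmeasurable_cst.
have p0 : (L2sq surf p = 0)%E.
  rewrite /L2sq surface_integral_gnomonic//; first last.
  - by move=> w; rewrite lee_fin sqr_ge0.
  - exact/measurable_EFinP/measurable_cmod_sqr.
  have pE (c : R) v : c != 0 -> p (escale c (lift1 v)) = ball_cut 0 (fun=> 1) v.
    move=> c0; rewrite /p; have [_ ->] := escale_coords c v.
    by rewrite enorm_escale pmulr_rle0// normr_gt0.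
  have b0 v : (bracket v)^-1 != 0 by rewrite invr_eq0 gt_eqF// bracket_gt0.
  apply/eqP; rewrite eq_le integral_ge0 ?andbT; last first.
    move=> v _; rewrite -EFinD -EFinM lee_fin mulr_ge0 ?addr_ge0 ?sqr_ge0//.
    by have /andP[] := bracketV_itv n.+1 v.
  rewrite -[leRHS](mule0 (2%:E : \bar R)) -[X in (2%:E * X)%E]origin_null.
  rewrite -ge0_integralZl//; last 2 first.
  - exact/measurable_EFinP/measurable_cmod_sqr/cmeasurable_ball_cut.
  - by move=> v _; rewrite lee_fin sqr_ge0.
  apply: ge0_integral_mono => v; have /andP[b1 b2] := bracketV_itv n.+1 v.
    by rewrite -EFinD -EFinM lee_fin mulr_ge0 ?addr_ge0 ?sqr_ge0.
  rewrite -EFinD -!EFinM lee_fin {2}/gnomonic /gnomonic /sphere_proj escaleA !pE//.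
  - by rewrite mulr_natl mulr2n ler_piMr ?addr_ge0 ?sqr_ge0.
  - by rewrite mulN1r oppr_eq0 b0.
  - exact: b0.
have := L2sq_eq0 mp p0; apply: filterS => w; rewrite /p ltNge; case: ifP => // _.
by move/eqP; rewrite oner_eq0.
Qed.

(** A limit of functions that concentrate at the poles is null: off the poles it
    agrees with zero, and the poles carry no surface measure. *)
Lemma concentrating_limit_null (h : nat -> euc R n.+1 -> R[i]) g :
  (forall j, cmeasurable (h j)) -> inL2 surf g ->
  (forall m j, (m <= j)%N -> concentrated m.+1%:R^-1 (h j)) ->
  (L2norm surf (fun w => h j w - g w)%R @[j --> \oo] --> 0)%E ->
  ae_zero surf g.
Proof.
move=> mh g2 hc hg; have mg := g2.1.
have mt : measurable_fun setT (fun w => enorm (tail w)).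
  exact: (measurableT_comp measurable_enorm measurable_tail).
have mhd : measurable_fun setT (fun w => `|head w|).
  by apply: measurableT_comp => //; exact: measurable_head.
have mg2 := measurable_cmod_sqr mg.
pose off (m : nat) w := m.+1%:R^-1 * `|head w| < enorm (tail w).
have moff m : measurable_fun setT (off m).
  by apply: measurable_fun_ltr => //; exact: measurable_funM.
pose F m w := if off m w then cmod (g w) ^+ 2 else 0.
have mF m : measurable_fun setT (F m) by exact: measurable_fun_ifT.
have F0 m w : 0 <= F m w by rewrite /F; case: ifP => // _; exact: sqr_ge0.
apply: L2sq_eq0 => //; apply/eqP; rewrite eq_le L2sq_ge0 andbT.
have -> : L2sq surf g = (\int[surf]_w
    (if (0 < enorm (tail w))%R then cmod (g w) ^+ 2 else 0)%:E)%E.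
  apply: ae_eq_integral => //.
  - exact/measurable_EFinP.
  - apply/measurable_EFinP; apply: measurable_fun_ifT => //.
    exact: measurable_fun_ltr.
  by apply: filterS ae_off_poles => w -> _.
apply: (@fatou_le _ _ _ _ F) => //.
  move=> w; apply: cvg_near_cst; near=> m; rewrite /F /off.
  have [w0|w0] := ltP 0 (enorm (tail w)).
    rewrite ifT// mulrC ltr_pdivrMr// mulrC -ltr_pdivrMr//.
    apply: (@lt_trans _ _ m%:R); last by rewrite ltr_nat.
    by near: m; exact: nbhs_infty_gtr.
  rewrite ifF//; apply/negbTE; rewrite -leNgt (le_trans w0)//.
move=> m; apply/lee_addgt0Pr => e e0; rewrite add0e.
have [K _ Ke] := cvg_L2sq hg e0.
pose j := maxn K m.
apply: (le_trans _ (Ke j _)); last by rewrite /= leq_maxl.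
apply: ge0_integral_mono => w; rewrite lee_fin// /F.
case: ifP => wm; last exact: sqr_ge0.
have -> : h j w = 0 by apply: (hc m j) => //; exact: leq_maxr.
by rewrite !sqr_cmod ReB ImB /= !sub0r !sqrrN.
Unshelve. all: by end_near. Qed.

Lemma L2sq_cis (t : euc R n.+1 -> R) f : (L2sq surf (fun w => cis (t w) * f w)%R =
  L2sq surf f)%E.
Proof. by apply: eq_integral => w _; rewrite cmodM cmod_cis mul1r. Qed.

Lemma extension_le_stein_tomas f : inL2 surf f -> L2norm surf f = 1%E ->
  (extension_int f <= stein_tomas n.+1)%E.
Proof.
move=> f2 f1; apply: ereal_sup_ubound; exists f; last by rewrite f1 poweR1r mul1e.
split => //= /(ae_zero_L2sq f2.1) /eqP.
by rewrite -L2norm_sqr f1 poweR1r eqe oner_eq0.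
Qed.

Lemma stein_tomas_ge0 : (0 <= stein_tomas n.+1 :> \bar R)%E.
Proof.
have [f [f2 f1 _]] := @concentrated_exists R n 1 ltr01.
apply: le_trans (extension_le_stein_tomas f2 f1).
by apply: integral_ge0 => x _; rewrite lee_fin powR_ge0.
Qed.

(** Otherwise [M] would be a bound to which [strichartz_le_concentrated] applies;
    a negative [M] lies below the functional of every concentrated function. *)
Lemma concentrated_competitor (dl : R) (M : \bar R) : 0 < dl ->
  (M < (2 `^ (q / 2) / Num.sqrt pi *
       (Gamma ((q + 1) / 2) / Gamma ((q + 2) / 2)))%:E * strichartz n)%E ->
  exists f, [/\ inL2 surf f, L2norm surf f = 1%E, concentrated dl f &
                (M <= extension_int f)%E].
Proof.
move=> dl0 MS; have [M0|M0] := leP 0%E M; last first.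
  have [f [f2 f1 fc]] := @concentrated_exists R n dl dl0.
  exists f; split => //; apply: (le_trans (ltW M0)).
  by apply: integral_ge0 => x _; rewrite lee_fin powR_ge0.
apply: contrapT => noF; move: MS; apply/negP; rewrite -leNgt.
apply: (strichartz_le_concentrated n0 dl0 M0) => f f2 f1 fc.
rewrite leNgt; apply/negP => /ltW Mf; apply: noF.
by exists f.
Qed.

Lemma approach_below (S : \bar R) : (0 <= S)%E -> exists M : nat -> \bar R,
  (forall j, (M j < S)%E) /\ (M j @[j --> \oo] --> S)%E.
Proof.
case: S => [r _| _|]//.
  exists (fun j => (r - harmonic j)%:E); split => [j|].
    by rewrite lte_fin ltrBlDr ltrDl invr_gt0.
  apply: cvg_EFin; first exact: nearW.
  rewrite -[X in _ --> X]subr0; apply: cvgB; first exact: cvg_cst.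
  exact: cvg_harmonic.
exists (fun j => j%:R%:E); split => [j|]; first exact: ltry.
exact/cvgenyP.
Qed.

End Poles.

Theorem mainTheorem3 (R : realType) (N : nat) (hN : (2 <= N)%N) :
  let q : R := 2 * (N%:R + 1) / (N%:R - 1) in
  let c : R := 2 `^ (q / 2) / Num.sqrt pi
               * (Gamma ((q + 1) / 2) / Gamma ((q + 2) / 2)) in
  (c%:E * strichartz N.-1 <= stein_tomas N)%E /\
  ((forall f : nat -> euc R N -> R[i],
      (forall n, inL2 surface_measure (f n)) ->
      (forall n, L2norm surface_measure (f n) = 1%E) ->
      (fun n => extension_int (f n)) @ \oo --> (stein_tomas N : \bar R) ->
      precompact_up_to_modulations f) ->
   (c%:E * strichartz N.-1 < stein_tomas N)%E).
Proof.
case: N hN => [//|n]; rewrite ltnS => n0 q c.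
have le_ST : (c%:E * strichartz n <= stein_tomas n.+1)%E.
  apply: (strichartz_le_concentrated n0 (@ltr01 R) stein_tomas_ge0) => f f2 f1 _.
  exact: extension_le_stein_tomas.
split => // compact; rewrite lt_neqAle le_ST andbT; apply/negP => /eqP eq_ST.
have [M [M_lt M_cvg]] := approach_below (@stein_tomas_ge0 R n).
have compet j : exists f : euc R n.+1 -> R[i],
    [/\ inL2 surface_measure f, L2norm surface_measure f = 1%E,
        concentrated j.+1%:R^-1 f & (M j <= extension_int f)%E].
  by apply: concentrated_competitor => //; rewrite ?invr_gt0// eq_ST.
(* Under equality the competitors on shrinking caps are maximizing. *)
have [f fP] := choice compet.
have f2 j : inL2 surface_measure (f j) by have [] := fP j.
have f1 j : L2norm surface_measure (f j) = 1%E by have [] := fP j.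
have f_max : (fun j => extension_int (f j)) @ \oo --> (stein_tomas n.+1 : \bar R).
  apply: squeeze_cvge M_cvg (cvg_cst _); apply: nearW => j.
  have [_ _ _ ->] := fP j.
  exact: extension_le_stein_tomas.
have [k [a [g [k_incr g2 h_cvg]]]] := compact f f2 f1 f_max.
pose h j w := cis (- dot (a j) w) * f (k j) w.
have mh j : cmeasurable (h j).
  apply: cmeasurableM (f2 _).1; apply: cmeasurable_cis.
  by apply: measurableT_comp => //; exact: measurable_dotl.
have k_ge j : (j <= k j)%N.
  elim: j => // j IH; exact: leq_ltn_trans IH (k_incr _ _ (ltnSn j)).
have hc m j : (m <= j)%N -> concentrated m.+1%:R^-1 (h j).
  move=> mj w wm; have [_ _ fc _] := fP (k j).
  rewrite /h fc ?mulr0//; apply: le_lt_trans wm; rewrite ler_wpM2r//.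
  by rewrite lef_pV2 ?posrE// ler_nat ltnS (leq_trans mj).
have g0 := concentrating_limit_null n0 mh g2 hc h_cvg.
(* Subtracting a null limit does not change the norm, which is one. *)
have half0 : 0 < 2^-1 :> R by rewrite invr_gt0.
have [K _ /(_ K (leqnn K)) hK] := cvg_L2sq h_cvg half0.
have : L2sq surface_measure (h K) = L2sq surface_measure (fun w => h K w - g w)%R.
  apply: ae_eq_integral => //.
  - exact/measurable_EFinP/measurable_cmod_sqr.
  - exact/measurable_EFinP/measurable_cmod_sqr/(cmeasurableB (mh K) g2.1).
  - by apply: filterS g0 => w -> _; rewrite subr0.
rewrite L2sq_cis -L2norm_sqr f1 poweR1r => hE; move: hK; rewrite /= -hE lee_fin.
by rewrite leNgt invf_lt1// ltr1n.
Qed.
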